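(* Let $d\ge2$, $A>1$, let $K\in2\mathbb N$ with $K\ge\lceil Ad\rceil$, and $M=K+d$. Let $\Theta=\{\theta_\xi\}_{\xi\in\mathcal X}$ be the real-valued system constructed in the context with parameters $d,K,M,\gamma_0$. If $\gamma_0>0$ satisfies $$\gamma_0\le\frac{\epsilon_0}{c_{42}C_9}$$ (with the constants $\epsilon_0,c_{42},C_9$ described in the context), then: (a) The synthesis operator $T_\theta h:=\sum_{\xi\in\mathcal X}h_\xi\theta_\xi$ on sequences of complex numbers $h=\{h_\xi\}_{\xi\in\mathcal X}$ is bounded as a map $T_\theta:\mathfrak b^{sq}_p\to\mathcal B^{sq}_p$, uniformly with respect to $(s,p,q)\in\mathcal Q(A)$. (b) The operator $Tf:=\sum_{\xi\in\mathcal X}\langle f,\psi_\xi\rangle\theta_\xi=T_\theta S_\psi f$ is invertible on $\mathcal B^{sq}_p$, and $T,T^{-1}$ are bounded on $\mathcal B^{sq}_p$, uniformly with respect to $(s,p,q)\in\mathcal Q(A)$. (c) For $(s,p,q)\in\mathcal Q(A)$ the dual system $\tilde\Theta=\{\tilde\theta_\xi\}_{\xi\in\mathcal X}$ consists of bounded linear functionals on $\mathcal B^{sq}_p$ defined by $$\tilde\theta_\xi(f)=\langle f,\tilde\theta_\xi\rangle:=\sum_{\eta\in\mathcal X}\langle T^{-1}\psi_\eta,\psi_\xi\rangle\langle f,\psi_\eta\rangle,\qquad f\in\mathcal B^{sq}_p,$$ with the series converging absolutely. Also, the analysis operator $S_{\tilde\theta}:\mathcal B^{sq}_p\to\mathfrak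 b^{sq}_p$, $S_{\tilde\theta}f:=\{\langle f,\tilde\theta_\xi\rangle\}_{\xi\in\mathcal X}$, satisfies $S_{\tilde\theta}=S_\psi T^{-1}T_\psi S_\psi=S_\psi T^{-1}$ and is uniformly bounded with respect to $(s,p,q)\in\mathcal Q(A)$. Moreover, $\{\theta_\xi\}$, $\{\tilde\theta_\xi\}$ form a pair of dual frames for $\mathcal B^{sq}_p$ in the following sense: for any $f\in\mathcal B^{sq}_p$ $$f=\sum_{\xi\in\mathcal X}\langle f,\tilde\theta_\xi\rangle\theta_\xi\quad\text{and}\quad\|f\|_{\mathcal B^{sq}_p}\sim\|\{\langle f,\tilde\theta_\xi\rangle\}\|_{\mathfrak b^{sq}_p},$$ where the convergence is unconditional in $\mathcal B^{sq}_p$. Furthermore, (a), (b), (c) hold true when $\mathcal B^{sq}_p,\mathfrak b^{sq}_p$ are replaced by $\mathcal F^{sq}_p,\mathfrak f^{sq}_p$, respectively.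
   Context: **Sphere.** $\mathbb S^{d-1}\subset\mathbb R^d$ is the unit sphere, $\sigma$ its surface measure, $|E|=\sigma(E)$, $\omega_d=|\mathbb S^{d-1}|$, $\rho(x,y)=\arccos(x\cdot y)$, $B(\eta,r)=\{x\in\mathbb S^{d-1}:\rho(x,\eta)<r\}$. $\mathcal H_k$: spherical harmonics of degree $k$, $\{Y_{k\nu}\}_{\nu=1}^{N(k,d)}$ a real orthonormal basis of $\mathcal H_k$ in $L^2(\mathbb S^{d-1})$, and $Z_k$ the polynomial with $Z_k(x\cdot y)=\sum_\nu Y_{k\nu}(x)Y_{k\nu}(y)$. $\mathcal S'$ is the space of distributions on $\mathbb S^{d-1}$ (dual of $C^\infty(\mathbb S^{d-1})$), $\langle f,\phi\rangle:=f(\overline\phi)$ (consistent with $\langle f,g\rangle=\int f\overline g\,d\sigma$), and $Z_k*f(x):=\langle f,Z_k(x\cdot\bullet)\rangle$. For a function $g$ on $\mathbb S^{d-1}$, $\breve g(x):=g(x/|x|)$, $x\in\mathbb R^d\setminus\{0\}$. A maximal $\delta$-net on $\mathbb S^{d-1}$ is a finite set $\mathcal Z$ with $\rho(\zeta_1,\zeta_2)\ge\delta$ for distinct $\zeta_1,\zeta_2\in\mathcal Z$ and $\bigcup_{\zeta\in\mathcal Z}B(\zeta,\delta)=\mathbb S^{d-1}$. **Function spaces.** Fix $\phi\in C^\infty(\mathbb R_+)$, $\operatorname{supp}\phi\subset[1/2,2]$, $|\phi|\ge c>0$ on $[3/5,5/3]$; $\Phi_0*f=Z_0*f$, $\Phi_j*f=\sum_k\phi(k/2^{j-1})Z_k*f$,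 $j\ge1$. For $s\in\mathbb R$, $0<p,q<\infty$, $\mathcal B^{sq}_p$ and $\mathcal F^{sq}_p$ consist of all $f\in\mathcal S'$ with finite quasi-norm $\|f\|_{\mathcal B^{sq}_p}=\big(\sum_{j\ge0}(2^{sj}\|\Phi_j*f\|_{L^p})^q\big)^{1/q}$, resp. $\|f\|_{\mathcal F^{sq}_p}=\big\|\big(\sum_{j\ge0}(2^{sj}|\Phi_j*f|)^q\big)^{1/q}\big\|_{L^p}$. $\mathcal Q(A):=\{(s,p,q):|s|\le A,\ A^{-1}\le p\le A,\ A^{-1}\le q<\infty\}$. **Needlets.** Fix real $\varphi\in C^\infty(\mathbb R_+)$ with $\operatorname{supp}\varphi\subset[1/2,2]$, $0\le\varphi\le1$, $\varphi\ge c>0$ on $[3/5,5/3]$, $\varphi^2(u)+\varphi^2(u/2)=1$ on $[1,2]$. $\Psi_0:=Z_0$, $\Psi_j:=\sum_k\varphi(k/2^{j-1})Z_k$, $j\ge1$. There is $\gamma\in(0,1)$ depending only on $d$ such that for each $j\ge1$ one can fix a maximal $\gamma2^{-j+1}$-net $\mathcal X_j$ and weights $\tilde w_\xi\sim2^{-j(d-1)}$, $\xi\in\mathcal X_j$ (constants depending only on $d$) with $\int f\,d\sigma=\sum_{\xi\in\mathcal X_j}\tilde w_\xi f(\xi)$ for all spherical harmonics $f$ of degree $\le2^{j+1}$. $\mathcal X_0:=\{e_1\}$, $e_1=(1,0,\dots,0)$, $\tilde w_{e_1}:=\omega_d$. $\mathcal X=\bigcup_{j\ge0}\mathcal X_j$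 (disjoint union), $N_\xi:=2^{j-1}$ for $\xi\in\mathcal X_j$. $\psi_\xi(x):=\tilde w_\xi^{1/2}\Psi_j(\xi\cdot x)$ and $\psi^\diamond_\xi(x):=\Psi_j(\xi\cdot x)$, $\xi\in\mathcal X_j$. $S_\psi f:=\{\langle f,\psi_\xi\rangle\}_\xi$, $T_\psi h:=\sum_\xi h_\xi\psi_\xi$. **Sequence spaces.** $\mathfrak b^{sq}_p$: complex sequences $h=\{h_\xi\}_{\xi\in\mathcal X}$ with $\|h\|_{\mathfrak b^{sq}_p}=\big(\sum_{j\ge0}[2^{j(s+(d-1)(1/2-1/p))}(\sum_{\xi\in\mathcal X_j}|h_\xi|^p)^{1/p}]^q\big)^{1/q}<\infty$. $\mathfrak f^{sq}_p$: $\|h\|_{\mathfrak f^{sq}_p}=\big\|\big(\sum_{\xi\in\mathcal X}[|B_\xi|^{-s/(d-1)-1/2}|h_\xi|\mathbb 1_{B_\xi}]^q\big)^{1/q}\big\|_{L^p}<\infty$, where $B_\xi=B(\xi,\gamma2^{-j+1})$ for $\xi\in\mathcal X_j$. **Construction of $\Theta$.** Let $m:=\lceil(M-d+2)/2\rceil$ and, for $N\ge1$, $\Lambda_N(u):=(-1)^{K/2}\sum_{N/2<k<2N}\varphi(k/N)[k(k+d-2)]^{-K/2}Z_k(u)$. For $0<\varepsilon\le1$ and $a=1+\varepsilon$ let $\mathcal F_\varepsilon(u)=\varepsilon^{2m-1}(a^2+1-2au)^{-d/2+1-m}$, $\kappa_{\varepsilon,m,d}=\big(\int_{\mathbb S^{d-1}}\mathcal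 F_\varepsilon(x\cdot\eta)d\sigma(x)\big)^{-1}$ (independent of $\eta\in\mathbb S^{d-1}$). It is known that there are real $b_0,\dots,b_m$ depending only on $\varepsilon,m,d$ with, for all $x,\eta\in\mathbb S^{d-1}$, $\mathcal F_\varepsilon(x\cdot\eta)=\sum_{\ell=0}^mb_\ell(\eta\cdot\nabla)^\ell|x-a\eta|^{2-d}$ if $d\ge3$, and $=b_0+\sum_{\ell=1}^mb_\ell(\eta\cdot\nabla)^\ell\ln\frac1{|x-a\eta|}$ if $d=2$ ($\nabla$ in $x$). For $t>0$, $\zeta\in\mathbb S^{d-1}$, acting on functions of $x$: $\mathfrak D^\ell_t(\zeta)f(x):=t^{-\ell}\sum_{k=0}^\ell(-1)^{\ell-k}\binom\ell kf(x+kt\zeta)$, and $\mathfrak L_tf(x):=t^{-2}\sum_{1\le i<l\le d}[f(Q_{i,l,-t}x)+f(Q_{i,l,t}x)-2f(x)]$, where $Q_{i,l,t}$ is the rotation replacing $(x_i,x_l)$ by $(x_i\cos t+x_l\sin t,-x_i\sin t+x_l\cos t)$ and fixing the other coordinates. Given parameters $0<\gamma_2\le\gamma_1\le1$, $0<\gamma_3\le1$ and $t_j>0$ ($j\ge1$), for $\xi\in\mathcal X_j$, $j\ge1$, put $\varepsilon:=\gamma_1/N_\xi$, $a=1+\varepsilon$, $r_\xi:=(\gamma_3N_\xi)^{-1}$; let $\mathcal Z_j$ be a fixed maximal $\gamma_22^{-j+1}$-net, $\{A_\zeta\}_{\zeta\in\mathcal Z_j}$ a measurable disjoint partition of $\mathbb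 S^{d-1}$ with $B(\zeta,\gamma_22^{-j})\subset A_\zeta\subset B(\zeta,\gamma_22^{-j+1})$, $w_\zeta=|A_\zeta|$, and $$\theta^\diamond_\xi(x):=\kappa_{\varepsilon,m,d}\sum_{\zeta\in\mathcal Z_j,\ \rho(\zeta,\xi)\le r_\xi}w_\zeta\Lambda_{N_\xi}(\xi\cdot\zeta)\sum_{\ell=0}^mb_\ell\,\mathfrak L_{t_j}^{K/2}\mathfrak D^\ell_{t_j}(\zeta)|x-a\zeta|^{2-d}\quad(d\ge3),$$ while for $d=2$ the inner sum is replaced by $\sum_{\ell=1}^mb_\ell\,\mathfrak L_{t_j}^{K/2}\mathfrak D^\ell_{t_j}(\zeta)\ln\frac1{|x-a\zeta|}$. The $t_j$ are small enough that all poles lie outside $\overline{B^d}$. Given $\gamma_0>0$, the parameters $\gamma_1,\gamma_2,\gamma_3$ (depending only on $d,K,M,\gamma_0$) and $t_j$ (depending only on $d,K,M,\gamma_0,j$) are fixed so that for all $\xi\in\mathcal X\setminus\mathcal X_0$: $|\partial^\beta[\breve\psi^\diamond_\xi-\breve\theta^\diamond_\xi](x)|\le\gamma_0N_\xi^{|\beta|+d-1}(1+N_\xi\rho(\xi,x))^{-M}$ for $x\in\mathbb S^{d-1}$, $0\le|\beta|\le K$, and $|\int_{\mathbb S^{d-1}}y^\beta[\psi^\diamond_\xi(y)-\theta^\diamond_\xi(y)]d\sigma(y)|\le\gamma_0N_\xi^{-K}$ for $0\le|\beta|\le K-1$ (such a choice exists). Finally $\theta_\xi:=\tilde w_\xi^{1/2}\theta^\diamond_\xi$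 for $\xi\in\mathcal X\setminus\mathcal X_0$ and $\theta_\xi:=\psi_\xi$ (a constant function) for $\xi\in\mathcal X_0$. **Constants.** Let $\omega^{(K,M)}_{\xi,\eta}:=\Big(\frac{\min\{N_\xi,N_\eta\}}{\max\{N_\xi,N_\eta\}}\Big)^{K+(d-1)/2}(1+\min\{N_\xi,N_\eta\}\rho(\xi,\eta))^{-M}$. $c_{42}\ge1$ is a constant depending only on $d,K,M$ (and the fixed needlet system), not on $\gamma_0$, such that $|\langle\psi_\eta,\psi_\xi-\theta_\xi\rangle|\le c_{42}\gamma_0\omega^{(K,M)}_{\xi,\eta}$ for all $\xi,\eta\in\mathcal X$. $C_9\ge1$ is a constant bounding the norm of the operator with matrix $\{\omega^{(K,M)}_{\xi,\eta}\}$ on $\mathfrak b^{sq}_p$ and on $\mathfrak f^{sq}_p$ for all $(s,p,q)\in\mathcal Q(A)$. $C_1\ge1$ is a common constant in the quasi-triangle inequalities $\|u+v\|\le C_1(\|u\|+\|v\|)$ of all spaces $\mathcal B^{sq}_p,\mathcal F^{sq}_p,\mathfrak b^{sq}_p,\mathfrak f^{sq}_p$, $(s,p,q)\in\mathcal Q(A)$. $C_2>1$ is a common bound for the norms of $S_\psi:\mathcal B^{sq}_p\to\mathfrak b^{sq}_p$, $T_\psi:\mathfrak b^{sq}_p\to\mathcal B^{sq}_p$, $S_\psi:\mathcal F^{sq}_p\to\mathfrak f^{sq}_p$, $T_\psi:\mathfrak f^{sq}_p\to\mathcal F^{sq}_p$ for $(s,p,q)\in\mathcal Q(A)$ (it is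 known that such a bound exists and that $T_\psi S_\psi=I$ on these spaces). With $\tau_0:=\ln2/(\ln2+\ln C_1)$, $\epsilon_0:=\dfrac{(1-2^{-\tau_0})^{1/\tau_0}}{2C_1C_2^4\,2^{1/\tau_0}}$. *)

(* Defs.v *)
From HB Require Import structures.
From mathcomp Require Import all_boot all_order all_algebra finmap complex.
From mathcomp Require Import ring lra.
From mathcomp Require mpoly.
Import -(notations) mpoly.
From mathcomp Require Import all_classical all_reals all_analysis.
From mathcomp Require Import measurable_realfun.

Set Implicit Arguments.
Unset Strict Implicit.
Unset Printing Implicit Defensive.

Import Order.TTheory GRing.Theory Num.Theory ComplexField.
Import numFieldNormedType.Exports.

(* Throughout, the ambient dimension is [d = n.+2], so that [n : nat] ranges
   over exactly the dimensions [d >= 2]. *)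

Local Open Scope classical_set_scope.
Local Open Scope ring_scope.
Local Open Scope complex_scope.

Section LebesgueTuple.
Variable R : realType.

Definition cons_pair k (p : R * k.-tuple R) : k.+1.-tuple R :=
  [tuple of p.1 :: p.2].

Lemma measurable_cons_pair k : measurable_fun [set: R * k.-tuple R] (@cons_pair k).
Proof. exact: measurable_cons measurable_fst measurable_snd. Qed.

Section step.
Variables (k : nat) (mu : {sigma_finite_measure set (k.-tuple R) -> \bar R}).

Definition lebesgue_cons : set (k.+1.-tuple R) -> \bar R :=
  pushforward (@lebesgue_measure R \x mu)%E (@cons_pair k).

Let lebesgue_cons0 : lebesgue_cons set0 = 0%E.
Proof. by rewrite /lebesgue_cons /pushforward preimage_set0 measure0. Qed.

Let lebesgue_cons_ge0 A : (0 <= lebesgue_cons A)%E.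
Proof. by rewrite /lebesgue_cons /pushforward measure_ge0. Qed.

Let lebesgue_cons_sigma : semi_sigma_additive lebesgue_cons.
Proof.
have h := @measure_semi_sigma_additive _ _ _
  (measure_function_pushforward__canonical__measure_function_Measure
    (lebesgue_measure \x mu)%E (@measurable_cons_pair k)).
exact: h.
Qed.

HB.instance Definition _ := isMeasure.Build _ _ _ lebesgue_cons
  lebesgue_cons0 lebesgue_cons_ge0 lebesgue_cons_sigma.

Let lebesgue_cons_sigma_finite : sigma_finite setT lebesgue_cons.
Proof.
have /sigma_finiteP[F [TF ndF Foo]] := sigma_finiteT (@lebesgue_measure R).
have /sigma_finiteP[G [TG ndG Goo]] := sigma_finiteT mu.
pose uncons (t : k.+1.-tuple R) := (thead t, [tuple of behead t]).
have unconsK : cancel (@cons_pair k) uncons.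
  by move=> [x t]; rewrite /uncons theadE; congr pair; exact/val_inj.
have muncons : measurable_fun [set: k.+1.-tuple R] uncons.
  apply/measurable_fun_pairP; split; first exact: measurable_tnth.
  exact: measurable_behead.
exists (fun i => uncons @^-1` (F i `*` G i)).
  apply/seteqP; split => // t _.
  have : [set: measurableTypeR R] (thead t) by [].
  rewrite TF => -[i _ Fi].
  have : [set: k.-tuple R] [tuple of behead t] by [].
  rewrite TG => -[j _ Gj].
  exists (maxn i j) => //; split => /=.
  - by move: Fi; exact/subsetPset/ndF/leq_maxl.
  - by move: Gj; exact/subsetPset/ndG/leq_maxr.
move=> i; have [? ?] := Foo i; have [? ?] := Goo i; split.
  by rewrite -[X in measurable X]setTI; apply: muncons => //; exact: measurableX.
rewrite /lebesgue_cons /pushforward -comp_preimage.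
rewrite (_ : uncons \o _ = id); last by apply/funext => x; exact: unconsK.
by rewrite preimage_id product_measure1E// lte_mul_pinfty// ge0_fin_numE.
Qed.

HB.instance Definition _ := Measure_isSigmaFinite.Build _ _ _ lebesgue_cons
  lebesgue_cons_sigma_finite.

End step.

Fixpoint lebesgue_tuple k : {sigma_finite_measure set (k.-tuple R) -> \bar R} :=
  match k with
  | 0 => \d_[tuple]
  | k'.+1 => lebesgue_cons (lebesgue_tuple k')
  end.

End LebesgueTuple.

Section Sphere.
Variables (R : realType) (n : nat).
Local Notation d := n.+2.
Implicit Types x y : 'rV[R]_d.

Definition edot x y : R := \sum_i x 0 i * y 0 i.

Definition enorm x : R := Num.sqrt (edot x x).

Record sphere := Sphere { sphere_pt :> 'rV[R]_d; _ : edot sphere_pt sphere_pt == 1 }.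

HB.instance Definition _ := [isSub for sphere_pt].
HB.instance Definition _ := [Choice of sphere by <:].

Lemma sphere_e1_subproof : edot (delta_mx 0 0) (delta_mx 0 0) == 1.
Proof.
rewrite /edot (bigD1 ord0)//= big1; last first.
  by move=> i i0; rewrite !mxE (negbTE i0) andbF mulr0.
by rewrite !mxE !eqxx mulr1 addr0.
Qed.

Definition sphere_e1 : sphere := Sphere sphere_e1_subproof.

HB.instance Definition _ := isPointed.Build sphere sphere_e1.

(* Borel sigma-algebra of the sphere, generated by the coordinate functions. *)
Definition sphere_display : measure_display. Proof. exact. Qed.

Definition sphere_coord (i : 'I_d) (x : sphere) : R := x 0 i.

Definition sphere_measurable : set (set sphere) := g_sigma_preimage sphere_coord.

Let sphere_measurable0 : sphere_measurable set0.
Proof. exact: sigma_algebra0. Qed.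

Let sphere_measurableC A : sphere_measurable A -> sphere_measurable (~` A).
Proof. exact: sigma_algebraC. Qed.

Let sphere_measurable_bigcup (F : (set sphere)^nat) :
  (forall i, sphere_measurable (F i)) -> sphere_measurable (\bigcup_i F i).
Proof. exact: sigma_algebra_bigcup. Qed.

HB.instance Definition _ := @isMeasurable.Build sphere_display sphere
  sphere_measurable sphere_measurable0 sphere_measurableC
  sphere_measurable_bigcup.

Definition cone (E : set sphere) : set (d.-tuple R) :=
  [set t | exists r (x : sphere),
     [/\ 0 < r <= 1, E x & forall i, tnth t i = r * x 0 i]].

Let nrm (t : d.-tuple R) : R := Num.sqrt (\sum_i tnth t i ^+ 2).

Let nrmE r (x : sphere) (t : d.-tuple R) : 0 < r ->
  (forall i, tnth t i = r * x 0 i) -> nrm t = r.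
Proof.
move=> r0 tx; rewrite /nrm.
under eq_bigr do rewrite tx exprMn.
rewrite -mulr_sumr.
under eq_bigr do rewrite expr2.
have /eqP := valP x; rewrite /edot /= => ->.
by rewrite mulr1 sqrtr_sqr gtr0_norm.
Qed.

Let measurable_nrm : measurable_fun setT nrm.
Proof.
apply: (@measurableT_comp _ _ _ _ _ _ (@Num.sqrt R)) => //.
  by apply: continuous_measurable_fun; exact: sqrt_continuous.
apply: measurable_sum => i.
by apply: measurable_funX; exact: measurable_tnth.
Qed.

Let pball : set (d.-tuple R) := [set t | 0 < nrm t <= 1].

Let measurable_pball : measurable pball.
Proof.
rewrite (_ : pball = nrm @^-1` `]0, 1]%classic); last first.
  by apply/seteqP; split => t /=; rewrite in_itv.
by rewrite -[X in measurable X]setTI; exact: measurable_nrm.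
Qed.

Let exists_dir t : pball t ->
  exists x : sphere, forall i, tnth t i = nrm t * x 0 i.
Proof.
move=> /andP[t0 _].
have h : edot (\row_i (tnth t i / nrm t)) (\row_i (tnth t i / nrm t)) == 1.
  rewrite /edot.
  under eq_bigr do rewrite !mxE -expr2 exprMn.
  have s0 : 0 <= \sum_i tnth t i ^+ 2 by apply: sumr_ge0 => i _; exact: sqr_ge0.
  rewrite -mulr_suml -(sqr_sqrtr s0) -[Num.sqrt _]/(nrm t) -exprMn.
  by rewrite divff ?(gt_eqF t0)// expr1n.
exists (Sphere h) => i /=.
by rewrite mxE mulrC divfK ?gt_eqF.
Qed.

Let coneT : cone setT = pball.
Proof.
apply/seteqP; split => [t [r [x [/andP[r0 r1] _ tx]]]|t pt].
  by rewrite /pball /= (nrmE r0 tx) r0.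
by have [x tx] := exists_dir pt; exists (nrm t), x; split.
Qed.

Let cone_uniq r r' (x x' : sphere) (t : d.-tuple R) : 0 < r -> 0 < r' ->
  (forall i, tnth t i = r * x 0 i) -> (forall i, tnth t i = r' * x' 0 i) ->
  x = x'.
Proof.
move=> r0 r'0 tx tx'; apply/val_inj/rowP => i /=.
have rr' : r = r' by rewrite -(nrmE r0 tx) (nrmE r'0 tx').
by apply: (mulfI (lt0r_neq0 r0)); rewrite -tx rr' tx'.
Qed.

Lemma coneC E : cone (~` E) = cone setT `\` cone E.
Proof.
apply/seteqP; split => t.
  move=> [r [x [rP Ex tx]]]; split; first by exists r, x.
  move=> [r' [x' [r'P Ex' tx']]]; apply: Ex.
  move/andP : rP => [r0 _]; move/andP : r'P => [r'0 _].
  by rewrite (cone_uniq r0 r'0 tx tx').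
move=> [[r [x [rP _ tx]]] nE]; exists r, x; split => // Ex.
by apply: nE; exists r, x.
Qed.

Lemma cone_bigcup (F : (set sphere)^nat) : cone (\bigcup_i F i) = \bigcup_i cone (F i).
Proof.
apply/seteqP; split => t.
  by move=> [r [x [rP [i _ Fi] tx]]]; exists i => //; exists r, x.
by move=> [i _ [r [x [rP Fi tx]]]]; exists r, x; split => //; exists i.
Qed.

Lemma measurable_cone E : measurable E -> measurable (cone E).
Proof.
move=> mE; pose G := [set E | measurable (cone E)].
suff : measurable `<=` G by exact.
apply: smallest_sub.
  split => [|A mA|F mF]; rewrite /G /=.
  - rewrite (_ : cone set0 = set0)//; apply/seteqP; split => // t.
    by case=> r [x []].
  - by rewrite setTD coneC coneT; exact: measurableD.
  - by rewrite cone_bigcup; apply: bigcup_measurable => i _; exact: mF.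
rewrite -bigcup_mkord_ord; apply: bigcup_sub => i Ii A [B mB <-].
rewrite /G /= setTI.
set j := inord i.
have -> : cone (sphere_coord j @^-1` B) =
    pball `&` (fun t => tnth t j / nrm t) @^-1` B.
  apply/seteqP; split => t.
    move=> [r [x [rP Bx tx]]]; split.
      by rewrite -coneT; exists r, x.
    move/andP : rP => [r0 _].
    by rewrite /= (nrmE r0 tx) tx mulrAC divff ?mul1r// gt_eqF.
  move=> [pt /= Bt]; have [x tx] := exists_dir pt; exists (nrm t), x; split => //.
  suff -> : (sphere_coord j @^-1` B) x = B (tnth t j / nrm t) by [].
  rewrite /preimage /= (_ : sphere_coord j x = tnth t j / nrm t)//.
  rewrite tx mulrAC divff ?mul1r//.
  by case/andP : pt => /lt0r_neq0.
have mf : measurable_fun pball (fun t => tnth t j / nrm t).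
  apply: measurable_funM; first by apply: measurable_funTS; exact: measurable_tnth.
  apply: (@measurable_comp _ _ _ _ _ _ [set x : R | x != 0] (@GRing.inv R)).
  - exact: open_measurable (@open_neq R 0).
  - by move=> _ [t pt <-] /=; case/andP : pt => /lt0r_neq0.
  - apply: open_continuous_measurable_fun; first exact: open_neq.
    by move=> x /= /set_mem x0; exact: inv_continuous.
  - exact: measurable_funTS.
exact: mf.
Qed.

(* Surface measure in polar coordinates: the solid cone over [E] inside the unit
   ball has Lebesgue measure [sigma E / d]. *)
Definition sigma (E : set sphere) : \bar R :=
  (d%:R%:E * lebesgue_tuple R d (cone E))%E.

Let sigma0 : sigma set0 = 0%E.
Proof.
rewrite /sigma (_ : cone set0 = set0) ?measure0 ?mule0//.
by apply/seteqP; split => // t [r [x []]].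
Qed.

Let sigma_ge0 E : (0 <= sigma E)%E.
Proof. by rewrite /sigma mule_ge0// lee_fin. Qed.

Let sigma_sigma : semi_sigma_additive sigma.
Proof.
move=> F mF tF mUF; rewrite /sigma cone_bigcup.
have h : (fun k => \sum_(0 <= i < k) lebesgue_tuple R d (cone (F i)))%E
    @ \oo --> lebesgue_tuple R d (\bigcup_i cone (F i)).
  apply: measure_semi_sigma_additive => [i||].
  - exact: measurable_cone.
  - apply/trivIsetP => i j _ _ ij; apply/seteqP; split => // t.
    move=> [[r [x [/andP[r0 _] Ex tx]]] [r' [x' [/andP[r'0 _] Ex' tx']]]].
    have FF : (F i `&` F j) x.
      by split; [|rewrite (cone_uniq r0 r'0 tx tx')].
    by move/trivIsetP : tF => /(_ i j Logic.I Logic.I ij) F0; rewrite F0 in FF.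
  - by apply: bigcup_measurable => i _; exact: measurable_cone.
under eq_cvg do rewrite -ge0_sume_distrr//.
exact: cvgeZl.
Qed.

HB.instance Definition _ := isMeasure.Build _ _ _ sigma sigma0 sigma_ge0 sigma_sigma.

End Sphere.

Section Smooth.
Variables (R : realType) (n : nat).
Local Notation d := n.+2.
Local Notation V := 'rV[R]_d.
Local Notation sphere := (sphere R n).
Implicit Types (f g : V -> R) (x : V).

Definition dpart (s : seq 'I_d) f : V -> R :=
  foldr (fun i g => 'D_(delta_mx 0 i) g) f s.

(* C^infty on the complement of the origin: all iterated partial derivatives, in
   any order, exist and are continuous there. *)
Definition smooth_off0 f := forall (s : seq 'I_d) x, x != 0 ->
  {for x, continuous (dpart s f)} /\
  forall i, derivable (dpart s f) x (delta_mx 0 i).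

Let near_neq0 x : x != 0 -> \forall y \near x, y != 0.
Proof.
move=> x0; apply: open_nbhs_nbhs; split => //.
have /closed_openC : closed [set (0 : V)].
  by apply: accessible_closed_set1; apply: hausdorff_accessible; exact: norm_hausdorff.
by congr open; apply/seteqP; split => y /eqP.
Qed.

Let near_eq f g x : (forall y, y != 0 -> f y = g y) -> x != 0 ->
  \forall y \near x, f y = g y.
Proof. by move=> fg /near_neq0; apply: filterS => y; exact: fg. Qed.

Let dpart_eq s f g : (forall y, y != 0 -> f y = g y) ->
  forall y, y != 0 -> dpart s f y = dpart s g y.
Proof.
move=> fg; elim: s => [//|i s ih] y y0 /=.
exact/near_eq_derive/near_eq.
Qed.

Lemma eq_smooth_off0 f g : (forall y, y != 0 -> f y = g y) ->
  smooth_off0 f -> smooth_off0 g.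
Proof.
move=> fg sf s x x0; have [cf df] := sf s x x0.
have fgs := near_eq (@dpart_eq s _ _ fg) x0.
split; last by move=> i; exact: near_eq_derivable (df i).
rewrite /prop_for /continuous_at -(@dpart_eq s _ _ fg _ x0).
exact: cvg_trans (near_eq_cvg fgs) cf.
Qed.

(* An auxiliary algebra of smooth functions containing the coordinates and
   [x |-> 1 / |x|]; by [smooth_closureP] it adds nothing to [smooth_off0]. *)
Inductive smooth_closure : (V -> R) -> Prop :=
| sc_smooth f : smooth_off0 f -> smooth_closure f
| sc_cst c : smooth_closure (cst c)
| sc_coord i : smooth_closure (fun x => x 0 i)
| sc_invn : smooth_closure (fun x => (enorm x)^-1)
| sc_add f g : smooth_closure f -> smooth_closure g -> smooth_closure (f + g)
| sc_mul f g : smooth_closure f -> smooth_closure g -> smooth_closure (f * g).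

Let derive_coord i x v : 'D_v (fun y : V => y 0 i) x = v 0 i.
Proof.
apply/cvg_lim => //.
suff h : {near 0^', (fun=> v 0 i) =1
    (fun h : R => h^-1 *: (((fun y : V => y 0 i) \o shift x) (h *: v) - x 0 i))}.
  by apply: cvg_trans (near_eq_cvg h) _; exact: cvg_cst.
near=> h; rewrite /= !mxE addrK scalerA mulVf ?scale1r//.
by near: h; exact: nbhs_dnbhs_neq.
Unshelve. all: by end_near. Qed.

Lemma edot_gt0 x : x != 0 -> 0 < edot x x.
Proof.
move=> x0; rewrite /edot lt0r sumr_ge0 ?andbT; last by move=> i _; rewrite -expr2 sqr_ge0.
apply: contra x0 => /eqP h; apply/eqP/rowP => i; rewrite mxE; apply/eqP.
rewrite -sqrf_eq0 expr2; move/eqP : h; rewrite psumr_eq0; last first.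
  by move=> j _; rewrite -expr2 sqr_ge0.
by move/allP => /(_ i); rewrite mem_index_enum => /(_ isT).
Qed.

Lemma enorm_gt0 x : x != 0 -> 0 < enorm x.
Proof. by move=> x0; rewrite sqrtr_gt0 edot_gt0. Qed.

Let diff_edot x : differentiable (fun y : V => edot y y) x.
Proof.
rewrite (_ : (fun y : V => edot y y) =
  \sum_(i < d) ((fun y : V => y 0 i) * (fun y : V => y 0 i))).
  apply: differentiable_sum => i.
  by apply: differentiableM; exact: differentiable_coord.
by apply/funext => y; rewrite fct_sumE.
Qed.

Let diff_enorm x : x != 0 -> differentiable (@enorm R n) x.
Proof.
move=> x0; apply: (@differentiable_comp _ _ _ _ (fun y : V => edot y y) (@Num.sqrt R)).
  exact: diff_edot.
apply/derivable1_diffP; have := is_derive1_sqrt (edot_gt0 x0).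
by move=> h; exact: ex_derive.
Qed.

Let derivable_invn x v : x != 0 ->
  derivable (fun y : V => (enorm y)^-1) x v.
Proof.
move=> x0; apply: derivableV; first by rewrite gt_eqF ?enorm_gt0.
exact/diff_derivable/diff_enorm.
Qed.

Let derive_invn x i : x != 0 ->
  'D_(delta_mx 0 i) (fun y : V => (enorm y)^-1) x =
  (-1) * (x 0 i * ((enorm x)^-1 * ((enorm x)^-1 * (enorm x)^-1))).
Proof.
move=> x0; have e0 := enorm_gt0 x0.
have den : derivable (@enorm R n) x (delta_mx 0 i).
  exact/diff_derivable/diff_enorm.
rewrite deriveV ?gt_eqF//.
have : 'D_(delta_mx 0 i) (@enorm R n * @enorm R n) x =
       'D_(delta_mx 0 i) (fun y : V => edot y y) x.
  congr ('D_ _ _ _); apply/funext => y; rewrite /GRing.mul /= -expr2 sqr_sqrtr//.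
  by apply: sumr_ge0 => j _; rewrite -expr2 sqr_ge0.
rewrite deriveM// [in RHS](_ : (fun y : V => edot y y) =
  \sum_(i < d) ((fun y : V => y 0 i) * (fun y : V => y 0 i))); last first.
  by apply/funext => y; rewrite fct_sumE.
have dc j : derivable (fun y : V => y 0 j) x (delta_mx 0 i).
  exact/diff_derivable/differentiable_coord.
rewrite derive_sum; last by move=> j; exact: derivableM.
rewrite (bigD1 i)//= big1 ?addr0; last first.
  move=> j ji; rewrite deriveM// derive_coord mxE eqxx (negbTE ji).
  by rewrite scaler0 addr0.
rewrite deriveM// derive_coord mxE !eqxx /GRing.scale /= => h.
have {}h : 'D_(delta_mx 0 i) (@enorm R n) x = x 0 i * (enorm x)^-1.
  by apply: (mulfI (lt0r_neq0 e0)); rewrite mulrCA divff ?gt_eqF//; lra.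
by rewrite h expr2 invfM; ring.
Qed.

Lemma smooth_closure_continuous f x : smooth_closure f -> x != 0 ->
  {for x, continuous f}.
Proof.
move=> + x0; elim=> {f} [f /(_ [::] x x0)[]//|c|i||f g _ cf _ cg|f g _ cf _ cg].
- exact: cst_continuous.
- exact/differentiable_continuous/differentiable_coord.
- apply: differentiable_continuous; apply: differentiableV; first exact: diff_enorm.
  by rewrite gt_eqF ?enorm_gt0.
- exact: continuousD.
- exact: continuousM.
Qed.

Lemma smooth_closure_derivable f x i : smooth_closure f -> x != 0 ->
  derivable f x (delta_mx 0 i).
Proof.
move=> + x0; elim=> {f} [f /(_ [::] x x0)[_]//|c|j||f g _ df _ dg|f g _ df _ dg].
- exact: derivable_cst.
- exact/diff_derivable/differentiable_coord.
- exact: derivable_invn.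
- exact: derivableD.
- exact: derivableM.
Qed.

Lemma smooth_closure_derive f i : smooth_closure f ->
  exists g, smooth_closure g /\
    forall x, x != 0 -> 'D_(delta_mx 0 i) f x = g x.
Proof.
elim=> {f} [f sf|c|j||f g Gf [f' [Gf' ff']] Gg [g' [Gg' gg']]
  |f g Gf [f' [Gf' ff']] Gg [g' [Gg' gg']]].
- exists ('D_(delta_mx 0 i) f); split => //; apply: sc_smooth => s x x0.
  by have := sf (rcons s i) x x0; rewrite /dpart foldr_rcons.
- exists (cst 0); split; first exact: sc_cst.
  by move=> x _; rewrite derive_cst.
- exists (cst ((delta_mx 0 i : V) 0 j)); split; first exact: sc_cst.
  by move=> x _; rewrite derive_coord.
- exists (cst (-1) * ((fun x => x 0 i) * ((fun x => (enorm x)^-1) *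
    ((fun x => (enorm x)^-1) * (fun x => (enorm x)^-1))))); split.
    apply: sc_mul; first exact: sc_cst.
    apply: sc_mul; first exact: sc_coord.
    apply: sc_mul; first exact: sc_invn.
    apply: sc_mul; exact: sc_invn.
  by move=> x x0; rewrite derive_invn.
- exists (f' + g'); split; first exact: sc_add.
  move=> x x0; rewrite deriveD ?ff' ?gg'//; exact: smooth_closure_derivable.
- exists (f * g' + g * f'); split.
    by apply: sc_add; exact: sc_mul.
  move=> x x0; rewrite deriveM ?ff' ?gg'//; exact: smooth_closure_derivable.
Qed.

Lemma smooth_closureP f : smooth_closure f -> smooth_off0 f.
Proof.
move=> Gf.
have dG s : exists g, smooth_closure g /\ forall x, x != 0 -> g x = dpart s f x.
  elim: s => [|i s [g [Gg gE]]] /=; first by exists f.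
  have [h [Gh hE]] := smooth_closure_derive i Gg.
  exists h; split => // x x0; rewrite -hE//.
  exact/near_eq_derive/near_eq.
move=> s x x0; have [g [Gg gE]] := dG s.
have gs := near_eq gE x0.
split; last first.
  by move=> i; apply: near_eq_derivable gs _; exact: smooth_closure_derivable.
rewrite /prop_for /continuous_at -(gE x x0).
exact: cvg_trans (near_eq_cvg gs) (smooth_closure_continuous Gg x0).
Qed.

End Smooth.

Section TestFunctions.
Variables (R : realType) (n : nat).
Local Notation d := n.+2.
Local Notation sphere := (sphere R n).

(* [breve g x = g (x / |x|)] for [x != 0]. *)
Definition breve (g : sphere -> R) (x : 'rV[R]_d) : R :=
  if insub ((enorm x)^-1 *: x) is Some y then g y else 0.

Lemma breveE (x : 'rV[R]_d) : x != 0 -> exists2 y : sphere,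
  (y : 'rV[R]_d) = (enorm x)^-1 *: x & forall g, breve g x = g y.
Proof.
move=> x0.
have h : edot ((enorm x)^-1 *: x) ((enorm x)^-1 *: x) == 1.
  rewrite /edot; under eq_bigr do rewrite !mxE mulrACA.
  rewrite -mulr_sumr -/(edot x x) -(sqr_sqrtr (ltW (edot_gt0 x0))).
  by rewrite -/(enorm x) -expr2 -exprMn mulVf ?expr1n// gt_eqF// enorm_gt0.
by exists (Sphere h) => // g; rewrite /breve insubT.
Qed.

Definition smooth_sphere (g : sphere -> R[i]^o) : bool :=
  `[< smooth_off0 (breve (fun y => complex.Re (g y))) /\
      smooth_off0 (breve (fun y => complex.Im (g y))) >].

Lemma smooth_sphere_submod : submod_closed (smooth_sphere : {pred sphere -> R[i]^o}).
Proof.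
split.
  apply/asboolP; split; apply: (@eq_smooth_off0 _ _ (cst 0)).
  - by move=> x x0; case: (breveE x0) => y _ ->.
  - exact/smooth_closureP/sc_cst.
  - by move=> x x0; case: (breveE x0) => y _ ->.
  - exact/smooth_closureP/sc_cst.
move=> [a b] f g /asboolP[rf jf] /asboolP[rg jg]; apply/asboolP; split.
  apply: (@eq_smooth_off0 _ _ (cst a * breve (fun y => complex.Re (f y)) +
      (cst (- b) * breve (fun y => complex.Im (f y)) + breve (fun y => complex.Re (g y))))).
    move=> x x0; have [y _ h] := breveE x0.
    rewrite !fctE !h.
    case: (f y) => u v; case: (g y) => u' v' /=.
    by rewrite addrA mulNr.
  apply: smooth_closureP; apply: sc_add.
    by apply: sc_mul; [exact: sc_cst|exact: sc_smooth].
  apply: sc_add; last exact: sc_smooth.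
  by apply: sc_mul; [exact: sc_cst|exact: sc_smooth].
apply: (@eq_smooth_off0 _ _ (cst a * breve (fun y => complex.Im (f y)) +
    (cst b * breve (fun y => complex.Re (f y)) + breve (fun y => complex.Im (g y))))).
  move=> x x0; have [y _ h] := breveE x0.
  rewrite !fctE !h.
  case: (f y) => u v; case: (g y) => u' v' /=.
  by rewrite addrA.
apply: smooth_closureP; apply: sc_add.
  by apply: sc_mul; [exact: sc_cst|exact: sc_smooth].
apply: sc_add; last exact: sc_smooth.
by apply: sc_mul; [exact: sc_cst|exact: sc_smooth].
Qed.

HB.instance Definition _ := GRing.isSubmodClosed.Build R[i] (sphere -> R[i]^o)
  smooth_sphere smooth_sphere_submod.

(* Complex-valued test functions; [R[i]^o] only provides the module structure
   over [R[i]]. *)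
Record testfun := TestFun {
  testfun_fun :> sphere -> R[i]^o;
  _ : testfun_fun \in (smooth_sphere : {pred sphere -> R[i]^o}) }.

HB.instance Definition _ := [isSub for testfun_fun].
HB.instance Definition _ := [Choice of testfun by <:].
HB.instance Definition _ := [SubChoice_isSubLmodule of testfun by <:].

Lemma conj_testfun_subproof (u : testfun) :
  (fun x => (u x)^*%C) \in (smooth_sphere : {pred sphere -> R[i]^o}).
Proof.
have /asboolP[ru ju] := valP u; apply/asboolP; split.
  by apply: eq_smooth_off0 ru => x x0; have [y _ h] := breveE x0; rewrite !h /=; case: (u y).
apply: (@eq_smooth_off0 _ _ (cst (-1) * breve (fun y => complex.Im (u y)))).
  move=> x x0; have [y _ h] := breveE x0.
  by rewrite !fctE !h mulN1r; case: (u y).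
apply: smooth_closureP.
by apply: sc_mul; [exact: sc_cst|exact: sc_smooth].
Qed.

Definition conj_testfun (u : testfun) : testfun := TestFun (conj_testfun_subproof u).

Definition zonal (P : {poly R}) (y x : sphere) : R := P.[edot y x].

Lemma zonal_testfun_subproof (P : {poly R}) (y : sphere) :
  (fun x => (zonal P y x)%:C) \in (smooth_sphere : {pred sphere -> R[i]^o}).
Proof.
apply/asboolP; split; last first.
  apply: (@eq_smooth_off0 _ _ (cst 0)); last exact/smooth_closureP/sc_cst.
  by move=> x x0; have [z _ ->] := breveE x0.
have cdot : smooth_closure (fun x : 'rV[R]_d =>
    \sum_i (y : 'rV[R]_d) 0 i * ((enorm x)^-1 * x 0 i)).
  rewrite (_ : (fun _ => _) = \sum_i (cst ((y : 'rV[R]_d) 0 i) *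
      ((fun x : 'rV[R]_d => (enorm x)^-1) * (fun x : 'rV[R]_d => x 0 i)))).
    elim/big_ind : _ => [|f g|i _]; first exact: (@sc_cst _ _ 0).
    - exact: sc_add.
    - apply: sc_mul; first exact: sc_cst.
      by apply: sc_mul; [exact: sc_invn|exact: sc_coord].
  by apply/funext => x; rewrite fct_sumE.
have cP : smooth_closure (fun x : 'rV[R]_d =>
    horner P (\sum_i (y : 'rV[R]_d) 0 i * ((enorm x)^-1 * x 0 i))).
  elim/poly_ind : P => [|P c ih].
    by under eq_fun do rewrite horner0; exact: sc_cst.
  under eq_fun do rewrite hornerMXaddC.
  by apply: (sc_add (sc_mul ih cdot)); exact: sc_cst.
apply: eq_smooth_off0 (smooth_closureP cP) => x x0.
have [z zx ->] := breveE x0; rewrite /zonal /edot /=; congr (P.[_]).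
by apply: eq_bigr => i _; rewrite zx !mxE.
Qed.

Definition zonal_testfun (P : {poly R}) (y : sphere) : testfun :=
  TestFun (zonal_testfun_subproof P y).

End TestFunctions.

Section SphereAnalysis.
Variables (R : realType) (n : nat).
Local Notation d := n.+2.
Local Notation V := 'rV[R]_d.
Local Notation sphere := (sphere R n).
Local Notation testfun := (testfun R n).

Definition rho (x y : sphere) : R := acos (edot x y).

Definition gball (y : sphere) (r : R) : set sphere := [set x | rho x y < r].

Definition area (E : set sphere) : R := fine (sigma E).

Definition maximal_net (delta : R) (Y : {fset sphere}) : Prop :=
  {in Y &, forall y z, y != z -> delta <= rho y z} /\
  \bigcup_(y in [set` Y]) gball y delta = setT.

Definition cintegral (f : sphere -> R[i]) : R[i] :=
  (\int[@sigma R n]_x complex.Re (f x)) +i* (\int[@sigma R n]_x complex.Im (f x)).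

Definition mindex_size (beta : 'I_d -> nat) : nat := \sum_i beta i.

Definition pderiv (beta : 'I_d -> nat) : (V -> R) -> V -> R :=
  dpart (flatten [seq nseq (beta i) i | i <- enum 'I_d]).

(* Elements of the dual of [C^infty]: a linear form is continuous for the
   Frechet topology iff it is dominated by finitely many seminorms
   [sup_x |partial^beta breve u (x)|]. *)
Definition is_distribution (F : testfun -> R[i]) : Prop :=
  (forall (c : R[i]) (u v : testfun), F (c *: u + v) = c * F u + F v) /\
  exists (C : R) (k : nat), forall (u : testfun) (M : R),
    (forall beta, (mindex_size beta <= k)%N -> forall x : sphere,
      Normc.normc (pderiv beta (breve (fun y => complex.Re (u y))) x +i*
                   pderiv beta (breve (fun y => complex.Im (u y))) x) <= M) ->
    Normc.normc (F u) <= C * M.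

(* [<F, u> := F (conj u)], consistent with [<f, g> = int f (conj g)] when [F] is
   the distribution [dist_of f]. *)
Definition pairing (F : testfun -> R[i]) (u : testfun) : R[i] := F (conj_testfun u).

Definition dist_of (g : sphere -> R) : testfun -> R[i] :=
  fun u => cintegral (fun x => (g x)%:C * u x).

Definition harmonic_homog (k : nat) (p : mpoly.mpoly d R) : Prop :=
  all [pred m | mpoly.mdeg m == k] (mpoly.msupp p) /\
  \sum_(i < d) mpoly.mderiv i (mpoly.mderiv i p) = 0.

Definition mpoly_eval (p : mpoly.mpoly d R) (x : sphere) : R :=
  mpoly.meval (fun i => (x : V) 0 i) p.

(* [Y] restricts to a real orthonormal basis of the space of spherical
   harmonics of degree [k]. *)
Definition harmonic_basis (k N : nat) (Y : 'I_N -> mpoly.mpoly d R) : Prop :=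
  [/\ forall nu, harmonic_homog k (Y nu),
      forall nu mu, \int[@sigma R n]_x (mpoly_eval (Y nu) x * mpoly_eval (Y mu) x)
                    = (nu == mu)%:R
    & forall p, harmonic_homog k p -> exists c : 'I_N -> R,
        forall x, mpoly_eval p x = \sum_nu c nu * mpoly_eval (Y nu) x].

Definition zonal_kernels (Z : nat -> {poly R}) : Prop :=
  forall k, exists (N : nat) (Y : 'I_N -> mpoly.mpoly d R), harmonic_basis k Y /\
    forall x y, zonal (Z k) x y = \sum_nu mpoly_eval (Y nu) x * mpoly_eval (Y nu) y.

Definition zconv (P : {poly R}) (F : testfun -> R[i]) (x : sphere) : R[i] :=
  pairing F (zonal_testfun P x).

End SphereAnalysis.

Section Series.
Variables (R : realType) (I : choiceType).

(* Unconditional (equivalently, absolute) convergence of a complex series. *)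
Definition csum_to (u : I -> R[i]) (l : R[i]) : Prop :=
  forall e : R, 0 < e -> exists E0 : {fset I}, forall E : {fset I},
    (E0 `<=` E)%fset -> Normc.normc (\sum_(i <- E) u i - l) < e.

Definition csummable (u : I -> R[i]) : Prop := exists l, csum_to u l.

Definition csum (u : I -> R[i]) : R[i] := xget 0 [set l | csum_to u l].

Definition abs_summable (u : I -> R[i]) : Prop :=
  (\esum_(i in [set: I]) (Normc.normc (u i))%:E < +oo)%E.

End Series.

(* The series [\sum_i h_i g_i] is the distribution whose value on every test
   function is the sum of an unconditionally convergent complex series
   (convergence in S' along the net of finite subsets); [unconditional_cvg]
   is the corresponding convergence with respect to a quasi-norm. *)
Section Synthesis.
Variables (R : realType) (n : nat) (I : choiceType).
Local Notation dist := (testfun R n -> R[i]).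

Definition synth_cvg (g : I -> sphere R n -> R) (h : I -> R[i]) : Prop :=
  forall u, csummable (fun i => h i * dist_of (g i) u).

Definition synth (g : I -> sphere R n -> R) (h : I -> R[i]) : dist :=
  fun u => csum (fun i => h i * dist_of (g i) u).

Definition unconditional_cvg (N : dist -> \bar R)
    (g : I -> sphere R n -> R) (h : I -> R[i]) (F : dist) : Prop :=
  forall e : R, 0 < e -> exists E0 : {fset I}, forall E : {fset I},
    (E0 `<=` E)%fset ->
    (N (fun u => F u - \sum_(i <- E) h i * dist_of (g i) u)%R < e%:E)%E.

End Synthesis.

Section Needlets.
Variables (R : realType) (n : nat).
Local Notation d := n.+2.
Local Notation V := 'rV[R]_d.
Local Notation sphere := (sphere R n).
Local Notation dist := (testfun R n -> R[i]).

(* [kernelZ k] is the polynomial Z_k, [cutoff] and [ncutoff] are the functions phi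
   of the function spaces and of the needlets, [netconst] is gamma, [node j] is
   X_j and [weight] is w-tilde; the disjoint union of the X_j is a sigma-type. *)
Record system := System {
  kernelZ : nat -> {poly R};
  cutoff : R -> R[i];
  ncutoff : R -> R;
  netconst : R;
  node : nat -> {fset sphere};
  weight : {j : nat & node j} -> R }.

Variable sys : system.
Local Notation Z := (kernelZ sys).
Local Notation idx := {j : nat & node sys j}.

Definition pt (xi : idx) : sphere := val (tagged xi).

Definition freq (xi : idx) : R := 2 ^+ tag xi / 2.

Definition smooth_pos (f : R -> R) : Prop :=
  forall (m : nat) (x : R), 0 < x -> derivable (derive1n m f) x 1.

Definition cutoff_spec : Prop :=
  [/\ smooth_pos (fun u => complex.Re (cutoff sys u)),
      smooth_pos (fun u => complex.Im (cutoff sys u)),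
      forall u, 0 <= u -> cutoff sys u != 0 -> 2^-1 <= u <= 2
    & exists2 c : R, 0 < c & forall u, 3 / 5 <= u <= 5 / 3 ->
        c <= Normc.normc (cutoff sys u)].

Definition ncutoff_spec : Prop :=
  [/\ smooth_pos (ncutoff sys),
      forall u, 0 <= u -> ncutoff sys u != 0 -> 2^-1 <= u <= 2,
      forall u, 0 <= u -> 0 <= ncutoff sys u <= 1,
      exists2 c : R, 0 < c & forall u, 3 / 5 <= u <= 5 / 3 -> c <= ncutoff sys u
    & forall u, 1 <= u <= 2 -> ncutoff sys u ^+ 2 + ncutoff sys (u / 2) ^+ 2 = 1].

Definition node_spec : Prop :=
  [/\ 0 < netconst sys < 1,
      node sys 0 = [fset sphere_e1 R n]%fset /\
        (forall xi : idx, tag xi = 0%N -> weight xi = area [set: sphere]),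
      forall j, (0 < j)%N -> maximal_net (netconst sys * (2 / 2 ^+ j)) (node sys j),
      exists2 c : R, 1 <= c & forall xi : idx, (0 < tag xi)%N ->
        c^-1 * (2 ^+ (tag xi * n.+1))^-1 <= weight xi
                                         <= c * (2 ^+ (tag xi * n.+1))^-1
    & forall j, (0 < j)%N -> forall (k : nat) (p : mpoly.mpoly d R),
        (k <= 2 ^ j.+1)%N -> harmonic_homog k p ->
        \int[@sigma R n]_x mpoly_eval p x =
        \sum_(xi : node sys j) weight (Tagged (fun j => node sys j) xi) *
                             mpoly_eval p (val xi)].

Definition needlet_system : Prop :=
  [/\ zonal_kernels n Z, cutoff_spec, ncutoff_spec & node_spec].

(* Since [cutoff] and [ncutoff] vanish on [0, 1/2[ and beyond 2, only the
   degrees [k <= 2 ^ j] contribute to level [j]. *)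
Definition Phi_conv (j : nat) (F : dist) (x : sphere) : R[i] :=
  if j is j'.+1 then
    \sum_(k < (2 ^ j).+1) cutoff sys (k%:R / 2 ^+ j') * zconv (Z k) F x
  else zconv (Z 0) F x.

Definition Psi (j : nat) : {poly R} :=
  if j is j'.+1 then \sum_(k < (2 ^ j).+1) ncutoff sys (k%:R / 2 ^+ j') *: Z k
  else Z 0.

Definition psi_dia (xi : idx) : sphere -> R := zonal (Psi (tag xi)) (pt xi).

Definition psi (xi : idx) : sphere -> R :=
  zonal (Num.sqrt (weight xi) *: Psi (tag xi)) (pt xi).

Definition psi_test (xi : idx) : testfun R n :=
  zonal_testfun (Num.sqrt (weight xi) *: Psi (tag xi)) (pt xi).

Definition S_psi (F : dist) : idx -> R[i] := fun xi => pairing F (psi_test xi).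

Inductive scale := Besov | TriebelLizorkin.

Definition Qset (A s p q : R) : Prop :=
  [/\ `|s| <= A, A^-1 <= p <= A & A^-1 <= q].

Definition fnorm (X : scale) (s p q : R) (F : dist) : \bar R :=
  match X with
  | Besov =>
    ((\sum_(0 <= j <oo) ((2 `^ (s * j%:R))%:E *
        Lnorm (@sigma R n) p%:E (fun x => (Normc.normc (Phi_conv j F x))%:E)) `^ q)
      `^ q^-1)%E
  | TriebelLizorkin =>
    Lnorm (@sigma R n) p%:E (fun x => (\sum_(0 <= j <oo)
        ((2 `^ (s * j%:R) * Normc.normc (Phi_conv j F x)) `^ q)%:E) `^ q^-1)%E
  end.

Definition snorm (X : scale) (s p q : R) (h : idx -> R[i]) : \bar R :=
  match X with
  | Besov =>
    ((\sum_(0 <= j <oo)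
        ((2 `^ (j%:R * (s + n.+1%:R * (2^-1 - p^-1))) *
          (\sum_(xi : node sys j) Normc.normc (h (Tagged (fun j => node sys j) xi)) `^ p)
            `^ p^-1) `^ q)%:E) `^ q^-1)%E
  | TriebelLizorkin =>
    Lnorm (@sigma R n) p%:E (fun x => (\esum_(xi in [set: idx])
        ((area (gball (pt xi) (netconst sys * (2 / 2 ^+ tag xi)))
            `^ (- s / n.+1%:R - 2^-1) * Normc.normc (h xi) *
          \1_(gball (pt xi) (netconst sys * (2 / 2 ^+ tag xi))) x) `^ q)%:E)
      `^ q^-1)%E
  end.

Definition fspace (X : scale) (s p q : R) : set dist :=
  [set F | is_distribution F /\ (fnorm X s p q F < +oo)%E].

Definition sspace (X : scale) (s p q : R) : set (idx -> R[i]) :=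
  [set h | (snorm X s p q h < +oo)%E].

Section Theta.
Variables (K M : nat).

(* m = ceil ((M - d + 2) / 2), for M + 2 >= d. *)
Definition order_m : nat := uphalf (M + 2 - d).

Definition Fker (eps : R) (m : nat) (u : R) : R :=
  eps ^+ (2 * m - 1) *
  ((1 + eps) ^+ 2 + 1 - 2 * (1 + eps) * u) `^ (- (d%:R / 2) + 1 - m%:R).

(* The integral does not depend on [eta]. *)
Definition kappa (eps : R) (m : nat) (eta : sphere) : R :=
  (\int[@sigma R n]_x Fker eps m (edot x eta))^-1.

(* Here [d - 2 = n], and [d == 2] iff [n] is 0. *)
Definition newtonian (y : V) : R :=
  if d == 2 then ln (enorm y)^-1 else enorm y ^- (d - 2).

Definition newton_coeffs (m : nat) (b : R -> nat -> R) : Prop :=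
  forall eps, 0 < eps <= 1 -> forall x eta : sphere,
    let D l := iter l (fun f => 'D_(eta : V) f)
                 (fun y : V => newtonian (y - (1 + eps) *: (eta : V))) (x : V) in
    Fker eps m (edot x eta) =
    if d == 2 then b eps 0%N + \sum_(1 <= l < m.+1) b eps l * D l
    else \sum_(0 <= l < m.+1) b eps l * D l.

Definition Lambda (N : nat) (u : R) : R :=
  (-1) ^+ (K./2) * \sum_(k < 2 * N | (N < 2 * k)%N)
    ncutoff sys (k%:R / N%:R) * (k * (k + d - 2))%:R ^- (K./2) * (Z k).[u].

Definition findiff (l : nat) (t : R) (zeta : V) (f : V -> R) (x : V) : R :=
  t ^- l * \sum_(k < l.+1) (-1) ^+ (l - k) * 'C(l, k)%:R *
                           f (x + (k%:R * t) *: zeta).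

Definition rotation (i l : 'I_d) (t : R) (x : V) : V :=
  \row_j (if j == i then x 0 i * cos t + x 0 l * sin t
          else if j == l then - x 0 i * sin t + x 0 l * cos t
          else x 0 j).

Definition rotdiff (t : R) (f : V -> R) (x : V) : R :=
  t ^- 2 * \sum_(i < d) \sum_(l < d | (i < l)%N)
    (f (rotation i l (- t) x) + f (rotation i l t x) - 2 * f x).

Definition theta_dia (b : R -> nat -> R) (eps r t : R) (Y : {fset sphere})
    (P : sphere -> set sphere) (N : nat) (xi : sphere) (x : V) : R :=
  kappa eps order_m xi * \sum_(zeta <- Y | rho zeta xi <= r)
    area (P zeta) * Lambda N (edot xi zeta) *
    \sum_((if d == 2 then 1 else 0) <= l < order_m.+1) b eps l *
      iter (K./2) (rotdiff t)
        (findiff l t zeta (fun y => newtonian (y - (1 + eps) *: (zeta : V)))) x.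

Definition Theta (b : R -> nat -> R) (gamma0 : R)
    (theta : idx -> sphere -> R) : Prop :=
  exists (gamma1 gamma2 gamma3 : R) (t : nat -> R) (Y : nat -> {fset sphere})
    (P : nat -> sphere -> set sphere),
  let thd (xi : idx) (x : sphere) := theta_dia b (gamma1 / freq xi)
    (gamma3 * freq xi)^-1 (t (tag xi)) (Y (tag xi)) (P (tag xi))
    (2 ^ (tag xi).-1) (pt xi) x in
  [/\ [/\ 0 < gamma2, gamma2 <= gamma1 <= 1 & 0 < gamma3 <= 1],
      (* the poles are the images of the points [(1 + eps - k t_j) zeta],
         [0 <= k <= m], by rotations *)
      forall j, (0 < j)%N -> 0 < t j /\
        1 < 1 + gamma1 / 2 ^+ j.-1 - order_m%:R * t j,
      forall j, (0 < j)%N ->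
        [/\ maximal_net (gamma2 * (2 / 2 ^+ j)) (Y j),
            {in Y j, forall zeta, [/\ measurable (P j zeta),
               gball zeta (gamma2 / 2 ^+ j) `<=` P j zeta
             & P j zeta `<=` gball zeta (gamma2 * (2 / 2 ^+ j))]},
            trivIset [set` Y j] (P j)
          & \bigcup_(zeta in [set` Y j]) P j zeta = setT],
      forall xi : idx, (0 < tag xi)%N ->
        (forall beta, (mindex_size beta <= K)%N -> forall x : sphere,
          `|pderiv beta (fun y => breve (psi_dia xi) y - breve (thd xi) y) x| <=
          gamma0 * freq xi ^+ (mindex_size beta + d - 1) *
            (1 + freq xi * rho (pt xi) x) ^- M) /\
        (forall beta, (mindex_size beta < K)%N ->
          `|\int[@sigma R n]_y ((\prod_i (y : V) 0 i ^+ beta i) *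
              (psi_dia xi y - thd xi y))| <= gamma0 * freq xi ^- K)
    & forall xi : idx, theta xi =
        if tag xi == 0%N then psi xi
        else fun x => Num.sqrt (weight xi) * thd xi x].

Definition omega (xi eta : idx) : R :=
  let Nmin := Num.min (freq xi) (freq eta) in
  let Nmax := Num.max (freq xi) (freq eta) in
  (Nmin / Nmax) `^ (K%:R + (d - 1)%:R / 2) *
  (1 + Nmin * rho (pt xi) (pt eta)) ^- M.

(* [c42] may depend on the needlet system and on the coefficients [b], but not
   on [gamma0]. *)
Definition coupling_constant (b : R -> nat -> R) (c42 : R) : Prop :=
  1 <= c42 /\
  forall gamma0 theta, 0 < gamma0 -> Theta b gamma0 theta ->
    forall xi eta : idx,
      `|\int[@sigma R n]_x (psi eta x * (psi xi x - theta xi x))| <=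
      c42 * gamma0 * omega xi eta.

Definition almost_diagonal_constant (A C9 : R) : Prop :=
  1 <= C9 /\
  forall X s p q, Qset A s p q -> forall h, sspace X s p q h ->
    (forall xi, csummable (fun eta => (omega xi eta)%:C * h eta)) /\
    (snorm X s p q (fun xi => csum (fun eta => (omega xi eta)%:C * h eta))%R <=
     C9%:E * snorm X s p q h)%E.

End Theta.

Definition quasi_triangle_constant (A C1 : R) : Prop :=
  1 <= C1 /\
  forall X s p q, Qset A s p q ->
    (forall F G, fspace X s p q F -> fspace X s p q G ->
      (fnorm X s p q (fun u => F u + G u)%R <=
       C1%:E * (fnorm X s p q F + fnorm X s p q G))%E) /\
    (forall h k, sspace X s p q h -> sspace X s p q k ->
      (snorm X s p q (fun xi => h xi + k xi)%R <=
       C1%:E * (snorm X s p q h + snorm X s p q k))%E).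

Definition needlet_frame_constant (A C2 : R) : Prop :=
  1 < C2 /\
  forall X s p q, Qset A s p q ->
    (forall F, fspace X s p q F ->
      (snorm X s p q (S_psi F) <= C2%:E * fnorm X s p q F)%E) /\
    (forall h, sspace X s p q h ->
      [/\ synth_cvg psi h, fspace X s p q (synth psi h)
        & (fnorm X s p q (synth psi h) <= C2%:E * snorm X s p q h)%E]).

Definition tau0 (C1 : R) : R := ln 2 / (ln 2 + ln C1).

Definition epsilon0 (C1 C2 : R) : R :=
  (1 - 2 `^ (- tau0 C1)) `^ (tau0 C1)^-1 /
  (2 * C1 * C2 ^+ 4 * 2 `^ (tau0 C1)^-1).

Definition needlet_reproducing (A : R) : Prop :=
  forall X s p q, Qset A s p q -> forall F, fspace X s p q F ->
    synth psi (S_psi F) = F.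

Section Dual.
Variables (theta : idx -> sphere -> R).

Definition T_op (F : dist) : dist := synth theta (S_psi F).

(* The inverse of [T_op] on the given space (set to 0 outside the range). *)
Definition T_inv (X : scale) (s p q : R) : dist -> dist :=
  'pinv_(fun=> (fun=> 0)) (fspace X s p q) T_op.

Definition dual_term (X : scale) (s p q : R) (xi : idx) (F : dist) (eta : idx) : R[i] :=
  pairing (T_inv X s p q (dist_of (psi eta))) (psi_test xi) * pairing F (psi_test eta).

Definition dual_fun (X : scale) (s p q : R) (xi : idx) (F : dist) : R[i] :=
  csum (dual_term X s p q xi F).

Definition S_dual (X : scale) (s p q : R) (F : dist) : idx -> R[i] :=
  fun xi => dual_fun X s p q xi F.

End Dual.

End Needlets.

Arguments snorm {R n} sys X s p q h.
Arguments sspace {R n} sys X s p q _.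
Arguments psi {R n} sys xi _.
Arguments S_psi {R n} sys F _.

(* Main.v *)
(* The residuals [psi xi - theta xi] are bounded functions, hence lie in the space
   B^{-A,1}_1: Bessel's inequality bounds the L^1 norms of their projections onto
   spherical harmonics uniformly in the degree, the level [j] contains O(2^j)
   degrees, and A > 1.  They can therefore be expanded in needlets, and
   T_psi - T_theta = T_psi D, where D is the matrix <psi_eta, psi_xi - theta_xi>,
   dominated by c42 gamma0 omega.  The smallness of gamma0 makes G = D S_psi T_psi
   a contraction of the sequence space with 2 C1 |G| <= 1, so that the Neumann
   series of 1 - G converges even under the quasi-triangle inequality and inverts
   T = T_theta S_psi = T_psi (1 - D) S_psi.  Both sequence norms are mixed norms
   L^b(l^a) over a measure space, which provides the Fatou property and the
   density of finite sequences used for the series and for the termwise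
   application of the dual functionals. *)
From mathcomp Require Import all_boot all_order all_algebra finmap complex.
From mathcomp Require Import ring lra.
From mathcomp Require mpoly.
From mathcomp Require Import all_classical all_reals all_analysis.
From mathcomp Require Import measurable_realfun.
Require Import Defs.

Set Implicit Arguments.
Unset Strict Implicit.
Unset Printing Implicit Defensive.

Import Order.TTheory GRing.Theory Num.Theory ComplexField.
Import numFieldNormedType.Exports.

Local Open Scope classical_set_scope.
Local Open Scope ring_scope.
Local Open Scope complex_scope.

(** The needlet expansion of a residual is an identity between distributions, checked on each test
    function. It can therefore be established in one space of the range and then used for every
    [(s, p, q)]. For [s] near [A], placing a residual in the space itself would call on its
    derivatives; at the corner [(-A, 1, 1)] boundedness and measurability of [theta xi] are enough.
    The obstacle to the Neumann series is that the quasi-triangle inequality, applied term by term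
    to a long sum, costs a growing power of [C1]. The condition [2 C1 |G| <= 1] compensates exactly
    for this: when the first term is split off, a bound by [2 C1 |h|] reproduces itself, so it holds
    for all partial sums at once. The series lives on sequences and converges coordinatewise as an
    absolutely convergent complex series; its norm is recovered afterwards by the Fatou property. It
    serves surjectivity only. Injectivity of [T] and the bound on its inverse come from an a priori
    estimate, in which the same condition absorbs the error term. *)

Section Normc.
Variable R : rcfType.
Implicit Types z : R[i].
Local Notation nc z := (Normc.normc z : R).

Lemma normc_ge0 z : 0 <= nc z.
Proof. by case: z => a b; rewrite /Normc.normc sqrtr_ge0. Qed.

Lemma normc_sub z1 z2 : nc (z1 - z2) <= nc z1 + nc z2.
Proof. by rewrite -(normcN z2); exact: le_normcD. Qed.

Lemma normc_subC z1 z2 : nc (z1 - z2) = nc (z2 - z1).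
Proof. by rewrite -normcN opprB. Qed.

Lemma normc_real (r : R) : nc r%:C = `|r|.
Proof. by rewrite /= expr0n /= addr0 sqrtr_sqr. Qed.

Lemma normc_sum (I : Type) (s : seq I) (P : pred I) (u : I -> R[i]) :
  nc (\sum_(i <- s | P i) u i) <= \sum_(i <- s | P i) nc (u i).
Proof.
elim/big_rec2 : _ => [|i x y Pi h]; first by rewrite Normc.normc0.
by rewrite (le_trans (le_normcD _ _))// lerD2l.
Qed.

Lemma Re_le_normc z : `|complex.Re z| <= nc z.
Proof. by case: z => a b /=; rewrite -sqrtr_sqr; apply: (@ler_wsqrtr R); rewrite lerDl sqr_ge0. Qed.

Lemma Im_le_normc z : `|complex.Im z| <= nc z.
Proof. by case: z => a b /=; rewrite -sqrtr_sqr; apply: (@ler_wsqrtr R); rewrite lerDr sqr_ge0. Qed.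

Lemma normc_le_Re_Im z : nc z <= `|complex.Re z| + `|complex.Im z|.
Proof.
case: z => a b /=.
have h : 0 <= `|a| + `|b| by rewrite addr_ge0.
have k : a ^+ 2 + b ^+ 2 <= (`|a| + `|b|) ^+ 2.
  rewrite sqrrD !real_normK ?num_real// addrAC lerDl mulrn_wge0//.
by have := ler_wsqrtr k; rewrite sqrtr_sqr ger0_norm.
Qed.

End Normc.

(** * Unconditionally convergent sums *)

Section Csum.
Variables (R : realType) (I : choiceType).
Local Notation nc z := (Normc.normc z : R).
Implicit Types (u v : I -> R[i]) (a : I -> \bar R) (E : {fset I}) (l m : R[i]).

Lemma esum_fset_le a E : (forall i, 0 <= a i)%E ->
  (\sum_(i <- E) a i <= \esum_(i in setT) a i)%E.
Proof.
move=> a0; apply: esum_ge; exists [set` E]; first by split.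
by rewrite fsbig_finite//= set_fsetK.
Qed.

Lemma esum_le_fset a (c : \bar R) :
  (forall E, (\sum_(i <- E) a i <= c)%E) -> (\esum_(i in setT) a i <= c)%E.
Proof.
move=> h; apply: ge_ereal_sup => _ [X [finX _] <-].
by rewrite fsbig_finite.
Qed.

Lemma esum_split a E : (forall i, 0 <= a i)%E ->
  (\esum_(i in setT) a i = \sum_(i <- E) a i + \esum_(i in [set i | i \notin E]) a i)%E.
Proof.
move=> a0; rewrite (esumID [set` E])//; congr (_ + _)%E.
  by rewrite setTI esum_fset// fsbig_finite//= set_fsetK.
by rewrite setTI; congr esum; apply/seteqP; split=> i /= /negP.
Qed.

Lemma esum_tail_lt a (e : R) : (forall i, 0 <= a i)%E ->
  (\esum_(i in setT) a i < +oo)%E -> 0 < e ->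
  exists E0, forall E, (E0 `<=` E)%fset ->
    (\esum_(i in [set i | i \notin E]) a i < e%:E)%E.
Proof.
move=> a0 afin e0.
have fin : \esum_(i in setT) a i \is a fin_num.
  by rewrite ge0_fin_numE// esum_ge0.
have [_ [X [finX _] <-] hX] := ub_ereal_sup_adherent e0 fin.
exists (fset_set X) => E XE.
rewrite fsbig_finite// in hX.
have hE : (\sum_(i <- fset_set X) a i <= \sum_(i <- E) a i)%E.
  by apply: lee_sum_nneg_subfset => //; exact/fsubsetP.
have {hX}hE := lt_le_trans hX hE.
have fE : \sum_(i <- E) a i \is a fin_num.
  by rewrite ge0_fin_numE ?sume_ge0// (le_lt_trans _ afin)// esum_fset_le.
move: hE; rewrite -/(esum setT a) (esum_split E a0).
by rewrite lteBlDr// lteD2lE.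
Qed.

Lemma csum_to_uniq u l m : csum_to u l -> csum_to u m -> l = m.
Proof.
move=> ul um; apply/eqP; rewrite -subr_eq0; apply/eqP/Normc.eq0_normc/eqP.
rewrite eq_le normc_ge0 andbT; apply/ler_addgt0Pl => e e0; rewrite addr0.
have e20 : 0 < e / 2 by rewrite divr_gt0.
have [E0 h0] := ul _ e20; have [E1 h1] := um _ e20.
have {}h0 := h0 _ (fsubsetUl E0 E1); have {}h1 := h1 _ (fsubsetUr E0 E1).
rewrite [e]splitr -(subrKA (\sum_(i <- (E0 `|` E1)%fset) u i)).
by rewrite (le_trans (le_normcD _ _))// normc_subC lerD// ltW.
Qed.

Lemma csum_eq u l : csum_to u l -> csum u = l.
Proof.
move=> ul; apply: (csum_to_uniq (u := u)) => //.
by rewrite /csum; case: xgetP => [x -> //|/(_ l)].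
Qed.

Lemma csumP u : csummable u -> csum_to u (csum u).
Proof. by case=> l ul; rewrite (csum_eq ul). Qed.

Lemma csum_to_lin (c : R[i]) u v l m : csum_to u l -> csum_to v m ->
  csum_to (fun i => c * u i + v i) (c * l + m).
Proof.
move=> ul vm e e0.
have k0 : 0 < nc c + 1 by rewrite ltr_wpDl ?normc_ge0.
have e20 : 0 < e / 2 by rewrite divr_gt0.
have [E0 h0] := ul _ (divr_gt0 e20 k0).
have [E1 h1] := vm _ e20.
exists (E0 `|` E1)%fset => E; rewrite fsubUset => /andP[/h0 hE0 /h1 hE1].
rewrite big_split/= -mulr_sumr opprD addrACA -mulrBr.
rewrite (le_lt_trans (le_normcD _ _))// [e]splitr ler_ltD// Normc.normcM.
rewrite (le_trans (ler_wpM2l (normc_ge0 _) (ltW hE0)))//.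
by rewrite mulrA ler_pdivrMr// mulrC ler_wpM2l ?(ltW e20)// lerDl.
Qed.

Lemma csum_to0 : csum_to (fun _ : I => 0 : R[i]) 0.
Proof.
by move=> e e0; exists fset0 => E _; rewrite big1// subr0 Normc.normc0.
Qed.

Lemma csum_toZ (c : R[i]) u l : csum_to u l -> csum_to (fun i => c * u i) (c * l).
Proof.
move=> /(csum_to_lin c) /(_ csum_to0); rewrite addr0.
by congr csum_to; apply/funext => i; rewrite addr0.
Qed.

Lemma csum_toD u v l m : csum_to u l -> csum_to v m ->
  csum_to (fun i => u i + v i) (l + m).
Proof.
move=> ul /(csum_to_lin 1 ul); rewrite mul1r.
by congr csum_to; apply/funext => i; rewrite mul1r.
Qed.

Lemma csum_toN u l : csum_to u l -> csum_to (fun i => - u i) (- l).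
Proof.
by move=> /(csum_toZ (-1)); rewrite mulN1r; congr csum_to; apply/funext => i; rewrite mulN1r.
Qed.

Lemma csum_toB u v l m : csum_to u l -> csum_to v m ->
  csum_to (fun i => u i - v i) (l - m).
Proof. by move=> ul /csum_toN; exact: csum_toD. Qed.

Lemma csum_to_le u l (c : \bar R) : csum_to u l ->
  (forall E, (\sum_(i <- E) (nc (u i))%:E <= c)%E) ->
  ((nc l)%:E <= c)%E.
Proof.
move=> ul h; apply/lee_addgt0Pr => e e0.
have [E0 /(_ _ (fsubset_refl _)) hE] := ul _ e0.
apply: le_trans (leeD (h E0) (lexx _)); rewrite sumEFin -EFinD lee_fin.
rewrite -[l](subKr (\sum_(i <- E0) u i)) (le_trans (normc_sub _ _))// lerD ?normc_sum//.
exact: ltW.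
Qed.

Lemma csum_norm_le u l : csum_to u l ->
  ((nc l)%:E <= \esum_(i in setT) (nc (u i))%:E)%E.
Proof.
move=> /csum_to_le; apply => E; apply: esum_fset_le => i.
by rewrite lee_fin normc_ge0.
Qed.

Lemma csum_to_esum (r : I -> R) : (forall i, 0 <= r i) ->
  (\esum_(i in setT) (r i)%:E < +oo)%E ->
  csum_to (fun i => (r i)%:C) (fine (\esum_(i in setT) (r i)%:E)%E)%:C.
Proof.
move=> r0 rfin e e0.
have re0 i : (0 <= (r i)%:E)%E by rewrite lee_fin.
have [E0 hE0] := esum_tail_lt re0 rfin e0.
exists E0 => E /hE0 hE.
have fin : (\esum_(i in setT) (r i)%:E)%E \is a fin_num.
  by rewrite ge0_fin_numE// esum_ge0.
have : (\esum_(i in [set i | i \notin E]) (r i)%:E)%E \is a fin_num.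
  by rewrite ge0_fin_numE ?esum_ge0// (lt_trans hE)// ltry.
rewrite -rmorph_sum -rmorphB normc_real (esum_split E re0) sumEFin => /fineK hf.
rewrite -hf -EFinD /= opprD addNKr normrN ger0_norm -?lte_fin ?hf//.
by rewrite -lee_fin hf esum_ge0.
Qed.

(** Real and imaginary parts are split into positive and negative parts [(|r| + r) / 2] and
    [(|r| - r) / 2]; each of these is a nonnegative family dominated by the moduli, whose limit is
    its [esum]. *)
Lemma abs_summable_csummable u : abs_summable u -> csummable u.
Proof.
move=> us.
have key (r : I -> R) : (forall i, `|r i| <= nc (u i)) ->
    csummable (fun i => (r i)%:C).
  move=> ru.
  have hle (s : I -> R) : (forall i, 0 <= s i <= nc (u i)) ->
      csummable (fun i => (s i)%:C).
    move=> sP; eexists; apply: csum_to_esum => [i|]; first by case/andP : (sP i).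
    apply: le_lt_trans us; apply: le_esum => i _; rewrite lee_fin.
    by case/andP : (sP i).
  have [|l hl] := hle (fun i => (`|r i| + r i) / 2).
    move=> i; have := ler_norm (r i); have := ler_norm (- r i).
    by rewrite normrN; have := ru i; lra.
  have [|m hm] := hle (fun i => (`|r i| - r i) / 2).
    move=> i; have := ler_norm (r i); have := ler_norm (- r i).
    by rewrite normrN; have := ru i; lra.
  exists (l - m); have := csum_toB hl hm; congr csum_to; apply/funext => i.
  by rewrite -rmorphB -mulrBl; congr (_%:C); field.
have [l hl] := key (fun i => complex.Re (u i)) (fun i => Re_le_normc _).
have [m hm] := key (fun i => complex.Im (u i)) (fun i => Im_le_normc _).
exists ('i%C * m + l); have := csum_to_lin 'i%C hm hl; congr csum_to.
by apply/funext => i; rewrite addrC -complexE.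
Qed.

(** Finite dimension is what matters here. A sum over [E] is the sum over the union of [E0] and [E],
    which is within 1 of [l], minus a sum over a part of [E0]; hence [B] bounds all finite sums.
    Applying this to the subsets where the real or imaginary part has a fixed sign bounds the sum of
    the moduli by [4 B]. *)
Lemma csummable_abs_summable u : csummable u -> abs_summable u.
Proof.
case=> l /(_ _ ltr01)[E0 h0].
pose B := nc l + 1 + \sum_(i <- E0) nc (u i).
have bnd E : nc (\sum_(i <- E) u i) <= B.
  have -> : \sum_(i <- E) u i =
      (\sum_(i <- (E0 `|` E)%fset) u i - l) + l - \sum_(i <- (E0 `\` E)%fset) u i.
    rewrite subrK [in RHS](big_fsetID _ (fun x => x \in E)) /=.
    rewrite [X in X + _ - _](_ : _ = \sum_(i <- E) u i); last first.
      apply: eq_fbigl => x; rewrite !inE /=.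
      by case: (x \in E); rewrite ?(orbT, andbF).
    rewrite [X in _ + X - _](_ : _ = \sum_(i <- (E0 `\` E)%fset) u i) ?addrK//.
    apply: eq_fbigl => x; rewrite !inE /=.
    by case: (x \in E); rewrite ?(orbF, andbF, andbT).
  rewrite (le_trans (normc_sub _ _))// lerD//.
    rewrite addrC (le_trans (le_normcD _ _))// lerD// ltW// h0//.
    exact: fsubsetUl.
  rewrite (le_trans (normc_sum _ _ _))// [leRHS](big_fsetID _ (fun x => x \in E)) /=.
  rewrite [X in _ <= _ + X](_ : _ = \sum_(i <- (E0 `\` E)%fset) Normc.normc (u i)).
    by rewrite lerDr sumr_ge0// => i _; exact: normc_ge0.
  by apply: eq_fbigl => x; rewrite !inE andbC.
have bndP (P : pred I) E : nc (\sum_(i <- E | P i) u i) <= B.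
  by rewrite big_fset_condE; exact: bnd.
have bndR (r : I -> R) E :
    (forall P : pred I, `|\sum_(i <- E | P i) r i| <= B) ->
    \sum_(i <- E) `|r i| <= B + B.
  move=> h; rewrite (bigID (fun i => 0 <= r i)) /= lerD//.
    rewrite (eq_bigr r); last by move=> i /ger0_norm.
    by rewrite (le_trans (ler_norm _)).
  rewrite (eq_bigr (fun i => - r i)); last first.
    by move=> i; rewrite -ltNge => /ltr0_norm.
  by rewrite sumrN (le_trans (ler_norm _))// normrN.
apply: (@le_lt_trans _ _ (B + B + (B + B))%:E); last exact: ltry.
apply: esum_le_fset => E; rewrite sumEFin lee_fin.
apply: (@le_trans _ _ (\sum_(i <- E) (`|complex.Re (u i)| + `|complex.Im (u i)|))).
  by apply: ler_sum => i _; exact: normc_le_Re_Im.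
rewrite big_split/= lerD// bndR// => P; apply: le_trans (bndP P E).
  by rewrite -raddf_sum; exact: Re_le_normc.
by rewrite -raddf_sum; exact: Im_le_normc.
Qed.

End Csum.

Section CsumFubini.
Variables (R : realType).
Local Notation nc z := (Normc.normc z : R).

Lemma csum_to_fset (I : choiceType) (u : I -> R[i]) (E : {fset I}) :
  csum_to (fun i => if i \in E then u i else 0) (\sum_(i <- E) u i).
Proof.
move=> e e0; exists E => F EF.
rewrite -(big_fset_incl _ EF); last by move=> i _ /negbTE ->.
rewrite (eq_big_seq u); last by move=> i ->.
by rewrite subrr Normc.normc0.
Qed.

Lemma csum_tail_le (I : choiceType) (u : I -> R[i]) l (E : {fset I}) :
  csum_to u l ->
  ((nc (l - \sum_(i <- E) u i))%:E <= \esum_(i in [set i | i \notin E]) (nc (u i))%:E)%E.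
Proof.
move=> ul; have /csum_norm_le := csum_toB ul (@csum_to_fset _ u E).
move/le_trans; apply; rewrite [leRHS]esum_mkcond; apply: le_esum => i _.
case: ifPn => iE; last by rewrite subr0 ifT// mem_set//.
by rewrite subrr Normc.normc0; case: ifP => //; rewrite lee_fin normc_ge0.
Qed.

Lemma esum_exchange (I J : choiceType) (A : set I) (B : set J) (a : I -> J -> \bar R) :
  (forall i j, 0 <= a i j)%E ->
  (\esum_(i in A) \esum_(j in B) a i j = \esum_(j in B) \esum_(i in A) a i j)%E.
Proof.
move=> a0; rewrite (esum_esum (J := fun=> B))// (esum_esum (J := fun=> A))//.
rewrite (reindex_esum (B `*` A) _ (fun x => (x.2, x.1)))//.
split => [[x y] [? ?]//|[x y] [x' y'] _ _ [-> ->]//|[x y] [/= ? ?]].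
by exists (y, x).
Qed.

(** The error [L - \sum_(i <- E) r i] is the sum over [j] of the tails [t j - \sum_(i <- E) w i j].
    Each tail is at most a sum of moduli over [i] outside [E], and exchanging the nonnegative sums
    turns the total into a tail of the convergent double sum. *)
Lemma csum_fubini (I J : choiceType) (w : I -> J -> R[i]) (r : I -> R[i])
    (t : J -> R[i]) (L : R[i]) :
  (\esum_(i in setT) \esum_(j in setT) (nc (w i j))%:E < +oo)%E ->
  (forall i, csum_to (w i) (r i)) -> (forall j, csum_to (w^~ j) (t j)) ->
  csum_to t L -> csum_to r L.
Proof.
move=> wfin wr wt tL e e0.
have w0 i j : (0 <= (nc (w i j))%:E)%E by rewrite lee_fin normc_ge0.
have [E0 hE0] := esum_tail_lt (fun i => esum_ge0 (fun j _ => w0 i j)) wfin e0.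
exists E0 => E /hE0 hE.
have hs : csum_to (fun j => \sum_(i <- E) w i j) (\sum_(i <- E) r i).
  elim: (E : seq I) => [|i s ih].
    by rewrite big_nil; under eq_fun do rewrite big_nil; exact: csum_to0.
  by rewrite big_cons; under eq_fun do rewrite big_cons; exact: csum_toD.
rewrite normc_subC -lte_fin; apply: le_lt_trans hE.
apply: le_trans (csum_norm_le (csum_toB tL hs)) _.
rewrite esum_exchange//; apply: le_esum => j _.
exact: csum_tail_le.
Qed.

(** Passage from complex sums, in which the bound on the matrix [omega] is formulated, to [esum],
    for which comparison and exchange of nonnegative sums are available. *)
Lemma csum_ge0_esum (I : choiceType) (r : I -> R) : (forall i, 0 <= r i) ->
  csummable (fun i => (r i)%:C) ->
  ((nc (csum (fun i => (r i)%:C)))%:E = \esum_(i in setT) (r i)%:E)%E.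
Proof.
move=> r0 /csummable_abs_summable rs.
have rE : (\esum_(i in setT) (r i)%:E = \esum_(i in setT) (nc (r i)%:C)%:E)%E.
  by apply: eq_esum => i _; rewrite normc_real ger0_norm.
have rfin : (\esum_(i in setT) (r i)%:E < +oo)%E by rewrite rE.
have re0 : (0 <= \esum_(i in setT) (r i)%:E)%E.
  by apply: esum_ge0 => i _; rewrite lee_fin.
rewrite (csum_eq (csum_to_esum r0 rfin)) normc_real ger0_norm ?fine_ge0//.
by rewrite fineK// ge0_fin_numE.
Qed.

Lemma csum_nat_shift (u : nat -> R[i]) l :
  csum_to (fun k => u k.+1) l -> csum_to u (u 0%N + l).
Proof.
move=> ul.
(* [v] is [u] with its first term replaced by 0, so the index 0 may be dropped from any finite set
   before reindexing by the predecessor. *)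
pose v k := if k is k'.+1 then u k'.+1 else 0.
have vl : csum_to v l.
  move=> e e0; have [E0 h] := ul _ e0.
  exists [fset k.+1 | k in E0]%fset => E hE.
  pose E' := [fset k.-1 | k in (E `\ 0%N)%fset]%fset.
  have -> : \sum_(k <- E) v k = \sum_(k <- E') u k.+1.
    rewrite big_imfset/=; last first.
      by move=> [|x] [|y]; rewrite !inE//= => _ _ ->.
    transitivity (\sum_(k <- (E `\ 0%N)%fset) v k).
      apply/esym/big_fset_incl; first exact: fsubD1set.
      by move=> [|k]; rewrite !inE//= => ->.
    by apply: eq_big_seq => -[|k] //; rewrite !inE.
  apply: h; apply/fsubsetP => k kE; apply/imfsetP; exists k.+1 => //=.
  by rewrite !inE/=; apply: (fsubsetP hE); apply/imfsetP; exists k.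
have := csum_toD (csum_to_fset u [fset 0%N]%fset) vl; rewrite big_seq_fset1.
congr csum_to; apply/funext => -[|k]; rewrite !inE/=; first by rewrite addr0.
by rewrite add0r.
Qed.

End CsumFubini.

(** * Powers of extended real numbers *)

Section ErealPow.
Variable R : realType.
Implicit Types (x y : \bar R) (r : R).
Local Open Scope ereal_scope.

Lemma le_poweR x y r : (0 <= r)%R -> 0 <= x -> x <= y -> x `^ r <= y `^ r.
Proof.
move=> r0 x0 xy; apply: gt0_ler_poweR => //; rewrite in_itv/= leey andbT//.
exact: le_trans xy.
Qed.

Lemma poweRK x r : (r != 0)%R -> 0 <= x -> (x `^ r) `^ r^-1 = x.
Proof. by move=> r0 x0; rewrite -poweRrM divff// poweRe1. Qed.

Lemma poweRVK x r : (r != 0)%R -> 0 <= x -> (x `^ r^-1) `^ r = x.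
Proof. by move=> r0 x0; rewrite -poweRrM mulVf// poweRe1. Qed.

Lemma poweRV_le x y r : (0 < r)%R -> 0 <= x -> 0 <= y ->
  (x `^ r^-1 <= y) = (x <= y `^ r).
Proof.
move=> r0 x0 y0; have rn0 := lt0r_neq0 r0; apply/idP/idP => h.
  by rewrite -(poweRVK rn0 x0) le_poweR ?poweR_ge0// ltW.
by rewrite -[leRHS](poweRK rn0 y0) le_poweR// invr_ge0 ltW.
Qed.

Lemma cvge0_ge0 (u : nat -> \bar R) : (forall n, 0 <= u n) ->
  (forall e : R, (0 < e)%R -> exists N, forall n, (N <= n)%N -> u n <= e%:E) ->
  u @ \oo --> 0.
Proof.
move=> u0 h; apply/fine_cvgP; split.
  have [N hN] := h _ ltr01; exists N => // n /= /hN; rewrite ge0_fin_numE//.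
  by move/le_lt_trans; apply; exact: ltry.
apply/cvgrPdist_le => e e0; have [N hN] := h _ e0; exists N => // n /= /hN hn.
rewrite sub0r normrN ger0_norm ?fine_ge0//.
by rewrite -lee_fin fineK// ge0_fin_numE// (le_lt_trans hn)// ltry.
Qed.

End ErealPow.

(** * Mixed norms *)

Section MixedNorm.
Context d (T : measurableType d) (R : realType) (mu : {measure set T -> \bar R}).
Variables (I : choiceType) (E : nat -> {fset I}).
Hypothesis E_incr : forall m n, (m <= n)%N -> (E m `<=` E n)%fset.
Hypothesis E_exhaust : forall i, exists J, i \in E J.
Variables (k : I -> T -> R) (al be : R).
Hypotheses (k0 : forall i x, 0 <= k i x) (mk : forall i, measurable_fun setT (k i)).
Hypotheses (al0 : 0 < al) (be0 : 0 < be).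
Implicit Types a b : I -> R.

(** The norm of [(k i x * a i)_i] in L^be(l^al). The inner sum is kept as the [al]-th power of the
    l^al norm, which explains the exponent [be / al] in [mixed_int]. *)
Definition mixed_inner a (x : T) : \bar R :=
  \esum_(i in [set: I]) ((k i x * a i) `^ al)%:E.

Definition mixed_int a : \bar R := (\int[mu]_x (mixed_inner a x `^ (be / al)))%E.

Definition mixed_norm a : \bar R := (mixed_int a `^ be^-1)%E.

Let ba0 : 0 <= be / al. Proof. by rewrite divr_ge0// ltW. Qed.
Let ba_neq0 : be / al != 0. Proof. by rewrite gt_eqF// divr_gt0. Qed.

Lemma exhaust_sub (X : {fset I}) : exists J, (X `<=` E J)%fset.
Proof.
elim/finSet_rect: X => X IH.
have [->|/fset0Pn[i iX]] := eqVneq X fset0; first by exists 0%N; exact: fsub0set.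
have [J hJ] := IH _ (fproperD1 iX).
have [J' hJ'] := E_exhaust i.
exists (maxn J J'); apply/fsubsetP => j jX.
have [->|ji] := eqVneq j i.
  by apply: (fsubsetP (E_incr (leq_maxr J J'))).
apply: (fsubsetP (E_incr (leq_maxl J J'))); apply: (fsubsetP hJ).
by rewrite !inE ji.
Qed.

(** The exhaustion [E] replaces a supremum over all finite sets by the limit of a sequence; this is
    how [mixed_inner] becomes measurable. *)
Lemma esum_cvg (f : I -> \bar R) : (forall i, 0 <= f i)%E ->
  (fun J => \sum_(i <- E J) f i)%E @ \oo --> (\esum_(i in [set: I]) f i)%E.
Proof.
move=> f0.
have nd : {homo (fun J => \sum_(i <- E J) f i)%E : m n / (m <= n)%N >-> (m <= n)%E}.
  move=> m n mn; apply: lee_sum_nneg_subfset => //.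
  exact/fsubsetP/E_incr.
have := ereal_nondecreasing_cvgn nd.
rewrite (_ : ereal_sup _ = \esum_(i in [set: I]) f i)%E//.
apply/eqP; rewrite eq_le; apply/andP; split.
  by apply: ge_ereal_sup => _ [J _ <-]; exact: esum_fset_le.
apply: esum_le_fset => X; have [J hJ] := exhaust_sub X.
apply: (@le_trans _ _ (\sum_(i <- E J) f i)%E); last first.
  by apply: ereal_sup_ubound; exists J.
by apply: lee_sum_nneg_subfset => //; exact/fsubsetP.
Qed.

Lemma mixed_inner_ge0 a x : (0 <= mixed_inner a x)%E.
Proof. by apply: esum_ge0 => i _; rewrite lee_fin powR_ge0. Qed.

Lemma measurable_mixed_inner a : measurable_fun setT (mixed_inner a).
Proof.
apply: (emeasurable_fun_cvg (fun J x => \sum_(i <- E J) ((k i x * a i) `^ al)%:E)%E).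
  move=> J; apply: emeasurable_sum => i; apply/measurable_EFinP.
  apply: (@measurableT_comp _ _ _ _ _ _ (@powR R ^~ al)) => //.
  exact: measurable_funM.
by move=> x _; apply: esum_cvg => i; rewrite lee_fin powR_ge0.
Qed.

Let mpow a : measurable_fun setT (fun x => mixed_inner a x `^ (be / al))%E.
Proof.
apply: (@measurableT_comp _ _ _ _ _ _ (fun y => y `^ (be / al))%E).
  exact: measurable_poweR.
exact: measurable_mixed_inner.
Qed.

Lemma mixed_int_ge0 a : (0 <= mixed_int a)%E.
Proof. by apply: integral_ge0 => x _; exact: poweR_ge0. Qed.

Lemma mixed_norm_ge0 a : (0 <= mixed_norm a)%E.
Proof. exact: poweR_ge0. Qed.

Lemma le_mixed_inner a b x : (forall i, 0 <= a i <= b i) ->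
  (mixed_inner a x <= mixed_inner b x)%E.
Proof.
move=> ab; apply: le_esum => i _; have /andP[a0 b0] := ab i.
rewrite lee_fin; apply: ge0_ler_powR; rewrite ?nnegrE ?mulr_ge0 ?(ltW al0)//.
  exact: le_trans b0.
exact: ler_wpM2l.
Qed.

Lemma le_mixed_int a b : (forall i, 0 <= a i <= b i) ->
  (mixed_int a <= mixed_int b)%E.
Proof.
move=> ab; apply: ge0_le_integral => //.
  by move=> x _; exact: poweR_ge0.
by move=> x _; apply: le_poweR; rewrite ?mixed_inner_ge0 ?le_mixed_inner.
Qed.

Lemma le_mixed_norm a b : (forall i, 0 <= a i <= b i) ->
  (mixed_norm a <= mixed_norm b)%E.
Proof.
move=> ab; apply: le_poweR; [by rewrite invr_ge0 ltW|exact: mixed_int_ge0|].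
exact: le_mixed_int.
Qed.

Lemma mixed_norm_le a (C : R) : 0 <= C ->
  (mixed_norm a <= C%:E)%E = (mixed_int a <= (C `^ be)%:E)%E.
Proof. by move=> C0; rewrite poweRV_le ?mixed_int_ge0. Qed.

Lemma mixed_normZ_le (c : R) a : 0 < c -> (forall i, 0 <= a i) ->
  (mixed_norm (fun i => c * a i)%R <= c%:E * mixed_norm a)%E.
Proof.
move=> c0 a0.
have c0' := ltW c0.
have h x : (mixed_inner (fun i => c * a i)%R x <= (c `^ al)%:E * mixed_inner a x)%E.
  apply: esum_le_fset => X.
  under eq_bigr do rewrite mulrCA powRM ?mulr_ge0// EFinM.
  rewrite -ge0_sume_distrr; last by move=> i _; rewrite lee_fin powR_ge0.
  rewrite lee_wpmul2l ?lee_fin ?powR_ge0//; apply: esum_fset_le => i.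
  by rewrite lee_fin powR_ge0.
rewrite /mixed_norm poweRV_le ?mule_ge0 ?poweR_ge0 ?lee_fin ?mixed_int_ge0//.
rewrite poweRM ?poweR_ge0 ?lee_fin// poweRVK ?gt_eqF ?mixed_int_ge0//.
rewrite -ge0_integralZl//; first last.
- by rewrite poweR_ge0.
- by move=> x _; rewrite poweR_ge0.
- apply: ge0_le_integral => //.
  + by move=> x _; rewrite poweR_ge0.
  + apply: measurable_funeM; exact: mpow.
  + move=> x _; apply: (@le_trans _ _ (((c `^ al)%:E * mixed_inner a x) `^ (be / al))%E).
      by apply: le_poweR; rewrite ?mixed_inner_ge0.
    rewrite poweRM ?lee_fin ?powR_ge0 ?mixed_inner_ge0//=.
    by rewrite -powRrM mulrCA divff ?gt_eqF// mulr1.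
Qed.

(** The Fatou property. Monotone convergence bounds the integral of the limit of the inner sums of
    [u n]; it remains to see pointwise that this limit dominates the inner sum of [a]. The
    hypothesis asks only that [a i] be at most the supremum of the [u n i]. *)
Lemma mixed_norm_sup (u : nat -> I -> R) a (C : R) : 0 <= C ->
  (forall n i, 0 <= u n i) -> (forall i, 0 <= a i) ->
  (forall i m n, (m <= n)%N -> u m i <= u n i) ->
  (forall i y, y < a i -> exists n, y < u n i) ->
  (forall n, (mixed_norm (u n) <= C%:E)%E) -> (mixed_norm a <= C%:E)%E.
Proof.
move=> C0 u0 a0 ndu ua uC; rewrite mixed_norm_le//.
pose f n x := (mixed_inner (u n) x `^ (be / al))%E.
have ndf x : {homo f^~ x : m n / (m <= n)%N >-> (m <= n)%E}.
  move=> m n mn; apply: le_poweR; rewrite ?mixed_inner_ge0//.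
  by apply: le_mixed_inner => i; rewrite u0 ndu.
have f0 n x : (0 <= f n x)%E by exact: poweR_ge0.
have cf x : cvgn (f ^~ x) by apply: ereal_nondecreasing_is_cvgn.
apply: (@le_trans _ _ (\int[mu]_x limn (f ^~ x))%E); last first.
  rewrite (monotone_convergence mu)//; last by move=> n; exact: mpow.
  apply: lime_le.
    apply: ereal_nondecreasing_is_cvgn => m n mn.
    by apply: ge0_le_integral => //; [exact: mpow|exact: mpow|move=> x _; exact: ndf].
  apply: nearW => n; have := uC n; rewrite mixed_norm_le//.
apply: ge0_le_integral => //.
- by move=> x _; exact: poweR_ge0.
- apply: (emeasurable_fun_cvg f); first by move=> n; exact: mpow.
  by move=> x _; exact: cf.
move=> x _; set L := limn _.
have L0 : (0 <= L)%E by apply: lime_ge => //; apply: nearW => n; exact: f0.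
have fL n : (f n x <= L)%E.
  by apply: lime_ge => //; near=> m; apply: ndf; near: m; exact: nbhs_infty_ge.
rewrite -[leRHS](poweRVK ba_neq0 L0) le_poweR// ?mixed_inner_ge0//.
have uL n : (mixed_inner (u n) x <= L `^ (be / al)^-1)%E.
  rewrite -[leLHS](poweRK ba_neq0)//; last exact: mixed_inner_ge0.
  apply: le_poweR; [by rewrite invr_ge0|exact: poweR_ge0|exact: fL].
case: (L `^ _)%E uL => [L'| |] uL; last 2 first.
- by rewrite leey.
- by have := le_trans (mixed_inner_ge0 _ x) (uL 0%N); rewrite leeNy_eq.
apply: esum_le_fset => X; rewrite sumEFin lee_fin leNgt; apply/negP.
set S := \sum_(i <- X) _ => L'S.
have L'0 : 0 <= L' by rewrite -lee_fin (le_trans (mixed_inner_ge0 _ x) (uL 0%N)).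
have S0 : 0 < S := le_lt_trans L'0 L'S.
(* The midpoint of [L' / S] and 1, so that [t < 1] and [L' < t * S]. Shrinking [a] by
   [c = t ^ (1 / al)] multiplies [S] by [t] and leaves room for one [n] with [c * a i <= u n i] at
   all indices of the finite set [X]. *)
pose t := (L' / S + 1) / 2.
have t0 : 0 < t by rewrite divr_gt0// ltr_wpDl// divr_ge0// ltW.
have t1 : t < 1.
  by rewrite ltr_pdivrMr// mul1r ltrD2r ltr_pdivrMr// mul1r.
have tS : L' < t * S.
  rewrite /t mulrAC mulrDl mul1r divfK ?gt_eqF// ltr_pdivlMr// mulr_natr mulr2n.
  by rewrite ltrD2l.
pose c := t `^ al^-1.
have c1 : c < 1.
  have -> : 1 = 1 `^ al^-1 :> R by rewrite powR1.
  by rewrite gt0_ltr_powR ?invr_gt0 ?nnegrE ?(ltW t0)//.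
have c0 : 0 <= c by exact: powR_ge0.
have [n hn] : exists n, forall i, i \in (X : seq I) -> c * a i <= u n i.
  elim: (X : seq I) => [|i s [n hn]]; first by exists 0%N.
  have [m hm] : exists m, c * a i <= u m i.
    have [ai0|ai0] := eqVneq (a i) 0; first by exists 0%N; rewrite ai0 mulr0.
    have [|m /ltW hm] := ua i (c * a i); last by exists m.
    by rewrite gtr_pMl// lt_def ai0 a0.
  exists (maxn m n) => j; rewrite inE => /predU1P[->|/hn hj].
    exact: le_trans hm (ndu _ _ _ (leq_maxl m n)).
  exact: le_trans hj (ndu _ _ _ (leq_maxr m n)).
have := uL n; apply/negP; rewrite -ltNge.
apply: (@lt_le_trans _ _ (\sum_(i <- X) ((k i x * u n i) `^ al)%:E)%E); last first.
  by apply: esum_fset_le => i; rewrite lee_fin powR_ge0.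
rewrite sumEFin lte_fin (lt_le_trans tS)// mulr_sumr big_seq [leRHS]big_seq.
apply: ler_sum => i iX.
have -> : t = c `^ al by rewrite -powRrM mulVf ?gt_eqF// powRr1// ltW.
rewrite -powRM ?mulr_ge0//; apply: ge0_ler_powR.
- exact: ltW.
- by rewrite nnegrE !mulr_ge0.
- by rewrite nnegrE mulr_ge0.
- by rewrite mulrCA ler_wpM2l// hn.
Unshelve. all: by end_near. Qed.

(** Both exponents are finite, so dominated convergence applies: the full inner sum, raised to
    [be / al], is an integrable majorant, hence finite almost everywhere, and at such points the
    tails of the inner sum tend to 0. Larger sets [X] are covered by monotonicity. *)
Lemma mixed_norm_tail a (e : R) : (forall i, 0 <= a i) ->
  (mixed_norm a < +oo)%E -> 0 < e ->
  exists J, forall X : {fset I}, (E J `<=` X)%fset ->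
    (mixed_norm (fun i => if i \in X then 0 else a i)%R < e%:E)%E.
Proof.
move=> a0 afin e0; have e20 : 0 < e / 2 by rewrite divr_gt0.
pose v J i := if i \in E J then 0 else a i.
have v0 J i : 0 <= v J i <= a i by rewrite /v; case: ifP; rewrite ?lexx a0.
pose f J x := (mixed_inner (v J) x `^ (be / al))%E.
have f0 J x : (0 <= f J x)%E by exact: poweR_ge0.
have fa J x : (f J x <= mixed_inner a x `^ (be / al))%E.
  by apply: le_poweR => //; [exact: mixed_inner_ge0|exact: le_mixed_inner].
have int_lt : (mixed_int a < +oo)%E.
  by apply: (@lty_poweRy _ _ be^-1) => //; rewrite gt_eqF ?invr_gt0.
have ia : mu.-integrable setT (fun x => mixed_inner a x `^ (be / al))%E.
  apply/integrableP; split; first exact: mpow.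
  apply: le_lt_trans int_lt; apply: ge0_le_integral => //.
  - by apply: measurableT_comp => //; exact: mpow.
  - by move=> x _; rewrite gee0_abs ?poweR_ge0.
have := @dominated_convergence _ _ _ mu setT measurableT f (cst 0%E)
  (fun x => mixed_inner a x `^ (be / al))%E (fun J => mpow (v J)) (@measurable_cst _ _ _ _ _ _).
case => //.
- have := integrable_ae measurableT ia.
  apply: filterS => x /(_ Logic.I) fin _.
  have {}fin : (mixed_inner a x < +oo)%E.
    by apply: (@lty_poweRy _ _ (be / al)) => //; rewrite -ge0_fin_numE ?poweR_ge0.
  apply: cvge0_ge0 => // r r0.
  have term0 i : (0 <= ((k i x * a i) `^ al)%:E)%E by rewrite lee_fin powR_ge0.
  have [X0 hX0] := esum_tail_lt term0 fin (powR_gt0 (be / al)^-1 r0).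
  have [J hJ] := exhaust_sub X0; exists J => n Jn.
  have hn := hX0 _ (fsubset_trans hJ (E_incr Jn)).
  rewrite /f -[leRHS](poweRVK ba_neq0) ?lee_fin ?(ltW r0)//.
  apply: le_poweR => //; first exact: mixed_inner_ge0.
  apply: le_trans (ltW hn).
  rewrite [leRHS]esum_mkcond; apply: le_esum => i _.
  rewrite /v; have [iE|iE] := boolP (i \in E n); last by rewrite ifT// mem_set.
  by rewrite mulr0 powR0 ?gt_eqF//; case: ifP.
- by apply: aeW => x J _; rewrite gee0_abs ?f0 ?fa.
move=> _ _; rewrite integral0 => /(_ [set y | (y < ((e / 2) `^ be)%:E)%E]).
case.
  by apply: open_ereal_lt'; rewrite lte_fin powR_gt0.
move=> J _ /(_ J (leqnn J)) /= hJ; exists J => X JX.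
apply: (@le_lt_trans _ _ (e / 2)%:E); last by rewrite lte_fin ltr_pdivrMr// ltr_pMr// ltr1n.
rewrite (mixed_norm_le _ (ltW e20)).
apply: le_trans (ltW hJ); apply: le_mixed_int => i.
case: ifPn => [_|iX]; first by rewrite lexx; case/andP: (v0 J i).
by rewrite a0 /= /v ifF//; apply/negbTE; apply: contra iX; exact/fsubsetP.
Qed.

(** On [B] the single term of index [i] already makes the inner sum at least [(c * a i) ^ al], so
    [mixed_int a] is at least [(c * a i) ^ be] times the measure of [B]. *)
Lemma mixed_norm_coord i (B : set T) (c : R) : measurable B -> (0 < mu B)%E ->
  0 < c -> (forall x, B x -> c <= k i x) ->
  exists2 D : R, 0 < D & forall a, (forall j, 0 <= a j) ->
    ((a i)%:E <= D%:E * mixed_norm a)%E.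
Proof.
move=> mB muB c0 ck.
have key a : (forall j, 0 <= a j) -> (((c * a i) `^ be)%:E * mu B <= mixed_int a)%E.
  move=> a0; rewrite -integral_cst//.
  apply: (@le_trans _ _ (\int[mu]_(x in B) (mixed_inner a x `^ (be / al)))%E); last first.
    apply: ge0_subset_integral => //.
    by move=> x _; exact: poweR_ge0.
  apply: ge0_le_integral => //.
  - by move=> x _; rewrite lee_fin powR_ge0.
  - by apply: measurable_funTS; exact: mpow.
  - move=> x Bx /=; rewrite -[be in leLHS](divfK (lt0r_neq0 al0)) (mulrC (be / al)) powRrM -poweR_EFin.
    apply: le_poweR => //; first by rewrite lee_fin powR_ge0.
    apply: (@le_trans _ _ (\sum_(j <- [fset i]%fset) ((k j x * a j) `^ al)%:E)%E).
      rewrite big_seq_fset1 lee_fin; apply: ge0_ler_powR.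
      + exact: ltW.
      + by rewrite nnegrE mulr_ge0// ltW.
      + by rewrite nnegrE mulr_ge0.
      + by apply: ler_wpM2r => //; exact: ck.
    by apply: esum_fset_le => j; rewrite lee_fin powR_ge0.
(* The measure of [B] may be infinite, so a positive real number below it is used instead. *)
have [m m0 mB'] : exists2 m : R, 0 < m & (m%:E <= mu B)%E.
  case: (mu B) muB => [r r0| |]; [by exists r|by exists 1; rewrite ?leey|by []].
exists (c^-1 * m `^ (- be^-1)); first by rewrite mulr_gt0 ?invr_gt0 ?powR_gt0.
move=> a a0.
have h : (((c * a i) `^ be * m)%:E <= mixed_int a)%E.
  apply: le_trans (key a a0); rewrite EFinM lee_pmul// ?lee_fin ?powR_ge0//.
  exact: ltW.
have /= : ((((c * a i) `^ be * m)%:E `^ be^-1) <= mixed_norm a)%E.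
  apply: le_poweR => //; first by rewrite invr_ge0 ltW.
  by rewrite lee_fin mulr_ge0 ?powR_ge0 ?(ltW m0).
rewrite powRM ?powR_ge0 ?(ltW m0)// -powRrM mulfV ?gt_eqF// powRr1 ?mulr_ge0 ?(ltW c0)//.
move=> {}h; apply: le_trans (lee_wpmul2l _ h); last first.
  by rewrite lee_fin mulr_ge0 ?invr_ge0 ?powR_ge0 ?(ltW c0).
rewrite -EFinM lee_fin powRN.
have m1 : m `^ be^-1 != 0 by rewrite gt_eqF ?powR_gt0.
by rewrite le_eqVlt; apply/orP; left; apply/eqP; field; rewrite m1 gt_eqF.
Qed.

Lemma mixed_norm_delta i : (\int[mu]_x ((k i x `^ be)%:E) < +oo)%E ->
  (mixed_norm (fun j => (j == i)%:R) < +oo)%E.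
Proof.
move=> ki; apply: poweR_lty; apply: le_lt_trans ki.
apply: ge0_le_integral => //.
- by move=> x _; exact: poweR_ge0.
- apply/measurable_EFinP.
  exact: (@measurableT_comp _ _ _ _ _ _ (@powR R ^~ be)).
- move=> x _; rewrite -[be in leRHS](divfK (lt0r_neq0 al0)) (mulrC (be / al)) powRrM -poweR_EFin.
  apply: le_poweR => //; first exact: mixed_inner_ge0.
  rewrite /mixed_inner (esumID [set i]); last by move=> j _; rewrite lee_fin powR_ge0.
  rewrite setTI esum_set1 ?lee_fin ?powR_ge0// eqxx mulr1 esum1 ?adde0//.
  move=> j [_ /= /eqP/negbTE ->]; by rewrite mulr0 powR0 ?gt_eqF.
Qed.

End MixedNorm.

(** * Measure and geometry of the sphere *)

Section Cubes.
Variable R : realType.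

Definition tcube k (c : k.-tuple R) (r : R) : set (k.-tuple R) :=
  [set t | forall i, `|tnth t i - tnth c i| <= r].

Lemma measurable_tcube k (c : k.-tuple R) r : measurable (tcube c r).
Proof.
rewrite (_ : tcube c r =
    \big[setI/setT]_(i < k) ((fun t : k.-tuple R => tnth t i) @^-1` `[tnth c i - r, tnth c i + r]%classic)).
  apply: bigsetI_measurable => i _.
  by rewrite -[X in measurable X]setTI; exact: measurable_tnth.
apply/seteqP; split=> t /=.
  move=> h; rewrite -bigcap_seq => i _ /=.
  by rewrite in_itv/= -ler_distlC distrC.
by rewrite -bigcap_seq => h i; have := h i (mem_index_enum i); rewrite /= in_itv/= -ler_distlC distrC.
Qed.

Lemma cons_pair_tcube k (c : k.+1.-tuple R) r :
  @cons_pair R k @^-1` (tcube c r) =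
  `[thead c - r, thead c + r]%classic `*` tcube [tuple of behead c] r.
Proof.
apply/seteqP; split => [[x t]|[x t]] /=.
  move=> h; split => /=.
    by have := h ord0; rewrite /= in_itv/= -ler_distlC distrC.
  move=> i; have := h (lift ord0 i); rewrite /cons_pair tnthS tnth_behead.
  by congr (`|_ - tnth c _| <= _); apply/val_inj; rewrite /= inordK// ltnS.
move=> [h1 h2] i; case: (unliftP ord0 i) => [j ->|->].
  have := h2 j; rewrite /cons_pair tnthS tnth_behead.
  by congr (`|_ - tnth c _| <= _); apply/val_inj; rewrite /= inordK// ltnS.
by move: h1; rewrite /= in_itv/= -ler_distlC distrC.
Qed.

(** Cubes are products, so their volume follows the recursion defining [lebesgue_tuple]. They bound
    cones from outside in [sigma_fin] and from inside in [sigma_gball_gt0]. *)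
Lemma lebesgue_tuple_tcube k (c : k.-tuple R) r : 0 <= r ->
  lebesgue_tuple R k (tcube c r) = ((2 * r) ^+ k)%:E.
Proof.
move=> r0; elim: k c => [|k ih] c.
  by rewrite /= diracE mem_set// => -[].
transitivity ((@lebesgue_measure R \x lebesgue_tuple R k)%E
    (@cons_pair R k @^-1` (tcube c r))) => //.
rewrite cons_pair_tcube product_measure1E ?ih//; last exact: measurable_tcube.
have := @lebesgue_measure_itv R `[(thead c - r), (thead c + r)].
rewrite /= lte_fin => ->; case: ifPn => h.
  by rewrite -EFinD -EFinM exprS; congr (_ * _)%:E; ring.
have -> : r = 0 by apply/eqP; rewrite eq_le r0 andbT; move: h; rewrite -leNgt; lra.
by rewrite mul0e mulr0 exprS mul0r.
Qed.

End Cubes.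

Section SphereGeometry.
Variables (R : realType) (n : nat).
Local Notation d := n.+2.
Local Notation sphere := (sphere R n).
Local Notation sigma := (@sigma R n).
Implicit Types x y : sphere.

Lemma edot_sphere x : edot x x = 1.
Proof. exact/eqP/(valP x). Qed.

Lemma sphere_neq0 x : (x : 'rV[R]_d) != 0.
Proof.
apply/eqP => x0; have := edot_sphere x; rewrite x0 /edot big1 => [/eqP|i _].
  by rewrite eq_sym oner_eq0.
by rewrite mxE mul0r.
Qed.

Lemma enorm_sphere x : enorm x = 1.
Proof. by rewrite /enorm edot_sphere sqrtr1. Qed.

Lemma edotC (u v : 'rV[R]_d) : edot u v = edot v u.
Proof. by apply: eq_bigr => i _; rewrite mulrC. Qed.

Lemma edotDl (u v w : 'rV[R]_d) : edot (u + v) w = edot u w + edot v w.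
Proof. by rewrite -big_split/=; apply: eq_bigr => i _; rewrite mxE mulrDl. Qed.

Lemma edotZl (c : R) (u w : 'rV[R]_d) : edot (c *: u) w = c * edot u w.
Proof. by rewrite mulr_sumr; apply: eq_bigr => i _; rewrite mxE mulrA. Qed.

Lemma edotDr (u v w : 'rV[R]_d) : edot w (u + v) = edot w u + edot w v.
Proof. by rewrite ![edot w _]edotC edotDl. Qed.

Lemma edotZr (c : R) (u w : 'rV[R]_d) : edot w (c *: u) = c * edot w u.
Proof. by rewrite ![edot w _]edotC edotZl. Qed.

Lemma edot_ge0 (u : 'rV[R]_d) : 0 <= edot u u.
Proof. by apply: sumr_ge0 => i _; rewrite -expr2 sqr_ge0. Qed.

Lemma edot_itv x y : -1 <= edot x y <= 1.
Proof.
have := edot_ge0 ((x : 'rV_d) + (y : 'rV_d)); have := edot_ge0 ((x : 'rV_d) + (-1) *: (y : 'rV_d)).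
rewrite !(edotDl, edotDr, edotZl, edotZr) !edot_sphere (edotC y x); lra.
Qed.

Lemma sphere_coord_le1 x i : `|(x : 'rV[R]_d) 0 i| <= 1.
Proof.
have := edot_sphere x; rewrite /edot (bigD1 i)//= -expr2 => h.
rewrite -ler_sqr ?nnegrE// real_normK ?num_real// expr1n -h lerDl.
by apply: sumr_ge0 => j _; rewrite -expr2 sqr_ge0.
Qed.

Lemma breve_sphere (g : sphere -> R) x : breve g x = g x.
Proof.
have [y yE ->] := breveE (sphere_neq0 x); congr g; apply/val_inj.
by rewrite /= yE enorm_sphere invr1 scale1r.
Qed.

Lemma measurable_sphere_coord i : measurable_fun setT (fun x : sphere => (x : 'rV[R]_d) 0 i).
Proof.
move=> _ B mB; apply: sub_sigma_algebra.
rewrite -bigcup_mkord_ord; exists (val i); first exact: (ltn_ord i).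
exists B => //.
by rewrite inord_val.
Qed.

Lemma measurable_edot y : measurable_fun setT (fun x : sphere => edot x y).
Proof.
apply: measurable_sum => i; apply: measurable_funM => //.
exact: measurable_sphere_coord.
Qed.

Lemma rho_lt x y r : 0 <= r <= pi -> (rho x y < r) = (cos r < edot x y).
Proof.
move=> rpi; rewrite -[edot x y in RHS]acosK ?ltr_cos// ?in_itv ?edot_itv//=.
by rewrite acos_ge0 ?acos_lepi ?edot_itv.
Qed.

Lemma measurable_gball y r : measurable (gball y r).
Proof.
have [r0|r0] := ltP r 0.
  rewrite (_ : gball y r = set0)//; apply/seteqP; split => // x /=.
  by rewrite /gball/= ltNge (le_trans (ltW r0))//= acos_ge0 ?edot_itv.
have [rpi|rpi] := leP r pi.
  rewrite (_ : gball y r = (fun x : sphere => edot x y) @^-1` `]cos r, +oo[%classic).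
    by rewrite -[X in measurable X]setTI; exact: measurable_edot.
  by apply/seteqP; split => x; rewrite /gball /= in_itv/= andbT rho_lt// r0.
rewrite (_ : gball y r = setT)//; apply/seteqP; split => // x _.
by rewrite /gball /= (le_lt_trans _ rpi)// acos_lepi ?edot_itv.
Qed.

Lemma sigma_fin : (sigma setT < +oo)%E.
Proof.
rewrite /Defs.sigma lte_mul_pinfty//.
have c0 : d.-tuple R := [tuple of nseq d 0].
apply: (@le_lt_trans _ _ (lebesgue_tuple R d (tcube [tuple of nseq d 0] 1))).
  apply: le_measure; rewrite ?inE.
  - exact: measurable_cone.
  - exact: measurable_tcube.
  - move=> t [s [x [/andP[s0 s1] _ tx]]] i.
    rewrite tx (tnth_nth 0) nth_nseq ltn_ord subr0 normrM gtr0_norm//.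
    by rewrite -[leRHS]mulr1 ler_pM// ?sphere_coord_le1// ltW.
by rewrite lebesgue_tuple_tcube// ltry.
Qed.

(** The point [y / 2] is interior to the cone over the ball: a cube of half-side [e] around it lies
    in the cone and has positive volume. *)
Lemma sigma_gball_gt0 y r : 0 < r -> (0 < sigma (gball y r))%E.
Proof.
move=> r0; pose q := Num.min r 1.
have q0 : 0 < q by rewrite lt_min r0 ltr01.
have qpi : 0 <= q <= pi.
  by rewrite (ltW q0) (le_trans _ (pi_ge2 _))// (@le_trans _ _ 1) ?ler1n// ge_min lexx orbT.
have cq1 : cos q < 1.
  by rewrite -(@cos0 R) ltr_cos// in_itv/= ?qpi ?lexx ?pi_ge0.
(* Taking the maximum with 0 allows the condition [c * |v| < <v, y>] to be squared. *)
pose c := Num.max 0 (cos q).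
have c0 : 0 <= c by rewrite le_max lexx.
have c1 : c < 1 by rewrite gt_max ltr01.
have cc1 : 0 < 1 - c ^+ 2 by rewrite subr_gt0 expr_lt1.
have d0 : 0 < d%:R :> R by rewrite ltr0n.
have cc2 : 1 - c ^+ 2 <= 1 by rewrite gerBl sqr_ge0.
(* For [v = w + y / 2] with [|w|^2] and [|<w, y>|] at most [eta], the squared condition reads [c^2
   (|w|^2 + <w, y> + 1/4) < (<w, y> + 1/2)^2]. With [c^2 = 1 - 13 eta] the left side is at most
   [1/4 - 5 eta / 4] and the right side at least [1/4 - eta]. *)
pose eta := (1 - c ^+ 2) / 13.
have eta0 : 0 < eta by rewrite divr_gt0.
have eta1 : eta <= 1 / 13 by rewrite ler_pM2r.
pose e := eta / d%:R.
have e0 : 0 < e by rewrite divr_gt0.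
have e1 : e <= 1.
  by rewrite ler_pdivrMr// mul1r (le_trans eta1)// (@le_trans _ _ 1) ?ler1n//; lra.
have de : d%:R * e = eta by rewrite mulrC divfK ?gt_eqF.
pose ct : d.-tuple R := [tuple (y : 'rV[R]_d) 0 i / 2 | i < d].
have sub : tcube ct e `<=` cone (gball y r).
  move=> t ht.
  pose v : 'rV[R]_d := \row_i tnth t i.
  have [w we vE] : exists2 w : 'rV[R]_d,
      forall i, `|w 0 i| <= e & v = w + 2^-1 *: (y : 'rV[R]_d).
    exists (v + (- 2^-1) *: (y : 'rV[R]_d)) => [i|]; last by rewrite scaleNr subrK.
    by have := ht i; rewrite !mxE tnth_mktuple; congr (`|_| <= _); ring.
  have wy : `|edot w y| <= eta.
    rewrite -de (le_trans (ler_norm_sum _ _ _))//.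
    rewrite (@le_trans _ _ (\sum_(i < d) e))//; last by rewrite sumr_const card_ord mulr_natl.
    apply: ler_sum => i _; rewrite normrM -[leRHS]mulr1 ler_pM//.
    exact: sphere_coord_le1.
  have ww : edot w w <= eta.
    rewrite -de (@le_trans _ _ (\sum_(i < d) e))//; last by rewrite sumr_const card_ord mulr_natl.
    apply: ler_sum => i _; rewrite (le_trans (ler_norm _))// normrM.
    by rewrite -[leRHS]mulr1 ler_pM// (le_trans (we i)).
  have vy : edot v y = edot w y + 2^-1 by rewrite vE edotDl edotZl edot_sphere mulr1.
  have vv : edot v v = edot w w + edot w y + 1 / 4.
    rewrite vE !(edotDl, edotDr, edotZl, edotZr) edot_sphere (edotC y w); by field.
  move: wy; rewrite ler_norml => /andP[wy1 wy2].
  have vy0 : 0 < edot v y by rewrite vy; lra.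
  have v0 : v != 0.
    apply: contraTneq vy0 => ->; rewrite /edot big1 ?ltxx// => i _.
    by rewrite mxE mul0r.
  have [z zE _] := breveE v0.
  have nv0 := enorm_gt0 v0.
  have nv2 : enorm v ^+ 2 = edot v v by rewrite sqr_sqrtr// edot_ge0.
  exists (enorm v), z; split.
  - rewrite nv0/= -(@expr_le1 _ 2)// ?ltW// nv2 vv; lra.
  - suff : rho z y < q by move=> h; rewrite /gball/=; apply: lt_le_trans h _; rewrite ge_min lexx.
    rewrite rho_lt// zE edotZl; apply: (@le_lt_trans _ _ c); first by rewrite le_max lexx orbT.
    rewrite mulrC ltr_pdivlMr// -ltr_sqr ?nnegrE ?mulr_ge0 ?(ltW nv0) ?(ltW vy0)//.
    rewrite exprMn nv2 vv vy.
    apply: (@le_lt_trans _ _ (c ^+ 2 * (1 / 4) + 2 * eta)).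
      rewrite mulrDr addrC lerD2l.
      have : c ^+ 2 <= 1 by rewrite expr_le1// ltW.
      have : 0 <= edot w w by exact: edot_ge0.
      have := sqr_ge0 c; nra.
    have : c ^+ 2 = 1 - 13 * eta by rewrite /eta; field.
    move=> ->; nra.
  - by move=> i; rewrite zE !mxE mulrA divff ?mul1r// gt_eqF.
rewrite /Defs.sigma mule_gt0 ?lte_fin ?ltr0n//.
apply: (@lt_le_trans _ _ (lebesgue_tuple R d (tcube ct e))).
  by rewrite lebesgue_tuple_tcube ?(ltW e0)// lte_fin exprn_gt0// mulr_gt0.
apply: le_measure; rewrite ?inE => //.
- exact: measurable_tcube.
- apply: measurable_cone; exact: measurable_gball.
Qed.

Lemma area_gball_gt0 y r : 0 < r -> 0 < area (gball y r).
Proof.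
move=> r0; rewrite /area fine_gt0// sigma_gball_gt0//=.
apply: le_lt_trans sigma_fin; apply: le_measure; rewrite ?inE//.
exact: measurable_gball.
Qed.

End SphereGeometry.

(** * Bounded measurable functions on the sphere *)

Section BoundedMeasurable.
Variables (R : realType) (n : nat).
Local Notation d := n.+2.
Local Notation sphere := (sphere R n).
Local Notation sigma := (@sigma R n).
Implicit Types f g : sphere -> R.

(** As [sigma] is finite, this algebra consists of integrable functions, so integrals of sums and
    products can be split without further integrability checks. *)
Definition bddm f := measurable_fun setT f /\ exists B : R, forall x, `|f x| <= B.

Lemma bddm_integrable f : bddm f -> sigma.-integrable setT (EFin \o f).
Proof.
move=> [mf [B fB]]; apply: measurable_bounded_integrable => //.
  exact: sigma_fin.
exists B; split; first exact: num_real.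
by move=> M BM x _ /=; rewrite (le_trans (fB x))// ltW.
Qed.

Lemma bddm_cst (c : R) : bddm (fun=> c).
Proof. by split => //; exists `|c|. Qed.

Lemma bddmD f g : bddm f -> bddm g -> bddm (fun x => f x + g x).
Proof.
move=> [mf [B fB]] [mg [C gC]]; split; first exact: measurable_funD.
by exists (B + C) => x; rewrite (le_trans (ler_normD _ _))// lerD.
Qed.

Lemma bddmM f g : bddm f -> bddm g -> bddm (fun x => f x * g x).
Proof.
move=> [mf [B fB]] [mg [C gC]]; split; first exact: measurable_funM.
by exists (B * C) => x; rewrite normrM ler_pM.
Qed.

Lemma bddmZ (c : R) f : bddm f -> bddm (fun x => c * f x).
Proof. by move=> hf; apply: bddmM => //; exact: bddm_cst. Qed.

Lemma bddmN f : bddm f -> bddm (fun x => - f x).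
Proof.
move=> /(bddmZ (-1)); congr bddm; apply/funext => x; exact: mulN1r.
Qed.

Lemma bddmB f g : bddm f -> bddm g -> bddm (fun x => f x - g x).
Proof. by move=> hf /bddmN; exact: bddmD. Qed.

Lemma bddm_sum (I : Type) (s : seq I) (F : I -> sphere -> R) :
  (forall i, bddm (F i)) -> bddm (fun x => \sum_(i <- s) F i x).
Proof.
move=> hF; elim: s => [|i s ih].
  by under eq_fun do rewrite big_nil; exact: bddm_cst.
by under eq_fun do rewrite big_cons; exact: bddmD.
Qed.

Lemma bddm_prod (I : Type) (s : seq I) (F : I -> sphere -> R) :
  (forall i, bddm (F i)) -> bddm (fun x => \prod_(i <- s) F i x).
Proof.
move=> hF; elim: s => [|i s ih].
  by under eq_fun do rewrite big_nil; exact: bddm_cst.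
by under eq_fun do rewrite big_cons; exact: bddmM.
Qed.

Lemma bddmX f k : bddm f -> bddm (fun x => f x ^+ k).
Proof.
move=> hf; elim: k => [|k ih]; first by under eq_fun do rewrite expr0; exact: bddm_cst.
by under eq_fun do rewrite exprS; exact: bddmM.
Qed.

Lemma bddm_coord i : bddm (fun x : sphere => (x : 'rV[R]_d) 0 i).
Proof.
split; first exact: measurable_sphere_coord.
by exists 1 => x; exact: sphere_coord_le1.
Qed.

Lemma bddm_norm f : bddm f -> bddm (fun x => `|f x|).
Proof.
move=> [mf [B fB]]; split; first exact: measurableT_comp.
by exists B => x; rewrite normr_id.
Qed.

Lemma bddm_zonal (P : {poly R}) (y : sphere) : bddm (zonal P y).
Proof.
have hd : bddm (fun x : sphere => edot y x).
  apply: bddm_sum => i; apply: bddmZ; exact: bddm_coord.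
elim/poly_ind : P => [|P c ih].
  by rewrite /zonal; under eq_fun do rewrite horner0; exact: bddm_cst.
rewrite /zonal; under eq_fun do rewrite hornerMXaddC.
by apply: bddmD; [exact: bddmM|exact: bddm_cst].
Qed.

Lemma bddm_mpoly_eval (p : mpoly.mpoly d R) : bddm (mpoly_eval p).
Proof.
rewrite /mpoly_eval; under eq_fun do rewrite mpoly.mevalE.
apply: bddm_sum => m; apply: bddmZ; apply: bddm_prod => i.
exact/bddmX/bddm_coord.
Qed.

(** The sigma-algebra of the sphere is generated by the coordinates, so open sets have to be built
    from coordinate conditions: the preimage of a ray is the union of the grid cells of mesh
    [1 / (k + 1)] that it contains, and there are countably many cells. *)
Lemma measurable_sphere_continuous g :
  (forall x : 'rV[R]_d, x != 0 -> {for x, continuous (breve g)}) ->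
  measurable_fun setT g.
Proof.
move=> cg; apply: (measurability _ (RGenOInfty.measurableE R)) => //= _ [_ [c ->] <-].
rewrite setTI.
pose cell (k : nat * {ffun 'I_d -> int}) : set sphere :=
  [set x | forall i, Num.floor (k.1.+1%:R * (x : 'rV[R]_d) 0 i) = k.2 i].
have mcell k : measurable (cell k).
  rewrite (_ : cell k = \big[setI/setT]_(i < d)
    ((fun x : sphere => k.1.+1%:R * (x : 'rV[R]_d) 0 i) @^-1` `[(k.2 i)%:~R, (k.2 i + 1)%:~R[%classic)).
    apply: bigsetI_measurable => i _; rewrite -[X in measurable X]setTI.
    apply: measurable_funM => //; first exact: measurable_sphere_coord.
  apply/seteqP; split=> x /=; rewrite -bigcap_seq => h i.
    by move=> _; rewrite /= in_itv/= -(h i) floor_itv.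
  by have := h i (mem_index_enum i); rewrite /= in_itv/=; exact: floor_def.
have -> : g @^-1` `]c, +oo[%classic = \bigcup_k
    (if `[< cell k `<=` g @^-1` `]c, +oo[%classic >] then cell k else set0).
  apply/seteqP; split => x; last first.
    by move=> [k _]; case: ifPn => // /asboolP; exact.
  rewrite /= in_itv/= andbT => gx.
  have : nbhs (x : 'rV[R]_d) [set y | c < breve g y].
    have gc : breve g @ (x : 'rV[R]_d) --> breve g x := cg _ (sphere_neq0 x).
    have : nbhs (breve g x) [set y | c < y].
      by apply: open_nbhs_nbhs; split; [exact: open_gt|rewrite /= breve_sphere].
    exact: gc.
  move=> /nbhs_ballP[e /= e0 he].
  have [m hm] : exists m : nat, m.+1%:R^-1 < e.
    exists (Num.bound e^-1); rewrite invf_plt ?posrE//.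
    apply: (@lt_trans _ _ (Num.bound e^-1)%:R); last by rewrite ltr_nat.
    by apply: archi_boundP; rewrite invr_ge0 ltW.
  exists (m, [ffun i => Num.floor (m.+1%:R * (x : 'rV[R]_d) 0 i)]) => //.
  rewrite ifT; first by move=> i; rewrite ffunE.
  apply/asboolP => y hy; rewrite /= in_itv/= andbT -(breve_sphere g y).
  apply: he; split=> // i j; rewrite ord1 /ball /=.
  have m0 : 0 < m.+1%:R :> R by rewrite ltr0n.
  apply: lt_trans hm; rewrite -(ltr_pM2l m0) mulfV ?gt_eqF//.
  rewrite -[X in X * _](gtr0_norm m0) -normrM mulrBr.
  have := hy j; rewrite ffunE => hj.
  have := floor_itv (m.+1%:R * (x : 'rV[R]_d) 0 j).
  have := floor_itv (m.+1%:R * (y : 'rV[R]_d) 0 j).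
  rewrite hj intrD ltr_norml; move: (_%:~R) => w /andP[? ?] /andP[? ?]; apply/andP; split; lra.
apply: countable_bigcupT_measurable; last by move=> k; case: ifP.
exact: countableP.
Qed.

Lemma sphere_set_compact : compact [set x : 'rV[R]_d | edot x x = 1].
Proof.
have c1 : compact [set v : 'rV[R]_d | forall i, `[(-1 : R), 1]%classic (v ord0 i)].
  by apply: (@rV_compact _ _ (fun=> `[(-1 : R), 1]%classic)) => i; exact: segment_compact.
have c2 : closed [set x : 'rV[R]_d | edot x x = 1].
  rewrite (_ : [set x : 'rV[R]_d | edot x x = 1] =
    (fun x : 'rV[R]_d => edot x x) @^-1` [set 1]); last by [].
  apply: closed_comp; last exact: closed_eq.
  move=> x _; apply: differentiable_continuous.
  rewrite (_ : (fun y : 'rV[R]_d => edot y y) =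
    \sum_(i < d) ((fun y : 'rV[R]_d => y 0 i) * (fun y : 'rV[R]_d => y 0 i))).
    apply: differentiable_sum => i.
    by apply: differentiableM; exact: differentiable_coord.
  by apply/funext => y; rewrite fct_sumE.
have := compact_closedI c1 c2; congr compact; apply/seteqP; split => x /=; first by case.
move=> x1; split => // i.
have h : edot x x == 1 by apply/eqP.
have := sphere_coord_le1 (Sphere h) i; rewrite ler_norml /= in_itv/=.
by [].
Qed.

Lemma bddm_continuous g :
  (forall x : 'rV[R]_d, x != 0 -> {for x, continuous (breve g)}) -> bddm g.
Proof.
move=> cg; split; first exact: measurable_sphere_continuous.
have ne : [set x : 'rV[R]_d | edot x x = 1] !=set0.
  by exists (sphere_e1 R n); exact: edot_sphere.
have wc : {within [set x : 'rV[R]_d | edot x x = 1], continuous (fun x => `|breve g x|)}.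
  apply: continuous_in_subspaceT => x; rewrite inE /= => x1.
  apply: (@continuous_comp _ _ _ (breve g) (fun y => `|y|)); last exact: norm_continuous.
  apply: cg; apply/eqP => x0; move: x1; rewrite x0 /edot big1 => [/eqP|i _].
    by rewrite eq_sym oner_eq0.
  by rewrite mxE mul0r.
have [c _ hc] := EVT_max_rV ne sphere_set_compact wc.
exists `|breve g c| => x; rewrite -(breve_sphere g x); apply: hc.
by rewrite inE /= edot_sphere.
Qed.

Lemma bddm_Re_testfun (u : testfun R n) : bddm (fun x => complex.Re (u x)).
Proof.
have /asboolP[su _] := valP u; apply: bddm_continuous => x x0.
by have [] := su [::] x x0.
Qed.

Lemma bddm_Im_testfun (u : testfun R n) : bddm (fun x => complex.Im (u x)).
Proof.
have /asboolP[_ su] := valP u; apply: bddm_continuous => x x0.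
by have [] := su [::] x x0.
Qed.

Lemma bddm_intD f g : bddm f -> bddm g ->
  \int[sigma]_x (f x + g x) = \int[sigma]_x f x + \int[sigma]_x g x.
Proof. by move=> hf hg; rewrite RintegralD//; exact: bddm_integrable. Qed.

Lemma bddm_intB f g : bddm f -> bddm g ->
  \int[sigma]_x (f x - g x) = \int[sigma]_x f x - \int[sigma]_x g x.
Proof. by move=> hf hg; rewrite RintegralB//; exact: bddm_integrable. Qed.

Lemma bddm_intZ (c : R) f : bddm f ->
  \int[sigma]_x (c * f x) = c * \int[sigma]_x f x.
Proof. by move=> hf; rewrite RintegralZl//; exact: bddm_integrable. Qed.

Lemma bddm_int_sum (I : Type) (s : seq I) (F : I -> sphere -> R) :
  (forall i, bddm (F i)) ->
  \int[sigma]_x (\sum_(i <- s) F i x) = \sum_(i <- s) \int[sigma]_x F i x.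
Proof.
move=> hF; elim: s => [|i s ih].
  rewrite big_nil (@eq_Rintegral _ _ _ _ _ (cst 0)) ?Rintegral_cst ?mul0r//.
  by move=> x _; rewrite big_nil.
rewrite big_cons -ih -bddm_intD//; last exact: bddm_sum.
by apply: eq_Rintegral => x _; rewrite big_cons.
Qed.

Lemma bddm_le_int f g : bddm f -> bddm g -> (forall x, f x <= g x) ->
  \int[sigma]_x f x <= \int[sigma]_x g x.
Proof.
by move=> hf hg fg; apply: le_Rintegral => //; exact: bddm_integrable.
Qed.

End BoundedMeasurable.

(** * Bounded functions as distributions in Besov spaces *)

Section Distributions.
Variables (R : realType) (n : nat).
Local Notation d := n.+2.
Local Notation sphere := (sphere R n).
Local Notation sigma := (@sigma R n).
Local Notation nc z := (Normc.normc z : R).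
Implicit Types (f g : sphere -> R) (u v : testfun R n) (P : {poly R}).

Lemma dist_ofE g u : dist_of g u =
  (\int[sigma]_x (g x * complex.Re (u x))) +i* (\int[sigma]_x (g x * complex.Im (u x))).
Proof.
rewrite /dist_of /cintegral; congr (_ +i* _); apply: eq_Rintegral => x _;
  case: (u x) => a b /=; ring.
Qed.

Lemma dist_ofB f g u : bddm f -> bddm g ->
  dist_of (fun x => f x - g x) u = dist_of f u - dist_of g u.
Proof.
move=> hf hg; have hr := bddm_Re_testfun u; have hi := bddm_Im_testfun u.
rewrite !dist_ofE.
have E (w : sphere -> R) : bddm w -> \int[sigma]_x ((f x - g x) * w x) =
    \int[sigma]_x (f x * w x) - \int[sigma]_x (g x * w x).
  move=> hw; rewrite -bddm_intB; [|exact: bddmM|exact: bddmM].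
  by apply: eq_Rintegral => x _; rewrite mulrBl.
by rewrite !E.
Qed.

Lemma dist_of_linear g (c : R[i]) u v : bddm g ->
  dist_of g (c *: u + v) = c * dist_of g u + dist_of g v.
Proof.
move=> hg; case: c => a b; rewrite !dist_ofE.
have hur := bddmM hg (bddm_Re_testfun u); have hui := bddmM hg (bddm_Im_testfun u).
have hvr := bddmM hg (bddm_Re_testfun v); have hvi := bddmM hg (bddm_Im_testfun v).
transitivity ((a * (\int[sigma]_x (g x * complex.Re (u x))) -
    b * (\int[sigma]_x (g x * complex.Im (u x))) + \int[sigma]_x (g x * complex.Re (v x))) +i*
  (a * (\int[sigma]_x (g x * complex.Im (u x))) +
    b * (\int[sigma]_x (g x * complex.Re (u x))) + \int[sigma]_x (g x * complex.Im (v x)))); last by [].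
congr (_ +i* _).
  rewrite -!bddm_intZ// -bddm_intB; [|exact: bddmZ|exact: bddmZ].
  rewrite -bddm_intD//; last by apply: bddmB; exact: bddmZ.
  apply: eq_Rintegral => x _ /=; rewrite !fctE.
  by case: (u x) => ? ?; case: (v x) => ? ? /=; ring.
rewrite -!bddm_intZ// -bddm_intD; [|exact: bddmZ|exact: bddmZ].
rewrite -bddm_intD//; last by apply: bddmD; exact: bddmZ.
apply: eq_Rintegral => x _ /=; rewrite ?fctE.
case: (u x) => ? ?; case: (v x) => ? ? /=. by ring.
Qed.

Lemma pderiv0 (F : 'rV[R]_d -> R) : pderiv (fun=> 0%N) F = F.
Proof.
rewrite /pderiv (_ : flatten _ = [::])//.
by elim: (enum _).
Qed.

Lemma dist_of_distribution g : bddm g -> is_distribution (dist_of g).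
Proof.
move=> hg; split; first by move=> c u v; exact: dist_of_linear.
(* The distribution has order 0; the factor 2 comes from estimating the real and the imaginary part
   separately. *)
exists (2 * \int[sigma]_x `|g x|), 0%N => u M hM.
have uM x : nc (u x) <= M.
  have h0 : (@mindex_size n (fun=> 0%N) <= 0)%N.
    by rewrite /mindex_size big1.
  have := hM (fun=> 0%N) h0 x; rewrite !pderiv0 !breve_sphere.
  by case: (u x).
have key (w : sphere -> R) : bddm w -> (forall x, `|w x| <= M) ->
    `|\int[sigma]_x (g x * w x)| <= M * \int[sigma]_x `|g x|.
  move=> hw wM; rewrite -bddm_intZ; last exact: bddm_norm.
  apply: le_trans (le_normr_Rintegral _ _) _ => //.
    by apply: bddm_integrable; exact: bddmM.
  apply: bddm_le_int; first by apply: bddm_norm; exact: bddmM.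
    by apply: bddmZ; exact: bddm_norm.
  by move=> x; rewrite normrM mulrC ler_wpM2r.
rewrite dist_ofE (le_trans (normc_le_Re_Im _))//=.
rewrite (_ : 2 * _ * M = M * \int[sigma]_x `|g x| + M * \int[sigma]_x `|g x|); last by ring.
apply: lerD; apply: key.
- exact: bddm_Re_testfun.
- by move=> x; apply: le_trans (uM x); exact: Re_le_normc.
- exact: bddm_Im_testfun.
- by move=> x; apply: le_trans (uM x); exact: Im_le_normc.
Qed.

Lemma conj_zonal_testfun P (y : sphere) :
  conj_testfun (zonal_testfun P y) = zonal_testfun P y.
Proof.
by apply/val_inj/funext => x /=; rewrite oppr0.
Qed.

Lemma pairing_dist_of_zonal g P y :
  pairing (dist_of g) (zonal_testfun P y) = (\int[sigma]_x (g x * zonal P y x))%:C.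
Proof.
rewrite /pairing conj_zonal_testfun dist_ofE /=; congr (_ +i* _).
rewrite (@eq_Rintegral _ _ _ _ _ (cst 0)) ?Rintegral_cst ?mul0r//.
by move=> x _; rewrite mulr0.
Qed.

End Distributions.

Section Bessel.
Variables (R : realType) (n : nat) (Z : nat -> {poly R}).
Hypothesis HZ : zonal_kernels n Z.
Local Notation d := n.+2.
Local Notation sphere := (sphere R n).
Local Notation sigma := (@sigma R n).

(* Bessel's inequality for the projection onto the harmonics of degree [k];
   AM-GM, [2 |G| <= 1 + G^2], then replaces the L^1 norm by the L^2 norm. *)
Lemma zonal_projection_L1 (g : sphere -> R) k : bddm g ->
  let G x := \int[sigma]_y (g y * zonal (Z k) x y) in
  bddm G /\
  \int[sigma]_x `|G x| <= \int[sigma]_x ((1 + g x ^+ 2) / 2).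
Proof.
move=> hg G; have [N [Y [[_ orthY _] ZE]]] := HZ k.
pose c nu := \int[sigma]_y (g y * mpoly_eval (Y nu) y).
have hY nu : bddm (mpoly_eval (Y nu)) by exact: bddm_mpoly_eval.
have hgY nu := bddmM hg (hY nu).
have GE x : G x = \sum_nu c nu * mpoly_eval (Y nu) x.
  rewrite /G (@eq_Rintegral _ _ _ _ _
    (fun y => \sum_nu mpoly_eval (Y nu) x * (g y * mpoly_eval (Y nu) y))); last first.
    by move=> y _; rewrite ZE mulr_sumr; apply: eq_bigr => nu _; ring.
  rewrite bddm_int_sum; last by move=> nu; exact: bddmZ.
  by apply: eq_bigr => nu _; rewrite bddm_intZ// mulrC.
have hG : bddm G.
  by rewrite (funext GE); apply: bddm_sum => nu; exact: bddmZ.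
split => //.
have intG (f : sphere -> R) : bddm f ->
    \int[sigma]_x (f x * G x) = \sum_nu c nu * \int[sigma]_x (f x * mpoly_eval (Y nu) x).
  move=> hf; rewrite (@eq_Rintegral _ _ _ _ _
    (fun x => \sum_nu c nu * (f x * mpoly_eval (Y nu) x))); last first.
    by move=> y _; rewrite GE mulr_sumr; apply: eq_bigr => nu _; ring.
  rewrite bddm_int_sum; last by move=> nu; apply: bddmZ; exact: bddmM.
  by apply: eq_bigr => nu _; rewrite bddm_intZ//; exact: bddmM.
have GG : \int[sigma]_x (G x * G x) = \sum_nu c nu * c nu.
  rewrite intG//; apply: eq_bigr => nu _; congr (_ * _).
  rewrite (@eq_Rintegral _ _ _ _ _ (fun x => mpoly_eval (Y nu) x * G x)); last first.
    by move=> x _; rewrite mulrC.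
  rewrite intG// (bigD1 nu)//= orthY eqxx mulr1 big1 ?addr0// => mu /negbTE munu.
  by rewrite orthY eq_sym munu mulr0.
have gG : \int[sigma]_x (g x * G x) = \sum_nu c nu * c nu by rewrite intG.
have hgg := bddmM hg hg; have hGG := bddmM hG hG; have hgG := bddmM hg hG.
(* [G] is an orthogonal projection of [g], so [g G] and [G G] have the same integral, and expanding
   the integral of [(g - G)^2] gives the inequality. *)
have bessel : \int[sigma]_x (G x * G x) <= \int[sigma]_x (g x * g x).
  have : 0 <= \int[sigma]_x ((g x - G x) * (g x - G x)).
    by apply: Rintegral_ge0 => x _; rewrite -expr2 sqr_ge0.
  rewrite (@eq_Rintegral _ _ _ _ _ (fun x => g x * g x + (G x * G x - 2 * (g x * G x)))); last first.
    by move=> x _; ring.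
  rewrite bddm_intD//; last by apply: bddmB => //; exact: bddmZ.
  rewrite bddm_intB//; last exact: bddmZ.
  rewrite bddm_intZ// GG gG; lra.
have h1 : @bddm R n (fun=> 1) by exact: bddm_cst.
have hg2 : bddm (fun x => g x ^+ 2) by exact: bddmX.
have hG2 : bddm (fun x => G x ^+ 2) by exact: bddmX.
have half (f : sphere -> R) : bddm f -> bddm (fun x => (1 + f x) / 2).
  move=> hf; have := bddmZ 2^-1 (bddmD h1 hf); congr bddm.
  by apply/funext => x; rewrite mulrC.
have halfE (f : sphere -> R) : bddm f ->
    \int[sigma]_x ((1 + f x) / 2) = 2^-1 * (\int[sigma]_x 1 + \int[sigma]_x f x).
  move=> hf; rewrite -bddm_intD// -bddm_intZ; last exact: bddmD.
  by apply: eq_Rintegral => x _; rewrite mulrC.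
apply: (@le_trans _ _ (\int[sigma]_x ((1 + G x ^+ 2) / 2))).
  apply: bddm_le_int; [exact: bddm_norm|exact: half|move=> x].
  have := sqr_ge0 (`|G x| - 1); rewrite sqrrB1 real_normK ?num_real//; lra.
rewrite !halfE// ler_pM2l// lerD2l.
by under eq_Rintegral do rewrite expr2; under [leRHS]eq_Rintegral do rewrite expr2.
Qed.

End Bessel.

Section BesovMembership.
Variables (R : realType) (n : nat) (sys : system R n).
Hypothesis hS : needlet_system sys.
Local Notation d := n.+2.
Local Notation sphere := (sphere R n).
Local Notation sigma := (@sigma R n).
Local Notation nc z := (Normc.normc z : R).
Local Notation Z := (kernelZ sys).

(** Smoothness is given on the open half-line, but the support lies in the compact interval
    [1/2, 2], away from 0. The requirement [1 <= S] lets the same bound cover the coefficient 1 of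
    level 0. *)
Lemma cutoff_bounded : exists2 S : R, 1 <= S & forall u, 0 <= u -> nc (cutoff sys u) <= S.
Proof.
have [_ [sr si supp _] _ _] := hS.
have half0 : (2^-1 : R) <= 2 by lra.
have bnd (f : R -> R) : smooth_pos f ->
    exists B : R, forall u, u \in `[(2^-1 : R), 2] -> `|f u| <= B.
  move=> sf.
  have cf : {within `[(2^-1 : R), 2], continuous (fun u => `|f u|)}.
    apply: continuous_in_subspaceT => u; rewrite inE /= in_itv/= => /andP[u2 _].
    apply: (@continuous_comp _ _ _ f (fun y => `|y|)); last exact: norm_continuous.
    apply: differentiable_continuous; apply/derivable1_diffP.
    by apply: (sf 0%N); apply: lt_le_trans u2; rewrite invr_gt0.
  by have [c _ hc] := EVT_max half0 cf; exists `|f c|.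
have [B hB] := bnd _ sr; have [C hC] := bnd _ si.
exists (1 + `|B| + `|C|); first by rewrite -addrA lerDl addr_ge0.
move=> u u0; have [->|cu] := eqVneq (cutoff sys u) 0.
  by rewrite Normc.normc0 !addr_ge0.
have ui : u \in `[(2^-1 : R), 2] by rewrite in_itv/=; exact: supp.
rewrite (le_trans (normc_le_Re_Im _))//.
have := hB _ ui; have := hC _ ui; have := ler_norm B; have := ler_norm C.
lra.
Qed.

Lemma Phi_conv_L1 (g : sphere -> R) : bddm g -> exists2 B : R, 0 <= B &
  forall j, (\int[sigma]_x (nc (Phi_conv sys j (dist_of g) x))%:E <=
             (B * (2 ^+ j)) %:E)%E.
Proof.
move=> hg; have [hZ _ _ _] := hS; have [S S1 hSc] := cutoff_bounded.
pose G k (x : sphere) := \int[sigma]_y (g y * zonal (Z k) x y).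
pose Q := \int[sigma]_x ((1 + g x ^+ 2) / 2).
have hG k : bddm (G k) by have [] := zonal_projection_L1 hZ k hg.
have GQ k : \int[sigma]_x `|G k x| <= Q by have [] := zonal_projection_L1 hZ k hg.
have Q0 : 0 <= Q by apply: le_trans (GQ 0%N); apply: Rintegral_ge0.
have convE k x : zconv (Z k) (dist_of g) x = (G k x)%:C.
  exact: pairing_dist_of_zonal.
(* [Q] bounds the L^1 norm of one projection, [S] a coefficient, and the factor 2 comes from
   [2 ^ j + 1 <= 2 * 2 ^ j]. *)
exists (2 * S * Q); first by rewrite !mulr_ge0// (le_trans ler01).
(* every level is a sum of at most [2 ^ j + 1] projections with bounded coefficients *)
move=> j.
have [N [c [hN hc hPhi]]] : exists N (c : nat -> R[i]),
    [/\ (N <= (2 ^ j).+1)%N, forall k, nc (c k) <= S &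
    forall x, Phi_conv sys j (dist_of g) x = \sum_(k < N) c k * (G k x)%:C].
  case: j => [|j].
    exists 1%N, (fun=> 1); split => // [k|x]; first by rewrite Normc.normc1.
    by rewrite big_ord_recl big_ord0 addr0 mul1r /= convE.
  exists (2 ^ j.+1).+1, (fun k => cutoff sys (k%:R / 2 ^+ j)); split => // [k|x].
    by apply: hSc; rewrite divr_ge0// exprn_ge0.
  by rewrite /=; apply: eq_bigr => k _; rewrite convE.
have mPhi : measurable_fun setT (fun x => nc (Phi_conv sys j (dist_of g) x)).
  rewrite (_ : (fun x => _) = (fun x => Num.sqrt
     ((\sum_(k < N) complex.Re (c k) * G k x) ^+ 2 +
      (\sum_(k < N) complex.Im (c k) * G k x) ^+ 2))).
    have mG (b : nat -> R) : bddm (fun x => \sum_(k < N) b k * G k x).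
      by apply: bddm_sum => k; exact: bddmZ.
    apply: (@measurableT_comp _ _ _ _ _ _ (@Num.sqrt R)) => //.
      by apply: continuous_measurable_fun; exact: sqrt_continuous.
    by have [] := bddmD (bddmX 2 (mG (fun k => complex.Re (c k))))
                        (bddmX 2 (mG (fun k => complex.Im (c k)))).
  apply/funext => x; rewrite hPhi.
  have -> : \sum_(k < N) c k * (G k x)%:C =
      (\sum_(k < N) complex.Re (c k) * G k x) +i* (\sum_(k < N) complex.Im (c k) * G k x).
    elim: {hN hPhi} N => [|N ih]; first by rewrite !big_ord0.
    by rewrite !big_ord_recr ih /=; case: (c N) => a b; apply/eqP; rewrite eq_complex /=; apply/andP; split; apply/eqP; ring.
  by [].
have hH : bddm (fun x => \sum_(k < N) S * `|G k x|).
  by apply: bddm_sum => k; apply: bddmZ; exact: bddm_norm.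
apply: (@le_trans _ _ (\int[sigma]_x (\sum_(k < N) S * `|G k x|)%:E)%E).
  apply: ge0_le_integral => //.
  - by move=> x _; rewrite lee_fin normc_ge0.
  - exact/measurable_EFinP.
  - by apply/measurable_EFinP; case: hH.
  - move=> x _; rewrite lee_fin hPhi (le_trans (normc_sum _ _ _))//.
    by apply: ler_sum => k _; rewrite Normc.normcM normc_real ler_wpM2r.
have /integrable_fin_num := bddm_integrable hH => /(_ measurableT) /fineK <-.
rewrite lee_fin -/(Rintegral _ _ _) bddm_int_sum; last first.
  by move=> k; apply: bddmZ; exact: bddm_norm.
apply: (@le_trans _ _ (\sum_(k < N) S * Q)).
  apply: ler_sum => k _; rewrite bddm_intZ; last exact: bddm_norm.
  by apply: ler_wpM2l => //; exact: le_trans S1.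
rewrite sumr_const card_ord -[_ *+ N]mulr_natl.
rewrite [leRHS](_ : _ = 2 * 2 ^+ j * (S * Q)); last by ring.
rewrite ler_wpM2r//.
  by rewrite mulr_ge0// (le_trans ler01).
rewrite -natrX -natrM ler_nat (leq_trans hN)// mul2n -addnn -addn1 leq_add2l.
by rewrite expn_gt0.
Qed.

Lemma dist_of_besov (A : R) (g : sphere -> R) : 1 < A -> bddm g ->
  fspace sys Besov (- A) 1 1 (dist_of g).
Proof.
move=> A1 hg; split; first exact: dist_of_distribution.
have [B B0 hB] := Phi_conv_L1 hg.
rewrite /fnorm invr1; apply: poweR_lty.
(* The ratio [2 ^ (1 - A)]: the weight [2 ^ (- A j)] of the norm against the growth [2 ^ j] of the
   L^1 norms. It is below 1 because [1 < A]. *)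
pose z := 2 `^ (- A) * 2.
have z0 : 0 < z by rewrite mulr_gt0// powR_gt0.
have z1 : z < 1.
  rewrite /z powRN mulrC ltr_pdivrMr ?powR_gt0// mul1r.
  have A10 : 0 < A - 1 by rewrite subr_gt0.
  have -> : 2 `^ A = 2 * 2 `^ (A - 1) :> R.
    by rewrite -[X in X * _]powRr1// -powRD ?pnatr_eq0 ?implybT// addrC subrK.
  have E1 : 1 = 1 `^ (A - 1) :> R by rewrite powR1.
  rewrite ltr_pMr// [ltLHS]E1.
  by apply: gt0_ltr_powR; rewrite ?nnegrE// ltr1n.
apply: (@le_lt_trans _ _ (B * (1 - z)^-1)%:E); last exact: ltry.
apply: lime_le.
  by apply: is_cvg_nneseries => j _ _; exact: poweR_ge0.
apply: nearW => N.
apply: (@le_trans _ _ (series (geometric B z) N)%:E).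
  rewrite /series/= -sumEFin; apply: lee_sum => j _.
  rewrite poweRe1; last first.
    by apply: mule_ge0; [rewrite lee_fin powR_ge0|exact: Lnorm_ge0].
  rewrite Lnorm1 /z powRrM powR_mulrn ?powR_ge0// exprMn mulrCA EFinM.
  rewrite lee_wpmul2l ?lee_fin ?exprn_ge0 ?powR_ge0//.
  apply: le_trans (hB j); rewrite le_eqVlt; apply/orP; left; apply/eqP.
  by apply: eq_integral => x _; rewrite gee0_abs// lee_fin normc_ge0.
by rewrite lee_fin; apply: geometric_le_lim => //; rewrite gtr0_norm.
Qed.

End BesovMembership.

(** * Measurability and boundedness of the functions of Theta *)

Section ThetaBounded.
Variables (R : realType) (n : nat).
Local Notation d := n.+2.
Local Notation V := 'rV[R]_d.
Local Notation sphere := (sphere R n).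
Implicit Types (f g : V -> R).

(* Measurability of functions on R^d, tested along measurable maps from the
   sphere, since ['rV_d] carries no sigma-algebra here. *)
Definition smeas f := forall h : sphere -> V,
  (forall i, measurable_fun setT (fun x => h x 0 i)) ->
  measurable_fun setT (fun x => f (h x)).

Lemma smeasD f g : smeas f -> smeas g -> smeas (fun x => f x + g x).
Proof. by move=> hf hg h mh; apply: measurable_funD; [exact: hf|exact: hg]. Qed.

Lemma smeasZ (c : R) f : smeas f -> smeas (fun x => c * f x).
Proof. by move=> hf h mh; apply: measurable_funM => //; exact: hf. Qed.

Lemma smeas_sum (I : Type) (s : seq I) (P : pred I) (F : I -> V -> R) :
  (forall i, smeas (F i)) -> smeas (fun x => \sum_(i <- s | P i) F i x).
Proof.
move=> hF h mh; under eq_fun do rewrite big_mkcond.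
apply: measurable_sum => i; case: (P i) => //.
exact: hF.
Qed.

Lemma smeas_translate (c : V) f : smeas f -> smeas (fun x => f (x + c)).
Proof.
move=> hf h mh; apply: (hf (fun x => h x + c)) => i.
under eq_fun do rewrite mxE.
exact: measurable_funD.
Qed.

Lemma smeas_newtonian : smeas (@newtonian R n).
Proof.
move=> h mh.
have me : measurable_fun setT (fun x => enorm (h x)).
  apply: (@measurableT_comp _ _ _ _ _ _ (@Num.sqrt R)) => //.
    by apply: continuous_measurable_fun; exact: sqrt_continuous.
  by apply: measurable_sum => i; exact: measurable_funM.
(* Inversion is rewritten as the power -1, which is measurable on the whole line. Both take the
   value 0 at 0, so a pole requires no case distinction. *)
have mV (k : sphere -> R) : (forall x, 0 <= k x) -> measurable_fun setT k ->
    measurable_fun setT (fun x => (k x)^-1).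
  move=> k0 mk.
  rewrite (_ : (fun x => (k x)^-1) = (fun x => k x `^ (- 1))).
    exact: (@measurableT_comp _ _ _ _ _ _ (@powR R ^~ (- 1))).
  by apply/funext => x; rewrite powR_inv1.
have e0 x : 0 <= enorm (h x) by rewrite /enorm sqrtr_ge0.
rewrite /newtonian; case: (n.+2 == 2).
  apply: (@measurableT_comp _ _ _ _ _ _ (@ln R)); first exact: measurable_ln.
  exact: mV.
apply: mV => [x|]; first exact: exprn_ge0.
exact: measurable_funX.
Qed.

Lemma smeas_findiff l t (zeta : V) f : smeas f -> smeas (findiff l t zeta f).
Proof.
move=> hf; rewrite /findiff; apply: smeasZ; apply: smeas_sum => k.
by apply: smeasZ; exact: smeas_translate.
Qed.

Lemma smeas_rotation i l t f : smeas f -> smeas (fun x => f (rotation i l t x)).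
Proof.
move=> hf h mh; apply: (hf (fun x => rotation i l t (h x))) => j.
under eq_fun do rewrite mxE.
have [_|_] := boolP (j == i).
  by apply: measurable_funD; apply: measurable_funM.
have [_|_] := boolP (j == l); last exact: mh.
apply: measurable_funD; apply: measurable_funM => //.
exact: measurableT_comp.
Qed.

Lemma smeas_rotdiff t f : smeas f -> smeas (rotdiff t f).
Proof.
move=> hf; rewrite /rotdiff; apply: smeasZ; apply: smeas_sum => i; apply: smeas_sum => l.
apply: (@smeasD (fun x => f (rotation i l (- t) x) + f (rotation i l t x))
  (fun x => - (2 * f x))).
  by apply: smeasD; exact: smeas_rotation.
have := smeasZ (-1) (smeasZ 2 hf); congr smeas.
by apply/funext => x; ring.
Qed.

Lemma smeas_iter_rotdiff k t f : smeas f -> smeas (iter k (rotdiff t) f).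
Proof. by move=> hf; elim: k => [//|k ih]; exact: smeas_rotdiff. Qed.

Variable sys : system R n.

Lemma smeas_theta_dia K M b eps r t (Y : {fset sphere}) P N xi :
  smeas (theta_dia sys K M b eps r t Y P N xi).
Proof.
rewrite /theta_dia; apply: smeasZ; apply: smeas_sum => zeta; apply: smeasZ.
apply: smeas_sum => l; apply: smeasZ; apply: smeas_iter_rotdiff; apply: smeas_findiff.
apply: (@smeas_translate (- ((1 + eps) *: (zeta : V))) (@newtonian R n)).
exact: smeas_newtonian.
Qed.

Lemma freq_gt0 (xi : {j : nat & node sys j}) : 0 < freq xi.
Proof. by rewrite divr_gt0// exprn_gt0. Qed.

Lemma bddm_psi xi : bddm (psi sys xi).
Proof. exact: bddm_zonal. Qed.

(** Measurability is read off the explicit formula. Boundedness comes from the approximation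
    estimate for the multi-index 0, which keeps [thd] within a fixed distance of the zonal
    polynomial [psi_dia xi]. *)
Lemma Theta_bddm K M b (gamma0 : R) (theta : {j : nat & node sys j} -> sphere -> R) xi :
  0 < gamma0 -> Theta K M b gamma0 theta -> bddm (theta xi).
Proof.
move=> gamma0_gt0 [g1 [g2 [g3 [t [Y [P [_ _ _ hder hth]]]]]]].
rewrite hth; case: ifPn => [_|xi0]; first exact: bddm_psi.
have [] := hder xi; first by rewrite lt0n.
set thd := fun x : sphere => _; move=> hd _.
have mthd : measurable_fun setT thd.
  have mt := @smeas_theta_dia K M b (g1 / freq xi) (g3 * freq xi)^-1 (t (tag xi))
    (Y (tag xi)) (P (tag xi)) (2 ^ (tag xi).-1) (pt xi).
  apply: (mt (fun x : sphere => (x : V))) => i.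
  exact: measurable_sphere_coord.
have [_ [B hB]] := bddm_zonal (Psi sys (tag xi)) (pt xi).
suff : bddm thd by exact: bddmZ.
split => //; exists (B + gamma0 * freq xi ^+ (@mindex_size n (fun=> 0%N) + d - 1)) => x.
have h0 : (@mindex_size n (fun=> 0%N) <= K)%N by rewrite /mindex_size big1.
have f0 : 0 < freq xi by exact: freq_gt0.
have := hd (fun=> 0%N) h0 x; rewrite pderiv0 !breve_sphere => hx.
rewrite -[thd x](subKr (psi_dia xi x)) (le_trans (ler_normB _ _))//; apply: lerD; first exact: hB.
apply: (le_trans hx); rewrite ler_piMr ?mulr_ge0 ?exprn_ge0 ?(ltW f0) ?(ltW gamma0_gt0)//.
have r1 : 1 <= 1 + freq xi * rho (pt xi) x.
  by rewrite lerDl mulr_ge0 ?(ltW f0)// acos_ge0// edot_itv.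
by rewrite invf_le1 ?exprn_ege1// exprn_gt0// (lt_le_trans ltr01).
Qed.

End ThetaBounded.

(** * Sequence norms as mixed norms *)

Section SequenceNorm.
Variables (R : realType) (n : nat) (sys : system R n).
Hypothesis hS : needlet_system sys.
Local Notation sphere := (sphere R n).
Local Notation sigma := (@sigma R n).
Local Notation nc z := (Normc.normc z : R).
Local Notation idx := {j : nat & node sys j}.

Definition low_levels J : {fset idx} := fset_set [set xi | (tag xi < J)%N].

Lemma finite_low_levels J : finite_set [set xi : idx | (tag xi < J)%N].
Proof.
rewrite (_ : [set xi : idx | _] =
    \bigcup_(j in `I_J) (fun x : node sys j => Tagged (fun j => node sys j) x : idx) @` setT).
  apply: bigcup_finite; first exact: finite_II.
  by move=> j _; apply: finite_image; exact: finite_finset.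
apply/seteqP; split => [[j x] /= jJ|_ [j /= jJ [x _ <-]]] //=.
by exists j => //; exists x.
Qed.

Lemma in_low_levels J (xi : idx) : (xi \in low_levels J) = (tag xi < J)%N.
Proof.
rewrite in_fset_set; last exact: finite_low_levels.
by apply/idP/idP => [/set_mem|?]; [|exact/mem_set].
Qed.

Lemma low_levels_incr i j : (i <= j)%N -> (low_levels i `<=` low_levels j)%fset.
Proof.
by move=> ij; apply/fsubsetP => xi; rewrite !in_low_levels => /leq_trans; exact.
Qed.

Lemma low_levels_exhaust xi : exists J, xi \in low_levels J.
Proof. by exists (tag xi).+1; rewrite in_low_levels. Qed.

Lemma esum_level j (f : idx -> \bar R) : (forall xi, 0 <= f xi)%E ->
  (forall xi, tag xi != j -> f xi = 0%E) ->
  (\esum_(xi in [set: idx]) f xi =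
   \sum_(x : node sys j) f (Tagged (fun j => node sys j) x))%E.
Proof.
move=> f0 fj; rewrite (esumID [set xi | tag xi = j])// [X in (_ + X)%E]esum1 ?adde0; last first.
  by move=> xi [_ /eqP/fj].
rewrite setTI (reindex_esum [set: node sys j] _
  (fun x : node sys j => Tagged (fun j => node sys j) x : idx)); last first.
  split => [x _//|x y _ _ /eqP|[i x] /= ij].
    by rewrite -tag_eqE /tag_eq/= eqxx tagged_asE => /eqP.
  by subst i; exists x.
rewrite esum_fset//; last exact: finite_finset.
rewrite fsbig_finite/=; last exact: finite_finset.
apply: perm_big; apply: uniq_perm; first exact: fset_uniq.
  exact: index_enum_uniq.
move=> x; rewrite mem_index_enum in_fset_set; last exact: finite_finset.
exact: mem_set.
Qed.

Lemma net_radius_gt0 j : 0 < netconst sys * (2 / 2 ^+ j).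
Proof.
have [_ _ _ [/andP[g0 _] _ _ _ _]] := hS.
by rewrite mulr_gt0// divr_gt0// exprn_gt0.
Qed.

(** In the Besov scale the measure space is the set of levels with counting measure, the kernel is
    [w j] at the level [j] of the index and 0 elsewhere, and [(al, be) = (p, q)]. In the other scale
    it is the sphere, the kernel is a multiple of the indicator of the ball of the index, and
    [(al, be) = (q, p)]. The existential form lets later arguments treat both scales at once. *)
Lemma snorm_mixed X s p q : 0 < p -> 0 < q ->
  exists (disp : measure_display) (T : measurableType disp)
    (mu : {measure set T -> \bar R}) (k : idx -> T -> R) (al be : R),
  [/\ 0 < al, 0 < be, forall xi x, 0 <= k xi x & forall xi, measurable_fun setT (k xi)] /\
  [/\ forall h, snorm sys X s p q h = mixed_norm mu k al be (fun xi => nc (h xi)),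
    forall xi, exists B, exists2 c : R, 0 < c &
      [/\ measurable B, (0 < mu B)%E & forall x, B x -> c <= k xi x]
    & forall xi, (\int[mu]_x ((k xi x) `^ be)%:E < +oo)%E].
Proof.
move=> p0 q0; case: X.
  pose w (j : nat) : R := 2 `^ (j%:R * (s + n.+1%:R * (2^-1 - p^-1))).
  have w0 j : 0 < w j by rewrite powR_gt0.
  exists _, nat, counting, (fun xi j => w j * (tag xi == j)%:R), p, q; split.
    by split => // xi j; rewrite mulr_ge0// ltW.
  split.
  - move=> h; rewrite /mixed_norm /mixed_int ge0_integral_count; last first.
      by move=> j; exact: poweR_ge0.
    rewrite /snorm; congr (_ `^ _)%E; apply: eq_eseriesr => j _.
    rewrite /mixed_inner (@esum_level j); last 2 first.
    + by move=> xi; rewrite lee_fin powR_ge0.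
    + by move=> xi /negbTE ->; rewrite mulr0 mul0r powR0// gt_eqF.
    rewrite sumEFin poweR_EFin -/(w j); congr (_%:E).
    under [in RHS]eq_bigr do rewrite /= eqxx mulr1 powRM ?(ltW (w0 j)) ?normc_ge0//.
    rewrite -mulr_sumr.
    set S := \sum_(_ : _) _; have S0 : 0 <= S by apply: sumr_ge0 => x _; exact: powR_ge0.
    rewrite powRM ?powR_ge0// [RHS]powRM ?powR_ge0// -!powRrM.
    by rewrite [p * _]mulrC divfK ?gt_eqF// [p^-1 * q]mulrC.
  - move=> xi; exists [set tag xi], (w (tag xi)) => //; split => //.
      by rewrite /= /counting asboolT ?fset_set1 ?cardfs1// lte_fin.
    by move=> j ->; rewrite eqxx mulr1.
  - move=> xi; rewrite ge0_integral_count; last by move=> j; rewrite lee_fin powR_ge0.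
    rewrite nneseries_esumT; last by move=> j; rewrite lee_fin powR_ge0.
    rewrite (esumID [set tag xi]); last by move=> j _; rewrite lee_fin powR_ge0.
    rewrite setTI esum_set1 ?lee_fin ?powR_ge0// esum1 ?adde0 ?ltry//.
    move=> j [_ /= /eqP]; rewrite eq_sym => /negbTE ->.
    by rewrite mulr0 powR0// gt_eqF.
pose r (xi : idx) := netconst sys * (2 / 2 ^+ tag xi).
pose c (xi : idx) := area (gball (pt xi) (r xi)) `^ (- s / n.+1%:R - 2^-1).
have c0 xi : 0 < c xi by rewrite powR_gt0// area_gball_gt0// net_radius_gt0.
have mB xi : measurable (gball (pt xi) (r xi)) by exact: measurable_gball.
exists _, sphere, sigma, (fun xi x => c xi * \1_(gball (pt xi) (r xi)) x), q, p; split.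
  split => // [xi x|xi]; first by rewrite mulr_ge0// ltW.
  by apply: measurable_funM => //; exact: measurable_indic.
split.
- move=> h; rewrite /snorm unlock; congr (_ `^ _)%E; apply: eq_integral => x _.
  rewrite gee0_abs ?poweR_ge0// -poweRrM [q^-1 * p]mulrC; congr (_ `^ _)%E.
  by apply: eq_esum => xi _; rewrite -/(r xi) -/(c xi) mulrAC.
- move=> xi; exists (gball (pt xi) (r xi)), (c xi) => //; split => //.
    by apply: sigma_gball_gt0; exact: net_radius_gt0.
  by move=> x Bx; rewrite indicE mem_set// mulr1.
- move=> xi; apply: (@le_lt_trans _ _ (\int[sigma]_x ((c xi `^ p)%:E))%E); last first.
    by rewrite integral_cst// lte_mul_pinfty ?lee_fin ?powR_ge0//; exact: sigma_fin.
  apply: ge0_le_integral => //.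
  + by move=> x _; rewrite lee_fin powR_ge0.
  + apply/measurable_EFinP; apply: (@measurableT_comp _ _ _ _ _ _ (@powR R ^~ p)) => //.
    by apply: measurable_funM => //; exact: measurable_indic.
  + move=> x _; rewrite lee_fin; apply: ge0_ler_powR; rewrite ?nnegrE ?(ltW p0)//.
    * by rewrite mulr_ge0// ltW.
    * exact: ltW.
    * by rewrite ler_piMr ?(ltW (c0 xi))// indicE lern1 leq_b1.
Qed.

End SequenceNorm.

Section SequenceNormProperties.
Variables (R : realType) (n : nat) (sys : system R n).
Hypothesis hS : needlet_system sys.
Local Notation nc z := (Normc.normc z : R).
Local Notation idx := {j : nat & node sys j}.
Variables (X : scale) (s p q : R).
Hypotheses (p0 : 0 < p) (q0 : 0 < q).
Local Notation N := (snorm sys X s p q).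
Implicit Types h : idx -> R[i].

Let incr := @low_levels_incr R n sys.
Let exhaust := @low_levels_exhaust R n sys.

Lemma snorm_ge0 h : (0 <= N h)%E.
Proof.
have [? [T [mu [k [al [be [_ [-> _ _]]]]]]]] := snorm_mixed hS X s p0 q0.
exact: mixed_norm_ge0.
Qed.

Lemma le_snormZ (c : R) h h' : 0 < c -> (forall xi, nc (h xi) <= c * nc (h' xi)) ->
  (N h <= c%:E * N h')%E.
Proof.
have [? [T [mu [k [al [be [[al0 be0 k0 mk] [NE _ _]]]]]]]] := snorm_mixed hS X s p0 q0.
move=> c0 hh'; rewrite !NE.
have h0 xi : 0 <= nc (h' xi) by exact: normc_ge0.
apply: le_trans _ (mixed_normZ_le mu incr exhaust k0 mk al0 be0 c0 h0).
by apply: (le_mixed_norm mu incr exhaust) => // xi; rewrite normc_ge0 hh'.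
Qed.

Lemma le_snorm h h' : (forall xi, nc (h xi) <= nc (h' xi)) -> (N h <= N h')%E.
Proof.
by move=> hh'; have := @le_snormZ 1 h h' ltr01; rewrite mul1e; apply=> xi; rewrite mul1r.
Qed.

Lemma snorm_sup (u : nat -> idx -> R[i]) h (C : R) : 0 <= C ->
  (forall xi m l, (m <= l)%N -> nc (u m xi) <= nc (u l xi)) ->
  (forall xi y, y < nc (h xi) -> exists m, y < nc (u m xi)) ->
  (forall m, (N (u m) <= C%:E)%E) -> (N h <= C%:E)%E.
Proof.
have [? [T [mu [k [al [be [[al0 be0 k0 mk] [NE _ _]]]]]]]] := snorm_mixed hS X s p0 q0.
move=> C0 ndu uh uC; rewrite NE.
apply: (mixed_norm_sup (mu := mu) incr exhaust k0 mk al0 be0 C0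
  (u := fun m xi => nc (u m xi))) => //.
- by move=> m xi; exact: normc_ge0.
- by move=> xi; exact: normc_ge0.
- by move=> m; rewrite -NE.
Qed.

Lemma snorm_tail h (e : R) : (N h < +oo)%E -> 0 < e ->
  exists E0 : {fset idx}, forall E : {fset idx}, (E0 `<=` E)%fset ->
    (N (fun xi => if xi \in E then 0 else h xi)%R < e%:E)%E.
Proof.
have [? [T [mu [k [al [be [[al0 be0 k0 mk] [NE _ _]]]]]]]] := snorm_mixed hS X s p0 q0.
rewrite NE => hfin e0.
have h0 xi : 0 <= nc (h xi) by exact: normc_ge0.
have [J hJ] := mixed_norm_tail (mu := mu) incr exhaust k0 mk al0 be0 h0 hfin e0.
exists (low_levels sys J) => E hE; rewrite NE.
rewrite (_ : (fun xi => _) = (fun xi => if xi \in E then 0 else nc (h xi))).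
  exact: hJ hE.
by apply/funext => xi; case: ifP => _ //; rewrite Normc.normc0.
Qed.

Lemma snorm_coord xi : exists2 D : R, 0 < D & forall h, ((nc (h xi))%:E <= D%:E * N h)%E.
Proof.
have [? [T [mu [k [al [be [[al0 be0 k0 mk] [NE cP _]]]]]]]] := snorm_mixed hS X s p0 q0.
have [B [c c0 [mB muB ck]]] := cP xi.
have [D D0 hD] := mixed_norm_coord (mu := mu) incr exhaust k0 mk al0 be0 mB muB c0 ck.
by exists D => // h; rewrite NE; apply: hD => j; exact: normc_ge0.
Qed.

Lemma snorm_delta xi : (N (fun eta => (eta == xi)%:R)%R < +oo)%E.
Proof.
have [? [T [mu [k [al [be [[al0 be0 k0 mk] [NE _ dP]]]]]]]] := snorm_mixed hS X s p0 q0.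
have hd := mixed_norm_delta (mu := mu) incr exhaust mk al0 be0 (dP xi).
rewrite NE (_ : (fun eta => _) = (fun eta => (eta == xi)%:R)); first exact: hd.
by apply/funext => eta; case: (eta == xi); rewrite ?Normc.normc0 ?Normc.normc1.
Qed.

End SequenceNormProperties.

(** * Perturbation of a frame *)

Section SynthesisLinear.
Variables (R : realType) (n : nat) (I : choiceType) (g : I -> sphere R n -> R).
Implicit Types h k : I -> R[i].

Lemma synthP h u : synth_cvg g h -> csum_to (fun i => h i * dist_of (g i) u) (synth g h u).
Proof. by move=> /(_ u)/csumP. Qed.

Lemma synth_eq h (F : testfun R n -> R[i]) :
  (forall u, csum_to (fun i => h i * dist_of (g i) u) (F u)) ->
  synth_cvg g h /\ synth g h = F.
Proof.
move=> hF; split; first by move=> u; exists (F u).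
by apply/funext => u; exact: csum_eq.
Qed.

Lemma synth_lin (c : R[i]) h k : synth_cvg g h -> synth_cvg g k ->
  synth_cvg g (fun i => c * h i + k i) /\
  synth g (fun i => c * h i + k i) = fun u => c * synth g h u + synth g k u.
Proof.
move=> hh hk; apply: synth_eq => u.
have := csum_to_lin c (synthP u hh) (synthP u hk).
by congr csum_to; apply/funext => i; ring.
Qed.

Lemma synth0 : synth_cvg g (fun=> 0) /\ synth g (fun=> 0) = fun=> 0.
Proof.
apply: synth_eq => u; have := @csum_to0 R I; congr csum_to.
by apply/funext => i; rewrite mul0r.
Qed.

Lemma synth_fset h (E : {fset I}) :
  synth_cvg g (fun i => if i \in E then h i else 0) /\
  synth g (fun i => if i \in E then h i else 0) =
    fun u => \sum_(i <- E) h i * dist_of (g i) u.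
Proof.
apply: synth_eq => u; have := csum_to_fset (fun i => h i * dist_of (g i) u) E.
by congr csum_to; apply/funext => i; case: ifP => // _; rewrite mul0r.
Qed.

End SynthesisLinear.

(** Absorption: [C * e] is at most [x / 2] and moves to the left-hand side. *)
Lemma apriori_estimate (R : realFieldType) (C D x t e : R) : 0 <= C -> 2 * C * D <= 1 ->
  e <= D * x -> x <= C * (t + e) -> 0 <= x -> x <= 2 * C * t.
Proof.
move=> C0 CD ex xt x0.
have : C * e <= C * (D * x) by exact: ler_wpM2l.
have : 2 * C * D * x <= 1 * x by exact: ler_wpM2r.
lra.
Qed.

(** * The perturbed frame operator over an abstract quasi-normed sequence space *)

Section FrameOperator.
Variables (R : realType) (n : nat) (I : choiceType).
Local Notation dist := (testfun R n -> R[i]).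
Local Notation nc z := (Normc.normc z : R).
Variables (psi theta : I -> sphere R n -> R) (test : I -> testfun R n).
Variables (N : (I -> R[i]) -> \bar R) (FS : set dist) (fn : dist -> \bar R).
Local Notation SS h := (N h%R < +oo)%E.
Local Notation Tpsi := (synth psi).
Local Notation Ttheta := (synth theta).
Definition analysis (F : dist) (i : I) : R[i] := pairing F (test i).
Local Notation S := analysis.
Variables (C1 C2 C9 kappa : R) (om dmat : I -> I -> R).
Hypotheses (C1ge1 : 1 <= C1) (C2gt0 : 0 < C2) (C9ge1 : 1 <= C9) (kappa0 : 0 < kappa)
  (contract : 2 * C1 * (C2 * C2 * (kappa * C9)) <= 1).
Hypothesis N0 : forall h, (0 <= N h)%E.
Hypothesis leZ : forall (c : R) h k, 0 < c ->
  (forall i, nc (h i) <= c * nc (k i)) -> (N h <= c%:E * N k)%E.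
Hypothesis N_sup : forall (u : nat -> I -> R[i]) h (C : R), 0 <= C ->
  (forall i m l, (m <= l)%N -> nc (u m i) <= nc (u l i)) ->
  (forall i y, y < nc (h i) -> exists m, y < nc (u m i)) ->
  (forall m, (N (u m) <= C%:E)%E) -> (N h <= C%:E)%E.
Hypothesis N_tail : forall h (e : R), (N h < +oo)%E -> 0 < e ->
  exists E0 : {fset I}, forall E : {fset I}, (E0 `<=` E)%fset ->
    (N (fun i => if i \in E then 0 else h i)%R < e%:E)%E.
Hypothesis N_coord : forall i, exists2 D : R, 0 < D & forall h, ((nc (h i))%:E <= D%:E * N h)%E.
Hypothesis N_delta : forall i, (N (fun j => (j == i)%:R)%R < +oo)%E.
Hypothesis N_zero : SS (fun=> 0).
Hypothesis ND : forall h k, SS h -> SS k -> (N (fun i => h i + k i)%R <= C1%:E * (N h + N k))%E.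
Hypothesis fn_fin : forall F, FS F -> (0 <= fn F < +oo)%E.
Hypothesis S_le : forall F, FS F -> (N (S F) <= C2%:E * fn F)%E.
Hypothesis T_psi_bound : forall h, SS h ->
  [/\ synth_cvg psi h, FS (Tpsi h) & (fn (Tpsi h) <= C2%:E * N h)%E].
Hypothesis rep : forall F, FS F -> Tpsi (S F) = F.
Hypothesis om0 : forall i j, 0 <= om i j.
Hypothesis dmat_le : forall i j, `|dmat i j| <= kappa * om i j.
Hypothesis omega_op : forall h, SS h ->
  (forall i, csummable (fun j => (om i j)%:C * h j)) /\
  (N (fun i => csum (fun j => (om i j)%:C * h j))%R <= C9%:E * N h)%E.
Hypothesis dist_of_residual : forall i u,
  csum_to (fun j => (dmat j i)%:C * dist_of (psi j) u)
    (dist_of (psi i) u - dist_of (theta i) u).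
Implicit Types (h k : I -> R[i]) (F G : dist).

Let C1ge0 : 0 <= C1. Proof. exact: le_trans C1ge1. Qed.

Lemma N_le h k : (forall i, nc (h i) <= nc (k i)) -> (N h <= N k)%E.
Proof. by move=> hk; have := @leZ 1 h k ltr01; rewrite mul1e; apply=> i; rewrite mul1r. Qed.

Lemma N_eq h k : (forall i, nc (h i) = nc (k i)) -> N h = N k.
Proof. by move=> hk; apply/eqP; rewrite eq_le !N_le// => i; rewrite hk. Qed.

Lemma ltey_mul (c : R) (x y : \bar R) : 0 <= c -> (x < +oo)%E -> (y <= c%:E * x)%E -> (y < +oo)%E.
Proof.
move=> c0 xfin /le_lt_trans; apply; move: xfin; case: x => [x| |]//= _.
  by rewrite -EFinM ltry.
rewrite mulrNy; case: sgrP c0 => //=; rewrite ?mul0e ?ltry// => _ _.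
by rewrite mul1e.
Qed.

Lemma sspace_leZ (c : R) h k : 0 < c -> SS k ->
  (forall i, nc (h i) <= c * nc (k i)) -> SS h.
Proof. by move=> c0 sk /(leZ c0); apply: ltey_mul sk; exact: ltW. Qed.

(** The zero sequence is dominated by half of itself, so its finite norm is at most half of its own
    value. *)
Lemma N_zeroE : N (fun=> 0) = 0%E.
Proof.
have h0 : forall m : nat, (N (fun=> 0%R) <= (2^-1 ^+ m)%:E * N (fun=> 0%R))%E.
  by move=> m; apply: leZ => [|i]; rewrite ?exprn_gt0 ?invr_gt0// Normc.normc0 mulr0.
have := h0 1%N; rewrite expr1; move: N_zero (N0 (fun=> 0)).
case: (N _) => [x| |]// _; rewrite -EFinM !lee_fin => x0 hx.
by congr (_%:E); lra.
Qed.

Lemma sspaceD h k : SS h -> SS k -> SS (fun i => h i + k i)%R.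
Proof.
move=> sh sk; apply: ltey_mul C1ge0 _ (ND sh sk).
exact: lte_add_pinfty.
Qed.

Lemma sspaceZ (c : R[i]) h : SS h -> SS (fun i => c * h i)%R.
Proof.
move=> sh; apply: (@sspace_leZ (nc c + 1) _ h) => //.
  by rewrite ltr_wpDl ?normc_ge0.
by move=> i; rewrite Normc.normcM ler_wpM2r ?normc_ge0// lerDl.
Qed.

Lemma sspace_lin (c : R[i]) h k : SS h -> SS k -> SS (fun i => c * h i + k i)%R.
Proof. by move=> /(sspaceZ c) sh /(sspaceD sh). Qed.

Lemma N_opp k : N (fun i => - k i)%R = N k.
Proof. by apply: N_eq => i; rewrite normcN. Qed.

Lemma sspaceB h k : SS h -> SS k -> SS (fun i => h i - k i)%R.
Proof. by move=> sh sk; apply: sspaceD => //; rewrite N_opp. Qed.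

Lemma NB h k : SS h -> SS k -> (N (fun i => h i - k i)%R <= C1%:E * (N h + N k))%E.
Proof. by move=> sh sk; rewrite -(N_opp k); apply: ND => //; rewrite N_opp. Qed.

Lemma S_psi_fin F : FS F -> SS (S F).
Proof.
by move=> fF; apply: ltey_mul (S_le fF); [exact: ltW|case/andP : (fn_fin fF)].
Qed.

Lemma T_psi_lin (c : R[i]) h k : SS h -> SS k ->
  Tpsi (fun xi => c * h xi + k xi) = fun u => c * Tpsi h u + Tpsi k u.
Proof.
move=> /T_psi_bound[ch _ _] /T_psi_bound[ck _ _].
by have [] := synth_lin c ch ck.
Qed.

(** The linear structure of [FS] is inherited from sequences: by the reproducing formula the
    combination is [Tpsi] of the same combination of the coefficient sequences. *)
Lemma fspace_lin (c : R[i]) F G : FS F -> FS G -> FS (fun u => c * F u + G u).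
Proof.
move=> fF fG; have sF := S_psi_fin fF; have sG := S_psi_fin fG.
have [_ + _] := T_psi_bound (sspace_lin c sF sG).
by rewrite T_psi_lin// !rep.
Qed.

(** The matrix is applied to the moduli of [h], so that no cancellation occurs: the resulting [g] is
    a sequence of the space that majorizes every series with matrix dominated by [om], up to a
    factor. *)
Lemma omega_sum h : SS h -> exists g : I -> R[i],
  [/\ SS g, (N g <= C9%:E * N h)%E &
   forall eta, ((nc (g eta))%:E = \esum_(xi in setT) (om eta xi * nc (h xi))%:E)%E].
Proof.
move=> sh; pose ah xi : R[i] := (nc (h xi))%:C.
have nah xi : nc (ah xi) = nc (h xi) by rewrite normc_real ger0_norm// normc_ge0.
have Nah : N ah = N h by apply: N_eq.
have sah : SS ah by rewrite Nah.
have [cg] := omega_op sah; rewrite Nah => le.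
eexists; split; [|exact: le|move=> eta].
  by apply: ltey_mul le => //; exact: le_trans C9ge1.
rewrite -csum_ge0_esum.
- by congr (nc _)%:E; congr csum; apply/funext => xi; rewrite rmorphM.
- by move=> xi; rewrite mulr_ge0 ?om0 ?normc_ge0.
- by have := cg eta; congr csummable; apply/funext => xi; rewrite rmorphM.
Qed.

Definition residual_op h (eta : I) : R[i] :=
  csum (fun xi => (dmat eta xi)%:C * h xi).

Lemma residual_esum_le h eta :
  (\esum_(xi in setT) (nc ((dmat eta xi)%:C * h xi))%:E <=
   kappa%:E * \esum_(xi in setT) (om eta xi * nc (h xi))%:E)%E.
Proof.
apply: esum_le_fset => E; have k0 := ltW kappa0.
apply: (@le_trans _ _ (kappa%:E * \sum_(xi <- E) (om eta xi * nc (h xi))%:E)%E); last first.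
  apply: lee_wpmul2l => //; apply: esum_fset_le => xi.
  by rewrite lee_fin mulr_ge0 ?om0 ?normc_ge0.
rewrite !sumEFin -EFinM lee_fin mulr_sumr; apply: ler_sum => xi _.
rewrite Normc.normcM normc_real mulrA.
by apply: ler_wpM2r; [exact: normc_ge0|exact: dmat_le].
Qed.

Lemma residual_op_bound h : SS h ->
  [/\ forall eta, csum_to (fun xi => (dmat eta xi)%:C * h xi) (residual_op h eta),
    SS (residual_op h) & (N (residual_op h) <= (kappa * C9)%:E * N h)%E].
Proof.
move=> sh; have [g [sg gle gE]] := omega_sum sh.
have cv eta : csum_to (fun xi => (dmat eta xi)%:C * h xi) (residual_op h eta).
  apply/csumP/abs_summable_csummable.
  apply: le_lt_trans (residual_esum_le h eta) _; rewrite -gE.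
  by rewrite -EFinM ltry.
have le eta : nc (residual_op h eta) <= kappa * nc (g eta).
  rewrite -lee_fin EFinM gE; apply: le_trans (residual_esum_le h eta).
  exact: csum_norm_le.
split => //; first exact: sspace_leZ kappa0 sg le.
apply: le_trans (leZ kappa0 le) _; rewrite EFinM -muleA.
by apply: lee_wpmul2l => //; rewrite lee_fin ltW// kappa0.
Qed.

Lemma residual_op_lin (c : R[i]) h k : SS h -> SS k ->
  residual_op (fun xi => c * h xi + k xi) = fun eta => c * residual_op h eta + residual_op k eta.
Proof.
move=> /residual_op_bound[ch _ _] /residual_op_bound[ck _ _].
apply/funext => eta; apply: csum_eq; have := csum_to_lin c (ch eta) (ck eta).
by congr csum_to; apply/funext => xi; ring.
Qed.

(* Expanding each residual [psi xi - theta xi] in needlets and exchanging the two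
   sums turns [T_psi - T_theta] into [T_psi] composed with the residual matrix. *)
Lemma synth_theta h : SS h -> synth_cvg theta h /\
  synth theta h = Tpsi (fun xi => h xi - residual_op h xi).
Proof.
move=> sh; have [cD sD _] := residual_op_bound sh.
have [ch _ _] := T_psi_bound sh; have [cDh _ _] := T_psi_bound sD.
have -> : Tpsi (fun xi => h xi - residual_op h xi) =
    fun u => Tpsi h u - Tpsi (residual_op h) u.
  have := T_psi_lin (-1) sD sh; rewrite (_ : (fun xi => _ + _) = fun xi => h xi - residual_op h xi).
    by move=> ->; apply/funext => u; rewrite mulN1r addrC.
  by apply/funext => xi; rewrite mulN1r addrC.
apply: synth_eq => u.
have [g [sg _ gE]] := omega_sum sh.
have [cg _ _] := T_psi_bound sg.
pose v eta := dist_of (psi eta) u.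
pose w xi eta := h xi * ((dmat eta xi)%:C * v eta).
have hres : csum_to (fun xi => h xi * (v xi - dist_of (theta xi) u))
    (Tpsi (residual_op h) u).
  apply: (csum_fubini (w := w) (t := fun eta => residual_op h eta * v eta)).
  (* Summing over [xi] first bounds the double sum by [kappa] times the sum of the moduli of
     [g eta * v eta]. That sum is finite because [Tpsi g] converges unconditionally at the test
     function [u], hence absolutely. *)
  - rewrite esum_exchange; last by move=> *; rewrite lee_fin normc_ge0.
    have /csummable_abs_summable gv := cg u.
    apply: (@le_lt_trans _ _ (kappa%:E * \esum_(eta in setT) (nc (g eta * v eta))%:E)%E); last first.
      by rewrite lte_mul_pinfty// lee_fin ltW// kappa0.
    apply: esum_le_fset => E.
    apply: (@le_trans _ _ (kappa%:E * \sum_(eta <- E) (nc (g eta * v eta))%:E)%E); last first.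
      apply: lee_wpmul2l; first by rewrite lee_fin ltW// kappa0.
      by apply: esum_fset_le => eta; rewrite lee_fin normc_ge0.
    rewrite sumEFin -EFinM mulr_sumr -sumEFin; apply: lee_sum => eta _.
    apply: esum_le_fset => E'; rewrite sumEFin lee_fin.
    rewrite (eq_bigr (fun xi => nc ((dmat eta xi)%:C * h xi) * nc (v eta))); last first.
      by move=> xi _; rewrite -Normc.normcM; congr Normc.normc; rewrite /w; ring.
    rewrite -mulr_suml Normc.normcM mulrA ler_wpM2r ?normc_ge0//.
    rewrite -lee_fin EFinM gE -sumEFin; apply: le_trans (residual_esum_le h eta).
    by apply: esum_fset_le => xi; rewrite lee_fin normc_ge0.
  - by move=> xi; apply: csum_toZ; exact: dist_of_residual.
  - move=> eta; have := csum_toZ (v eta) (cD eta); rewrite [v eta * _]mulrC.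
    by congr csum_to; apply/funext => xi; rewrite /w; ring.
  - exact: synthP.
have := csum_toB (synthP u ch) hres; congr csum_to.
by apply/funext => xi; rewrite /v; ring.
Qed.

(** With [G] this operator, [T (Tpsi h) = Tpsi (h - G h)]. Inserting [S Tpsi] before the residual
    matrix takes care of sequences [h] that are not coefficient sequences, so the equation can be
    solved in the whole sequence space. *)
Definition neumann_op h : I -> R[i] := residual_op (S (Tpsi h)).
Local Notation G_ := neumann_op.
Let delta := C2 * C2 * (kappa * C9).

Let delta0 : 0 <= delta.
Proof. by rewrite !mulr_ge0 ?(ltW C2gt0) ?(ltW kappa0) ?(le_trans ler01). Qed.

Let C1delta : 2 * C1 * delta <= 1. Proof. exact: contract. Qed.

Let delta_half : delta <= 2^-1.
Proof.
rewrite -(ler_pM2l (ltr0n R 2)) mulfV//; apply: le_trans C1delta.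
by rewrite -mulrA ler_pM2l// ler_peMl.
Qed.

Lemma T_psi_fn F : FS F -> (fn F <= C2%:E * N (S F))%E.
Proof. by move=> fF; have [_ _] := T_psi_bound (S_psi_fin fF); rewrite rep. Qed.

Lemma N_S_T_psi h : SS h ->
  SS (S (Tpsi h)) /\ (N (S (Tpsi h)) <= (C2 * C2)%:E * N h)%E.
Proof.
move=> sh; have [_ fT le] := T_psi_bound sh; split; first exact: S_psi_fin.
apply: le_trans (S_le fT) _; rewrite EFinM -muleA.
by apply: lee_wpmul2l => //; rewrite lee_fin ltW.
Qed.

Lemma neumann_op_bound h : SS h -> SS (G_ h) /\ (N (G_ h) <= delta%:E * N h)%E.
Proof.
move=> sh; have [sP Ple] := N_S_T_psi sh.
have [_ sR Rle] := residual_op_bound sP; split => //.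
apply: le_trans Rle _; rewrite /delta [C2 * C2 * _]mulrC (EFinM (kappa * C9)) -muleA.
apply: lee_wpmul2l => //.
by rewrite lee_fin mulr_ge0 ?(ltW kappa0)// (le_trans ler01).
Qed.

Lemma neumann_op_lin (c : R[i]) h k : SS h -> SS k ->
  G_ (fun i => c * h i + k i) = fun i => c * G_ h i + G_ k i.
Proof.
move=> sh sk; have [sPh _] := N_S_T_psi sh; have [sPk _] := N_S_T_psi sk.
by rewrite /neumann_op T_psi_lin// -residual_op_lin.
Qed.

Lemma neumann_iter_bound m h : SS h -> SS (iter m G_ h) /\
  (N (iter m G_ h) <= (2^-1 ^+ m)%:E * N h)%E.
Proof.
elim: m => [|m ih] sh /=; first by rewrite expr0 mul1e.
have [sm le] := ih sh; have [sG Gle] := neumann_op_bound sm; split => //.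
apply: le_trans Gle _; rewrite exprS (EFinM 2^-1) -muleA.
apply: (@le_trans _ _ ((2^-1)%:E * N (iter m G_ h))%E).
  by apply: lee_wpmul2r; [exact: N0|rewrite lee_fin delta_half].
by apply: lee_wpmul2l; [rewrite lee_fin invr_ge0|].
Qed.

(** Moduli are summed so that the sequences increase with [m], as [N_sup] requires, and dominate the
    partial sums of the Neumann series. *)
Definition neumann_partial m h i : R[i] := (\sum_(l < m) nc (iter l G_ h i))%:C.

Lemma normc_neumann_partial m h i :
  nc (neumann_partial m h i) = \sum_(l < m) nc (iter l G_ h i).
Proof.
by rewrite normc_real ger0_norm// sumr_ge0// => l _; exact: normc_ge0.
Qed.

(** The first term is split off and the induction runs over all [h]. The remaining sum belongs to
    [G h] and has norm at most [2 C1 delta N h <= N h], so one quasi-triangle inequality gives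
    [C1 (N h + N h)] again, whatever [m] is. *)
Lemma neumann_partial_bound m h : SS h -> SS (neumann_partial m h) /\
  (N (neumann_partial m h) <= (2 * C1)%:E * N h)%E.
Proof.
elim: m h => [|m ih] h sh.
  have -> : neumann_partial 0 h = fun=> 0.
    by apply/funext => i; rewrite /neumann_partial big_ord0.
  split; first exact: N_zero.
  by rewrite N_zeroE mule_ge0// lee_fin mulr_ge0.
have -> : neumann_partial m.+1 h = fun i => (nc (h i))%:C + neumann_partial m (G_ h) i.
  apply/funext => i; rewrite /neumann_partial big_ord_recl rmorphD; congr (_ + _).
  by congr (_%:C); apply: eq_bigr => l _; rewrite /= -iterSr.
have [sG Gle] := neumann_op_bound sh; have [sm mle] := ih _ sG.
have Nh : N (fun i => (nc (h i))%:C) = N h.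
  by apply: N_eq => i; rewrite normc_real ger0_norm// normc_ge0.
have sh' : SS (fun i => (nc (h i))%:C) by rewrite Nh.
split; first exact: sspaceD.
apply: le_trans (ND sh' sm) _; rewrite Nh.
have {mle}mle : (N (neumann_partial m (G_ h)) <= N h)%E.
  apply: le_trans mle _.
  apply: (@le_trans _ _ ((2 * C1)%:E * (delta%:E * N h))%E).
    by apply: lee_wpmul2l => //; rewrite lee_fin mulr_ge0.
  rewrite muleA -EFinM -[leRHS]mul1e; apply: lee_wpmul2r => //.
apply: (@le_trans _ _ (C1%:E * (N h + N h))%E).
  by apply: lee_wpmul2l; [rewrite lee_fin|exact: leeD].
by rewrite -mule2n -mule_natl muleA -EFinM mulrC.
Qed.

Lemma neumann_cvg h i : SS h ->
  csum_to (fun l => iter l G_ h i) (csum (fun l => iter l G_ h i)).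
Proof.
move=> sh; apply/csumP/abs_summable_csummable.
rewrite /abs_summable -nneseries_esumT; last by move=> l; rewrite lee_fin normc_ge0.
have [D D0 hD] := N_coord i.
apply: (@le_lt_trans _ _ (D%:E * ((2 * C1)%:E * N h))%E); last first.
  by rewrite muleA -EFinM lte_mul_pinfty// lee_fin !mulr_ge0// ltW.
apply: lime_le.
  by apply: is_cvg_nneseries => l _ _; rewrite lee_fin normc_ge0.
apply: nearW => m; rewrite big_mkord sumEFin -normc_neumann_partial.
apply: le_trans (hD _) _; apply: lee_wpmul2l; first by rewrite lee_fin ltW.
by have [] := neumann_partial_bound m sh.
Qed.

Definition neumann h i : R[i] := csum (fun l => iter l G_ h i).

Lemma N_fin h : SS h -> N h = (fine (N h))%:E.
Proof. by move=> sh; rewrite fineK// ge0_fin_numE. Qed.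

Lemma neumann_bound h : SS h -> SS (neumann h) /\
  (N (neumann h) <= (2 * C1)%:E * N h)%E.
Proof.
move=> sh; suff le : (N (neumann h) <= (2 * C1)%:E * N h)%E.
  by split => //; apply: ltey_mul sh le; rewrite mulr_ge0.
rewrite (N_fin sh) -EFinM; apply: (@N_sup (fun m => neumann_partial m h)).
- by rewrite !mulr_ge0// fine_ge0.
- move=> i m l ml; rewrite !normc_neumann_partial -(subnKC ml) big_split_ord /=.
  by rewrite lerDl sumr_ge0// => j _; exact: normc_ge0.
(* If no partial sum of moduli exceeds [y], neither does their limit, which bounds the modulus of
   the sum. *)
- move=> i y yh; apply: contrapT => hy; move: yh; apply/negP; rewrite -leNgt.
  rewrite -lee_fin; apply: le_trans (csum_norm_le (neumann_cvg i sh)) _.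
  rewrite -nneseries_esumT; last by move=> l; rewrite lee_fin normc_ge0.
  apply: lime_le.
    by apply: is_cvg_nneseries => l _ _; rewrite lee_fin normc_ge0.
  apply: nearW => m; rewrite big_mkord sumEFin -normc_neumann_partial lee_fin leNgt.
  by apply/negP => ym; apply: hy; exists m.
- by move=> m; rewrite EFinM -N_fin//; have [] := neumann_partial_bound m sh.
Qed.

Lemma neumann_shift h : SS h -> neumann h = fun i => h i + neumann (G_ h) i.
Proof.
move=> sh; apply/funext => i; apply: csum_eq.
have [sG _] := neumann_op_bound sh.
apply: (csum_nat_shift (u := fun l => iter l G_ h i)).
have := neumann_cvg i sG; congr csum_to.
by apply/funext => l; rewrite iterSr.
Qed.

(* The defect [h + G (neumann h) - neumann h] is unchanged when [h] is replaced
   by [G h], and it is bounded by a multiple of the norm of [h]. *)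
Lemma neumann_fixpoint h : SS h -> neumann h = fun i => h i + G_ (neumann h) i.
Proof.
move=> sh0.
pose D k i := neumann k i - (k i + G_ (neumann k) i).
have DG k : SS k -> D k = D (G_ k).
  move=> sh; have [sG _] := neumann_op_bound sh; have [sn _] := neumann_bound sG.
  apply/funext => i; rewrite /D.
  have E : neumann k = fun i => 1 * k i + neumann (G_ k) i.
    by rewrite neumann_shift//; apply/funext => j; rewrite mul1r.
  have -> : G_ (neumann k) i = G_ k i + G_ (neumann (G_ k)) i.
    by rewrite E neumann_op_lin//= mul1r.
  by rewrite [neumann k i](congr1 (fun g => g i) E) mul1r; ring.
have Diter m : D h = D (iter m G_ h).
  elim: m => [//|m ->]; have [sm _] := neumann_iter_bound m sh0.
  exact: DG.
(* The outer [C1] comes from the difference defining [D], the inner one from the sum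
   [h + G (neumann h)], and each [2 * C1] from [neumann_bound]. *)
pose C := C1 * (2 * C1 + C1 * (1 + delta * (2 * C1))).
have C0 : 0 <= C.
  have d0 : 0 <= delta * (2 * C1) by apply: mulr_ge0 => //; exact: mulr_ge0.
  by apply: mulr_ge0 => //; apply: addr_ge0; apply: mulr_ge0 => //; exact: addr_ge0.
have Dle h' : SS h' -> (N (D h') <= C%:E * N h')%E.
  move=> sh; have [sn nle] := neumann_bound sh; have [sG Gle] := neumann_op_bound sn.
  have sb : SS (fun i => h' i + G_ (neumann h') i) by exact: sspaceD.
  apply: le_trans (NB sn sb) _; move: (ND sh sG).
  have {}Gle := le_trans Gle (lee_wpmul2l _ nle).
  move: nle Gle; rewrite (N_fin sh) (N_fin sn) (N_fin sG) (N_fin sb).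
  rewrite -!EFinD -!EFinM.
  rewrite !lee_fin => nle /(_ delta0) Gle ble.
  rewrite /C -mulrA ler_wpM2l// mulrDl lerD//; apply: le_trans ble _.
  by rewrite -mulrA ler_wpM2l// mulrDl mul1r lerD2l -mulrA.
have D0 : N (D h) = 0%E.
  apply/eqP; rewrite eq_le N0 andbT; apply/lee_addgt0Pr => e e0; rewrite add0e.
  have h1 : `|2^-1 : R| < 1 by rewrite gtr0_norm ?invf_lt1 ?ltr1n.
  have := cvg_geometric (C * fine (N h)) h1.
  move=> /cvgrPdist_lt/(_ _ e0)[m _ /(_ m (leqnn m))] /=.
  rewrite sub0r normrN => hm; rewrite (Diter m).
  have [sm mle] := neumann_iter_bound m sh0.
  apply: le_trans (Dle _ sm) _.
  apply: le_trans (lee_wpmul2l _ mle) _; first by rewrite lee_fin.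
  rewrite (N_fin sh0) -!EFinM lee_fin ltW//.
  by apply: le_lt_trans hm; rewrite mulrA mulrAC ler_norm.
apply/funext => i; apply/eqP; rewrite -subr_eq0; apply/eqP/Normc.eq0_normc/eqP.
rewrite eq_le normc_ge0 andbT; have [B B0 /(_ (D h))] := N_coord i.
by rewrite D0 mule0 lee_fin.
Qed.

Definition frame_op F : dist := Ttheta (S F).
Local Notation T := frame_op.
Definition frame_op_inv : dist -> dist := 'pinv_(fun=> (fun=> 0)) FS T.
Local Notation Tinv := frame_op_inv.
Definition synth_const := C2 * (C1 * (1 + kappa * C9)).

Lemma synth_const_ge0 : 0 <= synth_const.
Proof.
apply: mulr_ge0; first exact: ltW.
apply: mulr_ge0 => //; apply: addr_ge0 => //; apply: mulr_ge0; first exact: ltW.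
exact: le_trans C9ge1.
Qed.

Lemma T_psiB h k : SS h -> SS k ->
  Tpsi (fun i => h i - k i) = fun u => Tpsi h u - Tpsi k u.
Proof.
move=> sh sk; have := T_psi_lin (-1) sk sh.
rewrite (_ : (fun xi => _ + _) = fun xi => h xi - k xi).
  by move=> ->; apply/funext => u; rewrite mulN1r addrC.
by apply/funext => xi; rewrite mulN1r addrC.
Qed.

Lemma T_theta_bound h : SS h ->
  [/\ synth_cvg theta h, FS (Ttheta h) & (fn (Ttheta h) <= synth_const%:E * N h)%E].
Proof.
move=> sh; have [ch ->] := synth_theta sh.
have [_ sR Rle] := residual_op_bound sh.
have sB := sspaceB sh sR.
have [_ fT le] := T_psi_bound sB; split => //.
apply: le_trans le _; rewrite /synth_const (EFinM C2) -muleA.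
apply: lee_wpmul2l; first by rewrite lee_fin ltW.
apply: le_trans (NB sh sR) _; rewrite (EFinM C1) -muleA.
apply: lee_wpmul2l; first by rewrite lee_fin.
move: Rle; rewrite (N_fin sh) (N_fin sR) -!EFinM -EFinD !lee_fin => Rle.
by rewrite mulrDl mul1r lerD2l.
Qed.

Lemma frame_op_fspace F : FS F -> FS (T F).
Proof. by move=> /S_psi_fin/T_theta_bound[]. Qed.

Lemma frame_opE F : FS F -> T F = fun u => F u - Tpsi (residual_op (S F)) u.
Proof.
move=> fF; have sF := S_psi_fin fF; have [_ sR _] := residual_op_bound sF.
by rewrite /frame_op (synth_theta sF).2 T_psiB// rep.
Qed.

Lemma frame_op_lin (c : R[i]) F G : FS F -> FS G ->
  T (fun u => c * F u + G u) = fun u => c * T F u + T G u.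
Proof.
move=> fF fG; have [cF _ _] := T_theta_bound (S_psi_fin fF).
have [cG _ _] := T_theta_bound (S_psi_fin fG).
by have [_ <-] := synth_lin c cF cG.
Qed.

Lemma fspace0 : FS (fun=> 0).
Proof. by have [_ + _] := T_psi_bound N_zero; rewrite (synth0 psi).2. Qed.

Lemma apriori_seq h k l : SS h -> SS k -> SS l ->
  (N l <= delta%:E * N h)%E -> (N h <= C1%:E * (N k + N l))%E ->
  (N h <= (2 * C1)%:E * N k)%E.
Proof.
move=> sh sk sl; move: C1delta delta0; move: delta => D; move: (N0 h).
rewrite (N_fin sh) (N_fin sk) (N_fin sl) -!EFinD -!EFinM !lee_fin.
move: (fine (N h)) (fine (N k)) (fine (N l)) => x t e x0 CD D0 ex xt.
exact: apriori_estimate C1ge0 CD ex xt x0.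
Qed.

(** [S F] is [S (T F)] plus [S Tpsi] of the residual of [S F]. The second term has norm at most
    [delta N (S F)] and is absorbed. Both the injectivity of [T] and the bound on its inverse rest
    on this. *)
Lemma frame_op_apriori F : FS F -> (N (S F) <= (2 * C1)%:E * N (S (T F)))%E.
Proof.
move=> fF; have sF := S_psi_fin fF; have fT := frame_op_fspace fF; have sT := S_psi_fin fT.
have [_ sR Rle] := residual_op_bound sF.
have [sE Ele] := N_S_T_psi sR.
have E : S F = fun i => S (T F) i + S (Tpsi (residual_op (S F))) i.
  by apply/funext => i; rewrite frame_opE// /analysis /pairing subrK.
apply: (apriori_seq sF sT sE).
  apply: le_trans Ele _; rewrite (EFinM (C2 * C2)) -muleA; apply: lee_wpmul2l Rle.
  by rewrite lee_fin mulr_ge0// ltW.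
by have := ND sT sE; rewrite -E.
Qed.

Lemma frame_op_inj F G : FS F -> FS G -> T F = T G -> F = G.
Proof.
move=> fF fG FG.
have fD : FS (fun u => -1 * G u + F u) by exact: fspace_lin.
have sD := S_psi_fin fD.
have TD : T (fun u => -1 * G u + F u) = fun=> 0.
  by rewrite frame_op_lin// FG; apply/funext => u; rewrite mulN1r addNr.
have := frame_op_apriori fD; rewrite TD.
have -> : S (fun=> 0) = fun=> 0 by [].
rewrite N_zeroE mule0 => le0.
have S0 : S (fun u => -1 * G u + F u) = fun=> 0.
  apply/funext => i; apply: Normc.eq0_normc; apply/eqP; rewrite eq_le normc_ge0 andbT.
  have [B B0 /(_ (S (fun u => -1 * G u + F u))) le1] := N_coord i.
  have B0' : (0 <= B%:E)%E by rewrite lee_fin ltW.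
  by have := le_trans le1 (lee_wpmul2l B0' le0); rewrite mule0 lee_fin.
have := rep fD; rewrite S0 (synth0 psi).2 => /(congr1 (fun H : dist => H)) D0.
apply/funext => u; have := congr1 (fun H : dist => H u) D0.
by move=> /= /esym/eqP; rewrite mulN1r addrC subr_eq0 => /eqP.
Qed.

(** The preimage is [Tpsi] of the Neumann sum of [S F]: by the fixed-point equation [1 - G] maps
    that sum back to [S F], and [Tpsi S] reproduces [F]. *)
Lemma frame_op_surj F : FS F -> exists2 G, FS G & T G = F.
Proof.
move=> fF; have sF := S_psi_fin fF; have [sn _] := neumann_bound sF.
have [_ fG _] := T_psi_bound sn; exists (Tpsi (neumann (S F))) => //.
rewrite frame_opE//; have [sG _] := neumann_op_bound sn.
rewrite -/(neumann_op (neumann (S F))) -T_psiB// -[RHS]rep//; congr (synth psi _).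
by apply/funext => i; rewrite {1}neumann_fixpoint//= addrK.
Qed.

Lemma frame_op_bij : set_bij FS FS T.
Proof.
split.
- by move=> F; exact: frame_op_fspace.
- by move=> F G /set_mem fF /set_mem fG; exact: frame_op_inj.
- by move=> F /frame_op_surj[G fG <-]; exists G.
Qed.

Lemma frame_op_invP F : FS F -> FS (Tinv F) /\ T (Tinv F) = F.
Proof.
have [TF _ Tsurj] := frame_op_bij.
move=> fF; split.
  by apply: (surjpinv_image_sub Tsurj); exists F.
have := @surjpK _ _ (fun=> (fun=> 0)) FS FS T Tsurj; apply; exact: mem_set.
Qed.

Lemma frame_op_inv_lin (c : R[i]) F G : FS F -> FS G ->
  Tinv (fun u => c * F u + G u) = fun u => c * Tinv F u + Tinv G u.
Proof.
move=> fF fG; have [iF TF] := frame_op_invP fF; have [iG TG] := frame_op_invP fG.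
have [iH TH] := frame_op_invP (fspace_lin c fF fG).
apply: frame_op_inj => //; first exact: fspace_lin.
by rewrite TH frame_op_lin// TF TG.
Qed.

Lemma N_S_inv F : FS F -> (N (S (Tinv F)) <= (2 * C1)%:E * N (S F))%E.
Proof.
move=> fF; have [iF TF] := frame_op_invP fF.
by have := frame_op_apriori iF; rewrite TF.
Qed.

Lemma frame_op_inv_bound F : FS F ->
  (fn (Tinv F) <= (C2 * (2 * C1 * C2))%:E * fn F)%E.
Proof.
move=> fF; have [iF TF] := frame_op_invP fF.
apply: le_trans (T_psi_fn iF) _; rewrite (EFinM C2) -muleA.
apply: lee_wpmul2l; first by rewrite lee_fin ltW.
apply: le_trans (N_S_inv fF) _; rewrite (EFinM (2 * C1)) -muleA.
by apply: lee_wpmul2l; [rewrite lee_fin mulr_ge0|exact: S_le].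
Qed.

Lemma frame_op_bound F : FS F -> (fn (T F) <= (synth_const * C2)%:E * fn F)%E.
Proof.
move=> fF; have [_ _ le] := T_theta_bound (S_psi_fin fF).
apply: le_trans le _; rewrite (EFinM synth_const) -muleA.
by apply: lee_wpmul2l; [rewrite lee_fin synth_const_ge0|exact: S_le].
Qed.

(** A frame element is the synthesis of a unit sequence, whose norm is finite. *)
Lemma dist_of_psi_fspace i : FS (dist_of (psi i)).
Proof.
have [_ + _] := T_psi_bound (N_delta i).
rewrite (_ : (fun j => _) = (fun j => if j \in [fset i]%fset then (1 : R[i]) else 0)).
  rewrite (synth_fset psi (fun=> 1) [fset i]%fset).2.
  by congr FS; apply/funext => u; rewrite big_seq_fset1 mul1r.
by apply/funext => j; rewrite inE; case: eqP.
Qed.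

Lemma N_fset h (E : {fset I}) : SS h -> SS (fun i => if i \in E then h i else 0) /\
  SS (fun i => if i \in E then 0 else h i).
Proof.
by move=> sh; split; apply: (@sspace_leZ 1 _ h) => // i; rewrite mul1r;
  case: ifP => _; rewrite ?Normc.normc0 ?normc_ge0.
Qed.

Lemma synth_tail (g : I -> sphere R n -> R) h (E : {fset I}) : synth_cvg g h ->
  synth g (fun i => if i \in E then 0 else h i) =
  fun u => synth g h u - \sum_(i <- E) h i * dist_of (g i) u.
Proof.
move=> ch; have [cE sE] := synth_fset g h E.
have [_] := synth_lin (-1) cE ch; rewrite sE.
rewrite (_ : (fun i => _ + _) = (fun i => if i \in E then 0 else h i)).
  by move=> ->; apply/funext => u; rewrite mulN1r addrC.
by apply/funext => i; case: ifP => _; rewrite ?mulr0 ?add0r// mulN1r addNr.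
Qed.

Definition dual_coef i F j := S (Tinv (dist_of (psi j))) i * S F j.

Lemma dual_fset h (s : seq I) :
  FS (fun u => \sum_(j <- s) h j * dist_of (psi j) u) /\
  Tinv (fun u => \sum_(j <- s) h j * dist_of (psi j) u) =
    fun u => \sum_(j <- s) h j * Tinv (dist_of (psi j)) u.
Proof.
elim: s => [|j s [fs Es]].
  have E : (fun u : testfun R n => \sum_(j <- [::]) h j * dist_of (psi j) u) = fun=> 0.
    by apply/funext => u; rewrite big_nil.
  rewrite E; split; first exact: fspace0.
  have := frame_op_inv_lin 1 fspace0 fspace0.
  rewrite (_ : (fun u => 1 * 0 + 0) = fun=> 0); last by apply/funext => u; rewrite mulr0 addr0.
  move=> h0; apply/funext => u; rewrite big_nil.
  have := congr1 (fun H : dist => H u) h0; rewrite /= mul1r => /eqP.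
  by rewrite -subr_eq0 opprD addNKr oppr_eq0 => /eqP.
have E : (fun u : testfun R n => \sum_(l <- j :: s) h l * dist_of (psi l) u) =
    fun u => h j * dist_of (psi j) u + \sum_(l <- s) h l * dist_of (psi l) u.
  by apply/funext => u; rewrite big_cons.
rewrite E; split; first by apply: fspace_lin => //; exact: dist_of_psi_fspace.
rewrite frame_op_inv_lin//; last exact: dist_of_psi_fspace.
by rewrite Es; apply/funext => u; rewrite big_cons.
Qed.

(* [F |-> <Tinv F, psi_i>] is a bounded functional and the needlet expansion of [F]
   converges unconditionally, so the functional may be applied termwise. *)
Lemma dual_csum i F : FS F -> csum_to (dual_coef i F) (S (Tinv F) i).
Proof.
move=> fF e e0; have [B B0 hB] := N_coord i.
have sF := S_psi_fin fF.
(* The factors bound, in turn, the coordinate functional, [S Tinv] against [S], and [S Tpsi] on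
   sequences. *)
pose c := B * (2 * C1 * (C2 * C2)).
have C1gt0 : 0 < C1 := lt_le_trans ltr01 C1ge1.
have c0 : 0 < c by rewrite !mulr_gt0.
have [E0 hE0] := N_tail sF (divr_gt0 e0 c0).
exists E0 => E /hE0 hE.
have [_ st] := N_fset E sF.
have [cF _ _] := T_psi_bound sF.
have [ft _] := dual_fset (S F) E.
have [_ ftail _] := T_psi_bound st.
have tE : Tpsi (fun j => if j \in E then 0 else S F j) =
    fun u => -1 * (\sum_(j <- E) S F j * dist_of (psi j) u) + F u.
  by rewrite synth_tail// rep//; apply/funext => u; rewrite mulN1r addrC.
have -> : \sum_(j <- E) dual_coef i F j - S (Tinv F) i =
    - S (Tinv (Tpsi (fun j => if j \in E then 0 else S F j))) i.
  rewrite tE frame_op_inv_lin// (dual_fset (S F) E).2 /analysis /pairing.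
  rewrite mulN1r opprD opprK; congr (_ - _); apply: eq_bigr => j _.
  by rewrite /dual_coef /analysis /pairing mulrC.
rewrite normcN -lte_fin; apply: le_lt_trans (hB _) _.
apply: (@le_lt_trans _ _ (c%:E * N (fun j => if j \in E then 0 else S F j)%R)%E).
  rewrite /c (EFinM B) -muleA; apply: lee_wpmul2l; first by rewrite lee_fin ltW.
  apply: le_trans (N_S_inv ftail) _; rewrite (EFinM (2 * C1)) -muleA.
  apply: lee_wpmul2l; first by rewrite lee_fin mulr_ge0.
  by have [] := N_S_T_psi st.
move: hE; rewrite (N_fin st) -EFinM !lte_fin ltr_pdivlMr// mulrC.
by [].
Qed.

Lemma dual_csumE i F : FS F -> csum (dual_coef i F) = S (Tinv F) i.
Proof. by move=> fF; apply: csum_eq; exact: dual_csum. Qed.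

Lemma dual_bounded i : exists2 B : R, 0 < B & forall F, FS F ->
  ((nc (S (Tinv F) i))%:E <= B%:E * fn F)%E.
Proof.
have [B B0 hB] := N_coord i.
have C1gt0 : 0 < C1 := lt_le_trans ltr01 C1ge1.
exists (B * (2 * C1 * C2)); first by rewrite !mulr_gt0.
move=> F fF; apply: le_trans (hB _) _; rewrite (EFinM B) -muleA.
apply: lee_wpmul2l; first by rewrite lee_fin ltW.
apply: le_trans (N_S_inv fF) _; rewrite (EFinM (2 * C1)) -muleA.
by apply: lee_wpmul2l; [rewrite lee_fin mulr_ge0|exact: S_le].
Qed.

Lemma dual_analysis_bound F : FS F -> (N (S (Tinv F)) <= (2 * C1 * C2)%:E * fn F)%E.
Proof.
move=> fF; apply: le_trans (N_S_inv fF) _; rewrite (EFinM (2 * C1)) -muleA.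
by apply: lee_wpmul2l; [rewrite lee_fin mulr_ge0|exact: S_le].
Qed.

(** The coefficients [S (Tinv F)] synthesize [T (Tinv F) = F]. The remainder after a finite set is
    the synthesis of the truncated sequence, so boundedness of [Ttheta] and the smallness of tails
    in [N] give unconditional convergence. *)
Lemma dual_frame F : FS F ->
  [/\ synth_cvg theta (S (Tinv F)), F = Ttheta (S (Tinv F)),
    unconditional_cvg fn theta (S (Tinv F)) F
  & (fn F <= synth_const%:E * N (S (Tinv F)))%E].
Proof.
move=> fF; have [iF TF] := frame_op_invP fF; have sI := S_psi_fin iF.
have [ch fT le] := T_theta_bound sI.
rewrite -[Ttheta (S (Tinv F))]/(T (Tinv F)) TF in fT le; split => //.
  move=> e e0.
  have k0 : 0 < synth_const + 1 by rewrite ltr_wpDl ?synth_const_ge0.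
  have [E0 hE0] := N_tail sI (divr_gt0 e0 k0); exists E0 => E /hE0 hE.
  have [_ st] := N_fset E sI.
  have [_ _ tle] := T_theta_bound st.
  have E1 : Ttheta (fun i => if i \in E then 0 else S (Tinv F) i) =
      fun u => F u - \sum_(i <- E) S (Tinv F) i * dist_of (theta i) u.
    by rewrite synth_tail// -[Ttheta (S (Tinv F))]/(T (Tinv F)) TF.
  rewrite -E1; apply: le_lt_trans tle _.
  move: hE; rewrite (N_fin st) -EFinM !lte_fin ltr_pdivlMr// => hE.
  by apply: le_lt_trans hE; rewrite mulrC ler_wpM2l ?fine_ge0// lerDl.
Qed.

Lemma frame_perturbation :
  [/\ forall h, SS h -> [/\ synth_cvg theta h, FS (Ttheta h)
       & (fn (Ttheta h) <= synth_const%:E * N h)%E],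
    [/\ set_bij FS FS T,
       forall F, FS F -> (fn (T F) <= (synth_const * C2)%:E * fn F)%E
     & forall F, FS F -> (fn (Tinv F) <= (C2 * (2 * C1 * C2))%:E * fn F)%E],
    (forall j, FS (dist_of (psi j))) /\
      (forall (c : R[i]) F G, FS F -> FS G -> FS (fun u => c * F u + G u) /\
         Tinv (fun u => c * F u + G u) = fun u => c * Tinv F u + Tinv G u),
    forall i, exists2 B : R, 0 < B & forall F, FS F -> ((nc (S (Tinv F) i))%:E <= B%:E * fn F)%E
  & forall F, FS F -> [/\ forall i, abs_summable (dual_coef i F),
       forall i, csum (dual_coef i F) = S (Tinv F) i,
       (N (S (Tinv F)) <= (2 * C1 * C2)%:E * fn F)%E
     & [/\ synth_cvg theta (S (Tinv F)), F = Ttheta (S (Tinv F)),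
         unconditional_cvg fn theta (S (Tinv F)) F
       & (fn F <= synth_const%:E * N (S (Tinv F)))%E]]].
Proof.
split.
- exact: T_theta_bound.
- split; [exact: frame_op_bij|exact: frame_op_bound|exact: frame_op_inv_bound].
- split; first exact: dist_of_psi_fspace.
  by move=> c F G fF fG; split; [exact: fspace_lin|exact: frame_op_inv_lin].
- exact: dual_bounded.
- move=> F fF; split.
  + by move=> i; apply: csummable_abs_summable; exists (S (Tinv F) i); exact: dual_csum.
  + by move=> i; exact: dual_csumE.
  + exact: dual_analysis_bound.
  + exact: dual_frame.
Qed.

End FrameOperator.

(** * Needlets and Theta as an instance of the abstract perturbation *)

Section Perturbation.
Variables (R : realType) (n : nat) (sys : system R n).
Hypothesis hS : needlet_system sys.
Variables (A : R) (hA : 1 < A) (K M : nat) (b : R -> nat -> R) (C1 C2 C9 c42 : R).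
Hypotheses (hC1 : quasi_triangle_constant sys A C1)
  (hC2 : needlet_frame_constant sys A C2) (hTS : needlet_reproducing sys A)
  (hC9 : almost_diagonal_constant sys K M A C9)
  (hc42 : coupling_constant sys K M b c42).
Variables (gamma0 : R) (hgamma0 : 0 < gamma0).
Variable theta : {j : nat & node sys j} -> sphere R n -> R.
Hypotheses (htheta : Theta K M b gamma0 theta)
  (hsmall : gamma0 <= epsilon0 C1 C2 / (c42 * C9)).
Local Notation sigma := (@sigma R n).
Local Notation nc z := (Normc.normc z : R).
Local Notation idx := {j : nat & node sys j}.
Local Notation Tpsi := (synth (psi sys)).
Local Notation Spsi := (S_psi sys).

Definition residual_matrix (eta xi : idx) : R :=
  \int[sigma]_x (psi sys eta x * (psi sys xi x - theta xi x)).

Local Notation kappa := (c42 * gamma0).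

Lemma kappa_gt0 : 0 < kappa.
Proof. by have [c421 _] := hc42; rewrite mulr_gt0// (lt_le_trans ltr01). Qed.

(** The smallness condition reads [kappa * C9 <= epsilon0]. In [epsilon0] the numerator is at most 1
    and [2 ^ (1 / tau0)] at least 1, since [tau0] is positive; so [epsilon0 * 2 C1 C2^4 <= 1], and
    [C2^2 <= C2^4]. *)
Lemma contraction_bound : [/\ 0 <= C1, 0 < C2 & 2 * C1 * (C2 * C2 * (kappa * C9)) <= 1].
Proof.
have [C11 _] := hC1; have [C21 _] := hC2; have [C91 _] := hC9; have [c421 _] := hc42.
have C1p : 0 < C1 := lt_le_trans ltr01 C11.
have C2p : 0 < C2 := lt_trans ltr01 C21.
have cC : 0 < c42 * C9 by rewrite mulr_gt0// (lt_le_trans ltr01).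
split; rewrite ?(ltW C1p)//.
have hk : kappa * C9 <= epsilon0 C1 C2.
  by move: hsmall; rewrite ler_pdivlMr// => h; rewrite (_ : _ * C9 = gamma0 * (c42 * C9)) //; ring.
have ln2 : 0 < ln 2 :> R by rewrite ln_gt0// ltr1n.
have t0 : 0 < tau0 C1.
  by rewrite divr_gt0// ltr_wpDr// ln_ge0.
set t := tau0 C1 in t0.
have pge1 (r : R) : 0 <= r -> 1 <= 2 `^ r.
  by move=> r0; rewrite -[leLHS](powRr0 2); apply: ler_powR => //; rewrite ler1n.
have num1 : (1 - 2 `^ (- t)) `^ t^-1 <= 1.
  have a0 : 0 <= 1 - 2 `^ (- t).
    by rewrite subr_ge0 powRN invf_le1 ?powR_gt0// pge1// ltW.
  rewrite -[leRHS](_ : 1 `^ t^-1 = 1); last by rewrite powR1.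
  by apply: ge0_ler_powR; [rewrite invr_ge0 ltW|rewrite nnegrE|rewrite nnegrE|rewrite gerBl powR_ge0].
have den1 : 1 <= 2 `^ t^-1 by rewrite pge1// invr_ge0 ltW.
have C2C2 : 1 <= C2 ^+ 2 by rewrite exprn_ege1// ltW.
have D0 : 0 < 2 * C1 * C2 ^+ 4 * 2 `^ t^-1 by rewrite !mulr_gt0// ?exprn_gt0 ?powR_gt0.
have : epsilon0 C1 C2 * (2 * C1 * C2 ^+ 4) <= 1.
  rewrite /epsilon0 -/t mulrAC ler_pdivrMr// mul1r.
  rewrite [leRHS]mulrC ler_pM ?powR_ge0 ?mulr_ge0 ?exprn_ge0 ?(ltW C1p) ?(ltW C2p)//.
  exact: le_trans den1.
apply: le_trans.
rewrite (_ : 2 * C1 * (C2 * C2 * (kappa * C9)) = kappa * C9 * (2 * C1 * C2 ^+ 2)); last by ring.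
apply: ler_pM => //.
- by rewrite mulr_ge0 ?(ltW kappa_gt0)// (le_trans ler01).
- by rewrite !mulr_ge0 ?exprn_ge0 ?(ltW C1p) ?(ltW C2p).
- by rewrite ler_pM2l ?mulr_gt0// ler_weXn2l// ltW.
Qed.

Lemma omegaC (xi eta : idx) : omega K M xi eta = omega K M eta xi.
Proof.
rewrite /omega; congr (_ * _).
  by rewrite minC maxC.
by rewrite minC /rho edotC.
Qed.

Lemma omega_ge0 (xi eta : idx) : 0 <= omega K M xi eta.
Proof.
rewrite /omega mulr_ge0 ?powR_ge0// invr_ge0 exprn_ge0// addr_ge0// mulr_ge0//.
  by rewrite le_min !ltW ?freq_gt0.
by rewrite acos_ge0// edot_itv.
Qed.

Lemma residual_matrix_le eta xi : `|residual_matrix eta xi| <= kappa * omega K M eta xi.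
Proof. by rewrite omegaC; case: hc42 => _; exact. Qed.

Lemma bddm_residual xi : bddm (fun x => psi sys xi x - theta xi x).
Proof. by apply: bddmB; [exact: bddm_psi|exact: (Theta_bddm _ hgamma0 htheta)]. Qed.

Let A0 : 0 < A := lt_trans ltr01 hA.

Lemma Qset_base : Qset A (- A) 1 1.
Proof.
have h : A^-1 <= 1 by rewrite invf_le1// ltW.
by split; rewrite ?normrN ?gtr0_norm// h ltW.
Qed.

(** The reproducing formula in the space of index [(-A, 1, 1)]. The needlet coefficients of the
    residual are the entries of [residual_matrix], and the resulting identity on test functions no
    longer refers to that space. *)
Lemma dist_of_residual xi u :
  csum_to (fun eta => (residual_matrix eta xi)%:C * dist_of (psi sys eta) u)
    (dist_of (psi sys xi) u - dist_of (theta xi) u).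
Proof.
have he := bddm_residual xi.
rewrite -dist_ofB; [|exact: bddm_psi|exact: (Theta_bddm _ hgamma0 htheta)].
have hF := dist_of_besov hS hA he.
have [h1 h2] := hC2.2 Besov _ _ _ Qset_base.
have SF : sspace sys Besov (- A) 1 1 (Spsi (dist_of (fun x => psi sys xi x - theta xi x))).
  apply: le_lt_trans (h1 _ hF) _; rewrite lte_mul_pinfty ?lee_fin//.
    by case: contraction_bound => _ /ltW.
  by case: hF.
have [sc _ _] := h2 _ SF.
have := synthP u sc; rewrite (hTS Qset_base hF); congr csum_to.
apply/funext => eta; congr (_ * _); rewrite /Spsi pairing_dist_of_zonal; congr (_%:C).
by apply: eq_Rintegral => x _; rewrite mulrC.
Qed.

Section Instance.
Variables (X : scale) (s p q : R) (hQ : Qset A s p q).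
Local Notation N := (snorm sys X s p q).
Local Notation FS := (fspace sys X s p q).
Local Notation fn := (fnorm sys X s p q).

Let p0 : 0 < p.
Proof. by case: hQ => _ /andP[+ _] _; apply: lt_le_trans; rewrite invr_gt0. Qed.

Let q0 : 0 < q.
Proof. by case: hQ => _ _; apply: lt_le_trans; rewrite invr_gt0. Qed.

Lemma fnorm_ge0 F : (0 <= fn F)%E.
Proof. by case: X; [exact: poweR_ge0|exact: Lnorm_ge0]. Qed.

Lemma snorm_nonneg h : (0 <= N h)%E.
Proof. exact: (snorm_ge0 hS X s p0 q0). Qed.

Lemma S_psi_bounded F : FS F -> sspace sys X s p q (Spsi F).
Proof.
move=> fF; have [_ frame] := hC2; have [S_le _] := frame X s p q hQ.
apply: le_lt_trans (S_le F fF) _; rewrite lte_mul_pinfty ?lee_fin//.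
  by case: contraction_bound => _ /ltW.
by case: fF.
Qed.

(** Comparison with a unit sequence; the node [e1] of level 0 supplies an index for it. *)
Lemma snorm_zero_fin : (N (fun=> 0)%R < +oo)%E.
Proof.
have [_ _ _ [_ [n0 _] _ _ _]] := hS.
have e1 : sphere_e1 R n \in node sys 0 by rewrite n0 inE.
apply: le_lt_trans _ (snorm_delta hS X s p0 q0 (Tagged (fun j => node sys j) [` e1]%fset)).
by apply: (le_snorm hS X s p0 q0) => xi; rewrite Normc.normc0 normc_ge0.
Qed.

Lemma needlet_frame_perturbation :
  [/\ forall h, sspace sys X s p q h -> [/\ synth_cvg theta h, FS (synth theta h)
       & (fn (synth theta h) <= (synth_const C1 C2 C9 kappa)%:E * N h)%E],
    [/\ set_bij FS FS (T_op theta),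
       forall F, FS F -> (fn (T_op theta F) <= (synth_const C1 C2 C9 kappa * C2)%:E * fn F)%E
     & forall F, FS F -> (fn (T_inv theta X s p q F) <= (C2 * (2 * C1 * C2))%:E * fn F)%E],
    (forall j, FS (dist_of (psi sys j))) /\
      (forall (c : R[i]) F G, FS F -> FS G -> FS (fun u => c * F u + G u) /\
         T_inv theta X s p q (fun u => c * F u + G u) =
           fun u => c * T_inv theta X s p q F u + T_inv theta X s p q G u),
    forall i, exists2 B : R, 0 < B & forall F, FS F ->
      ((nc (Spsi (T_inv theta X s p q F) i))%:E <= B%:E * fn F)%E
  & forall F, FS F -> [/\ forall i, abs_summable (dual_term theta X s p q i F),
       forall i, dual_fun theta X s p q i F = Spsi (T_inv theta X s p q F) i,
       (N (Spsi (T_inv theta X s p q F)) <= (2 * C1 * C2)%:E * fn F)%E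
     & [/\ synth_cvg theta (Spsi (T_inv theta X s p q F)),
         F = synth theta (Spsi (T_inv theta X s p q F)),
         unconditional_cvg fn theta (Spsi (T_inv theta X s p q F)) F
       & (fn F <= (synth_const C1 C2 C9 kappa)%:E * N (Spsi (T_inv theta X s p q F)))%E]]].
Proof.
have [C1ge1 tri] := hC1; have [C2gt1 frame] := hC2; have [C9ge1 diag] := hC9.
have [_ C2gt0 contract] := contraction_bound.
have [_ triS] := tri X s p q hQ; have [S_le T_bd] := frame X s p q hQ.
have diagQ := diag X s p q hQ; have repQ := @hTS X s p q hQ.
apply: (@frame_perturbation R n idx (psi sys) theta (psi_test (sys := sys)) N FS fn
  C1 C2 C9 kappa (omega K M) residual_matrix).
- exact: C1ge1.
- exact: C2gt0.
- exact: C9ge1.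
- exact: kappa_gt0.
- exact: contract.
- exact: snorm_ge0.
- exact: le_snormZ.
- exact: snorm_sup.
- exact: snorm_tail.
- exact: snorm_coord.
- exact: snorm_delta.
- exact: snorm_zero_fin.
- exact: triS.
- by move=> F [_ ffin]; rewrite fnorm_ge0.
- exact: S_le.
- exact: T_bd.
- exact: repQ.
- exact: omega_ge0.
- exact: residual_matrix_le.
- exact: diagQ.
- exact: dist_of_residual.
Qed.

End Instance.

Lemma synth_const_gt0 : 0 < synth_const C1 C2 C9 kappa.
Proof.
have [C1ge1 _] := hC1; have [C9ge1 _] := hC9; have [_ C2gt0 _] := contraction_bound.
apply: mulr_gt0 => //; apply: mulr_gt0; first exact: lt_le_trans C1ge1.
apply: ltr_pwDl => //; apply: mulr_ge0; first exact: (ltW kappa_gt0).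
exact: le_trans C9ge1.
Qed.

End Perturbation.

Theorem theorem6p9 (R : realType) (n : nat) (sys : system R n)
  (hS : needlet_system sys)
  (A : R) (hA : 1 < A)
  (K : nat) (hK : ~~ odd K) (hKA : Num.ceil (A * n.+2%:R) <= K%:Z)
  (M : nat) (hM : M = (K + n.+2)%N)
  (b : R -> nat -> R) (hb : newton_coeffs n (order_m n M) b)
  (C1 C2 C9 c42 : R)
  (hC1 : quasi_triangle_constant sys A C1)
  (hC2 : needlet_frame_constant sys A C2)
  (hTS : needlet_reproducing sys A)
  (hC9 : almost_diagonal_constant sys K M A C9)
  (hc42 : coupling_constant sys K M b c42)
  (gamma0 : R) (hgamma0 : 0 < gamma0)
  (theta : {j : nat & node sys j} -> sphere R n -> R)
  (htheta : Theta K M b gamma0 theta)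
  (hsmall : gamma0 <= epsilon0 C1 C2 / (c42 * C9)) :
  forall X : scale,
  [/\ exists2 C : R, 0 < C & forall s p q : R, Qset A s p q ->
        forall h, sspace sys X s p q h ->
        [/\ synth_cvg theta h, fspace sys X s p q (synth theta h)
          & (fnorm sys X s p q (synth theta h) <= C%:E * snorm sys X s p q h)%E],
      exists2 C : R, 0 < C & forall s p q : R, Qset A s p q ->
        [/\ forall f, fspace sys X s p q f -> synth_cvg theta (S_psi sys f),
            set_bij (fspace sys X s p q) (fspace sys X s p q) (T_op theta),
            forall f, fspace sys X s p q f ->
              (fnorm sys X s p q (T_op theta f) <= C%:E * fnorm sys X s p q f)%E
          & forall f, fspace sys X s p q f ->
              (fnorm sys X s p q (T_inv theta X s p q f) <=
               C%:E * fnorm sys X s p q f)%E]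
    & exists2 C : R, 0 < C & forall s p q : R, Qset A s p q ->
        [/\ (forall eta, fspace sys X s p q (dist_of (psi sys eta))) /\
            forall xi f, fspace sys X s p q f ->
              abs_summable (dual_term theta X s p q xi f),
            forall xi,
              (forall (c : R[i]) f g,
                fspace sys X s p q f -> fspace sys X s p q g ->
                dual_fun theta X s p q xi (fun u => c * f u + g u) =
                c * dual_fun theta X s p q xi f + dual_fun theta X s p q xi g) /\
              (exists2 B : R, 0 < B & forall f, fspace sys X s p q f ->
                ((Normc.normc (dual_fun theta X s p q xi f))%:E <=
                 B%:E * fnorm sys X s p q f)%E),
            forall f, fspace sys X s p q f ->
              S_dual theta X s p q f =
                S_psi sys (T_inv theta X s p q (synth (psi sys) (S_psi sys f))) /\
              S_dual theta X s p q f = S_psi sys (T_inv theta X s p q f),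
            forall f, fspace sys X s p q f ->
              (snorm sys X s p q (S_dual theta X s p q f) <=
               C%:E * fnorm sys X s p q f)%E
          & forall f, fspace sys X s p q f ->
              [/\ synth_cvg theta (S_dual theta X s p q f),
                  f = synth theta (S_dual theta X s p q f),
                  unconditional_cvg (fnorm sys X s p q) theta
                    (S_dual theta X s p q f) f
                & (C^-1%:E * fnorm sys X s p q f <=
                   snorm sys X s p q (S_dual theta X s p q f) <=
                   C%:E * fnorm sys X s p q f)%E]]].
Proof.
move=> X.
have [C1ge1 _] := hC1; have [_ C2gt0 _] := contraction_bound hC1 hC2 hC9 hc42 hgamma0 hsmall.
have C1gt0 : 0 < C1 := lt_le_trans ltr01 C1ge1.
have Ca0 := synth_const_gt0 hC1 hC2 hC9 hc42 hgamma0 hsmall.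
set Ca := synth_const C1 C2 C9 (c42 * gamma0) in Ca0.
(* The operator bounds obtained here involve only [C1], [C2], [C9] and [c42 * gamma0], never
   [(s, p, q)]; this is the uniformity claimed. *)
have main s p q (hQ : Qset A s p q) :=
  needlet_frame_perturbation hS hA hC1 hC2 hTS hC9 hc42 hgamma0 htheta hsmall X hQ.
have D0 : 0 < 2 * C1 * C2 by rewrite !mulr_gt0.
have fle s p q c c' F : c <= c' -> (c%:E * fnorm sys X s p q F <= c'%:E * fnorm sys X s p q F)%E.
  by move=> cc'; apply: lee_wpmul2r; [exact: fnorm_ge0|rewrite lee_fin].
split.
- exists Ca => // s p q hQ h sh.
  by have [H _ _ _ _] := main s p q hQ; exact: H.
- exists (Ca * C2 + C2 * (2 * C1 * C2)); first by rewrite addr_gt0// mulr_gt0.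
  move=> s p q hQ; have [Ha [Hbij HT HTi] _ _ _] := main s p q hQ; split => //.
  + move=> f ff; have sf := S_psi_bounded hC1 hC2 hC9 hc42 hgamma0 hsmall hQ ff.
    by have [] := Ha _ sf.
  + move=> f ff; apply: le_trans (HT f ff) _; apply: fle.
    by rewrite lerDl mulr_ge0// ltW.
  + move=> f ff; apply: le_trans (HTi f ff) _; apply: fle.
    by rewrite lerDr mulr_ge0// ltW.
(* One constant for both sides of the norm equivalence: [2 * C1 * C2] bounds the dual analysis
   operator, and [Ca] bounds [f] by its dual coefficients. *)
- exists (Ca + 2 * C1 * C2); first by rewrite addr_gt0.
  move=> s p q hQ; have [_ _ [Hpsi Hlin] Hbd Hdual] := main s p q hQ.
  have dualE f : fspace sys X s p q f ->
      S_dual theta X s p q f = S_psi sys (T_inv theta X s p q f).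
    by move=> ff; apply/funext => xi; have [_ + _ _] := Hdual f ff; exact.
  split.
  + by split => // xi f ff; have [+ _ _ _] := Hdual f ff; exact.
  + move=> xi; split.
      move=> c f g ff fg; have [fl Tl] := Hlin c f g ff fg.
      have [_ -> _ _] := Hdual _ fl; have [_ -> _ _] := Hdual _ ff.
      by have [_ -> _ _] := Hdual _ fg; rewrite Tl.
    have [B B0 hB] := Hbd xi; exists B => // f ff.
    by have [_ -> _ _] := Hdual _ ff; exact: hB.
  + by move=> f ff; rewrite (dualE f ff) (hTS _ _ _ _ hQ _ ff).
  + move=> f ff; rewrite (dualE f ff); have [_ _ le _] := Hdual _ ff.
    by apply: le_trans le _; apply: fle; rewrite lerDr; exact: ltW Ca0.
  + move=> f ff; rewrite (dualE f ff); have [_ _ le [H1 H2 H3 H4]] := Hdual _ ff.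
    split => //; apply/andP; split; last first.
      by apply: le_trans le _; apply: fle; rewrite lerDr; exact: ltW Ca0.
    have C0 : 0 < Ca + 2 * C1 * C2 by rewrite addr_gt0.
    apply: (@le_trans _ _ ((Ca + 2 * C1 * C2)^-1%:E *
        ((Ca + 2 * C1 * C2)%:E * snorm sys X s p q (S_psi sys (T_inv theta X s p q f))))%E).
      apply: lee_wpmul2l; first by rewrite lee_fin invr_ge0 ltW.
      apply: le_trans H4 _; apply: lee_wpmul2r; last by rewrite lee_fin lerDl ltW.
      exact: (snorm_nonneg hS hA X hQ).
    by rewrite muleA -EFinM mulVf ?gt_eqF// mul1e.
Qed.
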